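(* Let $Q$ be a rooted tree quiver. (1) Given $T$, a rooted tree quiver over $Q$, Algorithm 1 (written out in the context) returns the summands in the indecomposable decomposition of $\Bbbk_T\in\mathbf{rep}(Q)$ in $O(|T|^2)$ time. (2) Given $(G,h)$, a $Q$-filtered graph, Algorithm 2 (written out in the context) returns the summands in the indecomposable decomposition of $H_0(h)\in\mathbf{rep}(Q)$ in $O(|G|^2)$ time.
   Context: Fix a field $\Bbbk$. All quivers are finite and all representations are finite dimensional over $\Bbbk$; $\mathbf{rep}(Q)$ is the category of representations of $Q$, and every representation is a finite direct sum of indecomposables, unique up to isomorphism and reordering. A tree quiver is a quiver whose underlying undirected graph is a tree. A rooted tree quiver is a tree quiver with exactly one vertex $\sigma$ of out-degree zero, called its root. For vertices $x,y$ of a tree quiver $Q$, with vertex set $Q_0$, write $x\leq_Q y$ if there is a (possibly empty) directed path from $x$ to $y$. In a rooted tree quiver every non-root vertex $x$ has a unique cover in this order, its successor; the set $\mathrm{pred}(x)$ of predecessors of $x$ consists of the non-root vertices whose successor is $x$. The level of a vertex is the length of the unique directed path from it to the root, and $\mathrm{height}(T)$ is the maximum level of a vertex of $T$. A quiver morphism $f:Q'\to Q$ is a pair of functions $f_0,f_1$ on vertices and edges respecting sources and targets; a quiver over $Q$ is a quiver with a quiver morphism to $Q$. A rooted tree quiver over $Q$ is a pair $(T,f_T)$ with $T$ a rooted tree quiver and $f_T:T\to Q$ a quiver morphism sending root to root. For a quiver morphism $f:Q'\to Q$, the push-forward is $f_*(V)_x=\bigoplus_{y\in f_0^{-1}(x)}V_y$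 and $f_*(V)_\alpha=\sum_{\beta\in f_1^{-1}(\alpha)}V_\beta$. The constant representation $\mathbb{1}_T$ has $\Bbbk$ at every vertex and the identity at every arrow. The linearization of a quiver $(T,f_T:T\to Q)$ over $Q$ is $\Bbbk_T:=(f_T)_*(\mathbb{1}_T)\in\mathbf{rep}(Q)$. Subquivers of a quiver over $Q$, and their connected components, are regarded as quivers over $Q$ by restriction. Let $G=(V,E)$ be a finite simple undirected graph. A $Q$-filtration of $G$ is a pair of functions $h=(h_V:V\to Q_0,\ h_E:E\to Q_0)$ with $h_V(x),h_V(y)\leq_Q h_E(\{x,y\})$ for every $\{x,y\}\in E$; then $(G,h)$ is a $Q$-filtered graph. It induces a functor from the path category of $Q$ (objects: vertices; morphisms: directed paths) to topological spaces, sending $x\in Q_0$ to the geometric realization of the subgraph of $G$ spanned by the vertices and edges whose $h$-value $y$ satisfies $y\leq_Q x$, with inclusions as structure maps. Applying zeroth homology with coefficients in $\Bbbk$ gives $H_0(h)\in\mathbf{rep}(Q)$. The level of a vertex $v$ (respectively edge $e$) of $G$ is the level of $h_V(v)$ (respectively $h_E(e)$) in $Q$. $|T|$ and $|G|$ denote the sizes (numbers of vertices and edges) of $T$ and $G$. The summands are returned as a quiver $S$ over $Q$: the linearizations $\Bbbk_C$ of the connected components $C$ of $S$ are the indecomposable summands. Algorithm 1. Input: a rooted tree quiver $(T,f_T:T\to Q)$ over the rooted tree quiver $Q$. Output: $S\subseteq T$. (Throughout, $\mathrm{pred}(x)$ means predecessors in $T$.) - $S\leftarrow T$; $R\leftarrow$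 empty relation on the vertices of $S$. - For $\ell=\mathrm{height}(T),\mathrm{height}(T)-1,\dots,1,0$: (a) For each vertex $x$ of $S$ of level $\ell$: let $\mathcal{A}$ be a maximal set of pairwise $R$-incomparable predecessors of $x$ in $T$, such that every predecessor $x'$ of $x$ in $T$ satisfies $x'\,R\,a$ for some $a\in\mathcal{A}$; then, for each $p\in\mathrm{pred}(x)\setminus\mathcal{A}$, delete the edge $p\to x$ from $S$. (b) For all vertices $x,y$ of $S$ of level $\ell$: if for every $p\in\mathrm{pred}(x)$ there exists $q\in\mathrm{pred}(y)$ such that $p\,R\,q$, then add $(x,y)$ to $R$ (i.e. $x\,R\,y$). - Return $S$. Algorithm 2. Input: a graph $G=(V,E)$ and a $Q$-filtration $h=(h_V,h_E)$, with $Q$ a rooted tree quiver. Output: a quiver $(S,f_S:S\to Q)$ over $Q$. - $S\leftarrow$ empty quiver; $(T,f_T:T\to Q)\leftarrow$ output of Algorithm 3 on $(G,h)$. - For each connected component $T'$ of $T$: $(S',f_{S'})\leftarrow$ output of Algorithm 1 on $(T',f_T|_{T'})$; then $(S,f_S)\leftarrow(S\sqcup S',f_S\sqcup f_{S'})$. - Return $S$. Algorithm 3 (subroutine of Algorithm 2). Input: as for Algorithm 2. Output: a disjoint union $T$ of rooted tree quivers over $Q$, with its map $f_T$ to $Q$. It uses a union-find (disjoint-set) data structure $\mathsf{uf}$, with operations add (new singleton class), union (merge the classes of two elements), find (representative of the class of an element), and representatives (the set of representatives of all classes). - $T\leftarrow$ empty quiver; $f_T\leftarrow$ empty function to $Q_0$;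 $\mathsf{uf}\leftarrow$ empty union-find; $\mathsf{max}_\ell\leftarrow$ largest level $\ell$ of $Q$ such that $G$ has vertices of level $\ell$. - For $\ell=\mathsf{max}_\ell,\mathsf{max}_\ell-1,\dots,1,0$: (a) for each vertex $v$ of $G$ of level $\ell$: $\mathsf{uf}.\mathrm{add}(v)$; (b) for each edge $\{v,w\}$ of $G$ of level $\ell$: $\mathsf{uf}.\mathrm{union}(v,w)$; (c) $T_0^\ell\leftarrow\mathsf{uf}.\mathrm{representatives}()$, and add $T_0^\ell\times\{\ell\}$ to the vertices of $T$ (the product with $\{\ell\}$ makes it disjoint); (d) for each $v\in T_0^\ell$: $f_T(v):=h_V(v)$; (e) for each $v\in T_0^{\ell+1}$ (empty when $\ell=\mathsf{max}_\ell$): $w\leftarrow\mathsf{uf}.\mathrm{find}(v)$, and add $((v,\ell+1),(w,\ell))$ to the edges of $T$. - Return $(T,f_T:T\to Q)$. For the time bound in (2), one needs $|Q|\in O(|G|)$; this is guaranteed by restricting the codomain of $h$ to $\mathrm{im}(h)\cup\{\sigma\}\subseteq Q$, which is again a rooted tree poset, and in practice is achieved by skipping, in the loop over $\ell$ of Algorithm 3, the levels that contain no vertex or edge of $G$.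
   Formalization: Three mends: in Algorithm 1(b), x R y also requires f_T(x)=f_T(y); in Algorithm 3(d), f_T(v) is the vertex of level l above h_V(v); the time bounds are for an implementation that does not visit pairs of vertices with exactly one predecessor each, since visiting all pairs can take cubic time. *)

(* Defs.v *)
From HB Require Import structures.
From mathcomp Require Import all_boot all_order all_algebra.
From mathcomp Require Import all_classical all_reals all_analysis.
Set Implicit Arguments.
Unset Strict Implicit.
Unset Printing Implicit Defensive.
Import Order.TTheory GRing.Theory Num.Theory.
Import numFieldNormedType.Exports.
Local Open Scope nat_scope.

(** * Quivers *)

Record quiver := Quiver {
  vertex :> finType;
  arrow : finType;
  source : arrow -> vertex;
  target : arrow -> vertex }.
Arguments source {q} a.
Arguments target {q} a.

Definition qsize (Q : quiver) : nat := #|vertex Q| + #|arrow Q|.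

Section Trees.
Variable Q : quiver.
Implicit Types (x y : Q) (d : arrow Q * bool).

(* A dart is an arrow with a direction of traversal; walks in the underlying
   undirected multigraph are sequences of darts. *)
Definition dsource d : Q := if d.2 then source d.1 else target d.1.
Definition dtarget d : Q := if d.2 then target d.1 else source d.1.

Fixpoint walk x (w : seq (arrow Q * bool)) y : Prop :=
  if w is d :: w' then dsource d = x /\ walk (dtarget d) w' y else x = y.

(* The underlying graph is nonempty, connected, and has no cycle.  A cycle is
   a nonempty closed walk with distinct arrows and distinct vertices, so loops
   and pairs of parallel or opposite arrows count as cycles. *)
Definition tree_quiver : Prop :=
  [/\ 0 < #|Q|,
      forall x y, exists w, walk x w y
    & forall x w, walk x w x -> uniq [seq d.1 | d <- w] ->
        uniq [seq dsource d | d <- w] -> w = [::]].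

Definition sink x : bool := [forall a : arrow Q, source a != x].

Definition rooted_tree : Prop := tree_quiver /\ #|[set x | sink x]| = 1.

Definition adj x y : bool :=
  [exists a : arrow Q, (source a == x) && (target a == y)].

Definition leQ x y : bool := connect adj x y.

Definition predecessors x : {set Q} := [set p | adj p x].

Definition level x : nat :=
  find (fun n => [exists p : n.-tuple Q, path adj x p && sink (last x p)])
       (iota 0 #|Q|).

Definition height : nat := \max_(x : Q) level x.

Definition uadj x y : bool := adj x y || adj y x.

Definition components : {set {set Q}} :=
  [set [set y | connect uadj x y] | x : Q].

Definition component := {C : {set Q} | C \in components}.

End Trees.

(** * Quivers over [Q] *)

Record qmorph (T Q : quiver) := QMorph {
  on_vertex :> T -> Q;
  on_arrow : arrow T -> arrow Q;
  on_source : forall b, source (on_arrow b) = on_vertex (source b);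
  on_target : forall b, target (on_arrow b) = on_vertex (target b) }.

Definition root_to_root (T Q : quiver) (f : qmorph T Q) : Prop :=
  forall x : T, sink x -> sink (f x).

Section Subquivers.
Variables (T Q : quiver) (f : qmorph T Q).

Definition keep_arrows (S : {set arrow T}) : quiver :=
  @Quiver T {b : arrow T | b \in S}
    (fun b => source (val b)) (fun b => target (val b)).

Definition keep_arrows_over (S : {set arrow T}) : qmorph (keep_arrows S) Q :=
  @QMorph (keep_arrows S) Q f (fun b => on_arrow f (val b))
    (fun b => on_source f (val b)) (fun b => on_target f (val b)).

Definition full_on (A : {set T}) : quiver :=
  @Quiver {x : T | x \in A}
    {b : arrow T | (source b \in A) && (target b \in A)}
    (fun b => exist (fun x => x \in A) (source (val b)) (proj1 (andP (valP b))))
    (fun b => exist (fun x => x \in A) (target (val b)) (proj2 (andP (valP b)))).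

Definition full_on_over (A : {set T}) : qmorph (full_on A) Q :=
  @QMorph (full_on A) Q (fun x => f (val x)) (fun b => on_arrow f (val b))
    (fun b => on_source f (val b)) (fun b => on_target f (val b)).

End Subquivers.

(** * Finite direct sums of vector spaces *)

Section DirectSum.
Local Open Scope ring_scope.
Variables (k : fieldType) (I : finType) (V : I -> vectType k).

Definition dsum := {dffun forall i, V i}.
HB.instance Definition _ := Choice.on dsum.
Implicit Types u v w : dsum.

Definition dsum_zero : dsum := [ffun i => 0 : V i].
Definition dsum_opp v : dsum := [ffun i => - v i].
Definition dsum_add v w : dsum := [ffun i => v i + w i].
Definition dsum_scale (c : k) v : dsum := [ffun i => c *: v i].

Fact dsum_addA : associative dsum_add.
Proof. by move=> u v w; apply/ffunP=> i; rewrite !ffunE addrA. Qed.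
Fact dsum_addC : commutative dsum_add.
Proof. by move=> u v; apply/ffunP=> i; rewrite !ffunE addrC. Qed.
Fact dsum_add0 : left_id dsum_zero dsum_add.
Proof. by move=> u; apply/ffunP=> i; rewrite !ffunE add0r. Qed.
Fact dsum_addN : left_inverse dsum_zero dsum_opp dsum_add.
Proof. by move=> u; apply/ffunP=> i; rewrite !ffunE addNr. Qed.

HB.instance Definition _ :=
  GRing.isZmodule.Build dsum dsum_addA dsum_addC dsum_add0 dsum_addN.

Fact dsum_scaleA c d v : dsum_scale c (dsum_scale d v) = dsum_scale (c * d) v.
Proof. by apply/ffunP=> i; rewrite !ffunE scalerA. Qed.
Fact dsum_scale1 : left_id 1 dsum_scale.
Proof. by move=> v; apply/ffunP=> i; rewrite !ffunE scale1r. Qed.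
Fact dsum_scaleDr : right_distributive dsum_scale +%R.
Proof. by move=> c u v; apply/ffunP=> i; rewrite !ffunE scalerDr. Qed.
Fact dsum_scaleDl v : {morph dsum_scale^~ v : c d / c + d}.
Proof. by move=> c d; apply/ffunP=> i; rewrite !ffunE scalerDl. Qed.

HB.instance Definition _ := GRing.Zmodule_isLmodule.Build k dsum
  dsum_scaleA dsum_scale1 dsum_scaleDr dsum_scaleDl.

Import VectorInternalTheory.

Let coord : finType := {i : I & 'I_(dim (V i))}.
Let mkcoord i (c : 'I_(dim (V i))) : coord := Tagged (fun i => 'I_(dim (V i))) c.

Fact dsum_vect_iso : Vector.axiom #|coord| dsum.
Proof.
exists (fun v : dsum => \row_j v2r (v (tag (enum_val j))) 0 (tagged (enum_val j))).
  by move=> c u v; apply/rowP=> j; rewrite !mxE !ffunE linearP !mxE.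
exists (fun r : 'rV[k]_#|coord| => [ffun i : I =>
    r2v (\row_(c < dim (V i)) r 0 (enum_rank (mkcoord c))) : V i] : dsum) => [v|r].
  apply/ffunP=> i; rewrite ffunE; apply: (canLR v2rK); apply/rowP=> c.
  by rewrite !mxE enum_rankK.
apply/rowP=> j; rewrite !mxE ffunE r2vK !mxE; congr (r 0 _).
by apply: (canLR enum_valK); case: (enum_val j).
Qed.

HB.instance Definition _ := Lmodule_hasFinDim.Build k dsum dsum_vect_iso.

Definition dsum_proj (i : I) : 'Hom(dsum, V i) := linfun (fun v : dsum => v i).

Definition dsum_inj (i : I) : 'Hom(V i, dsum) :=
  linfun (fun w : V i => finfun (dfwith (fun j => 0 : V j) i w) : dsum).

End DirectSum.

(** * Representations *)

Record rep (k : fieldType) (Q : quiver) := Rep {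
  space_at :> Q -> vectType k;
  map_at : forall a : arrow Q, 'Hom(space_at (source a), space_at (target a)) }.

Section Representations.
Local Open Scope ring_scope.
Variables (k : fieldType) (Q : quiver).
Implicit Types M N : rep k Q.

Record rep_hom M N := RepHom {
  hom_at :> forall x : Q, 'Hom(M x, N x);
  hom_natural : forall (a : arrow Q) (v : M (source a)),
    hom_at (target a) (map_at M a v) = map_at N a (hom_at (source a) v) }.

Definition zero_rep M : Prop := forall (x : Q) (v : M x), v = 0.

(* [M] is a direct sum (biproduct) of the family [W]. *)
Definition is_direct_sum M (I : finType) (W : I -> rep k Q) : Prop :=
  exists (inj : forall i, rep_hom (W i) M) (proj : forall i, rep_hom M (W i)),
    [/\ forall i x w, proj i x (inj i x w) = w,
        forall i j x w, i != j -> proj j x (inj i x w) = 0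
      & forall x v, v = \sum_i inj i x (proj i x v)].

Definition indecomposable M : Prop :=
  ~ zero_rep M /\
  forall W : bool -> rep k Q, is_direct_sum M W ->
    zero_rep (W true) \/ zero_rep (W false).

Definition const_rep : rep k Q := @Rep k Q (fun=> k^o) (fun=> \1%VF).

End Representations.

Section PushForward.
Local Open Scope ring_scope.
Variables (k : fieldType) (T Q : quiver) (f : qmorph T Q).

Definition fiber (x : Q) := {y : T | f y == x}.
Definition arrow_fiber (a : arrow Q) := {b : arrow T | on_arrow f b == a}.

Fact fiber_source a (b : arrow_fiber a) : f (source (val b)) == source a.
Proof. by rewrite -on_source (eqP (valP b)). Qed.
Fact fiber_target a (b : arrow_fiber a) : f (target (val b)) == target a.
Proof. by rewrite -on_target (eqP (valP b)). Qed.

Definition in_source a (b : arrow_fiber a) : fiber (source a) :=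
  exist (fun y => f y == source a) (source (val b)) (fiber_source b).
Definition in_target a (b : arrow_fiber a) : fiber (target a) :=
  exist (fun y => f y == target a) (target (val b)) (fiber_target b).

Definition push_forward (V : rep k T) : rep k Q :=
  let U (x : Q) (y : fiber x) : vectType k := V (val y) in
  @Rep k Q (fun x => dsum (@U x))
    (fun a => \sum_(b : arrow_fiber a)
       (dsum_inj (@U (target a)) (in_target b) \o
        (map_at V (val b) \o dsum_proj (@U (source a)) (in_source b))))%VF.

Definition linearization : rep k Q := push_forward (const_rep k T).

End PushForward.

(* [M] is the direct sum of the linearizations of the connected components of
   the subquiver with arrows [S], and these are indecomposable. *)
Definition summands_of (k : fieldType) (T Q : quiver) (f : qmorph T Q)
    (S : {set arrow T}) (M : rep k Q) : Prop :=
  let kC (C : component (keep_arrows S)) :=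
    linearization k (full_on_over (keep_arrows_over f S) (val C)) in
  is_direct_sum M kC /\ forall C, indecomposable (kC C).

(** * Decomposing the linearization of a rooted tree quiver over [Q] *)

Section PruneTree.
Variables (T Q : quiver) (f : qmorph T Q).

(* the arrows kept so far, and the relation [R] *)
Definition prune_state := ({set arrow T} * {set T * T})%type.

Definition incomparable (R : {set T * T}) (A : {set T}) : bool :=
  [forall a in A, forall b in A, (a != b) ==> ((a, b) \notin R)].

Definition selection (R : {set T * T}) (x : T) (A : {set T}) : Prop :=
  maxset (fun B => (B \subset predecessors x) && incomparable R B) A /\
  forall p, p \in predecessors x -> exists2 a, a \in A & (p, a) \in R.

(* The pass for the level [l]:
   (a) at each vertex [x] of level [l], delete the arrows from the
       predecessors outside of the chosen set [A x];
   (b) relate [x] to [y] if every predecessor of [x] is related to one of [y].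
   Only vertices lying over the same vertex of [Q] may be related: otherwise
   the quiver a -> s <- b over itself would lose one of its arrows. *)
Definition prune_pass (l : nat) (st st' : prune_state) : Prop :=
  exists A : T -> {set T},
  [/\ forall x, level x = l -> selection st.2 x (A x),
      st'.1 = st.1 :\: [set b | (level (target b) == l) &&
                                (source b \notin A (target b))]
    & st'.2 = st.2 :|: [set xy : T * T |
        [&& level xy.1 == l, level xy.2 == l, f xy.1 == f xy.2 &
            [forall p in predecessors xy.1, exists q in predecessors xy.2,
               (p, q) \in st.2]]]].

(* [S] is a possible result of the passes for [height T], ..., 1, 0, starting
   with all arrows and the empty relation; [st l] is the state after the pass
   for [l]. *)
Definition prune_tree (S : {set arrow T}) : Prop :=
  exists st : nat -> prune_state,
  [/\ st (height T).+1 = ([set: arrow T]%SET, finset.set0),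
      forall l, l <= height T -> prune_pass l (st l.+1) (st l)
    & S = (st 0).1].

End PruneTree.

(** * Filtered graphs *)

Record sgraph := SGraph {
  gvertex :> finType;
  gedges : {set {set gvertex}};
  gedges_card : forall e, e \in gedges -> #|e| = 2 }.

Definition gedge (G : sgraph) : finType := {e : {set G} | e \in gedges G}.

Definition gsize (G : sgraph) : nat := #|gvertex G| + #|gedge G|.

Record filtration (Q : quiver) (G : sgraph) := Filtration {
  hV : G -> Q;
  hE : gedge G -> Q;
  hVE : forall (e : gedge G) (v : G), v \in val e -> leQ (hV v) (hE e) }.

(** * Zeroth singular homology of a filtered graph *)

Section Homology.
Local Open Scope classical_set_scope.
Local Open Scope ring_scope.
Variables (R : realType) (k : fieldType).

Section Space.
Variables (I : finType) (X : set (I -> R)).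

(* Paths (singular 1-simplices) of a subspace of [R^I]; continuity into the
   product is coordinatewise. *)
Definition path_in (g : R -> I -> R) : Prop :=
  (forall t : R, 0 <= t <= 1 -> X (g t)) /\
  forall i, {within `[0, 1], continuous (fun t => g t i)}.

(* A singular 0-chain is given by a list [c] of weighted points, a singular
   1-chain by a list [b] of weighted paths. *)
Definition coef0 (c : seq (k * (I -> R))) (p : I -> R) : k :=
  \sum_(i <- c | i.2 == p) i.1.

Definition boundary (b : seq (k * (R -> I -> R))) : seq (k * (I -> R)) :=
  [seq (j.1, j.2 1) | j <- b] ++ [seq (- j.1, j.2 0) | j <- b].

(* [cl] exhibits [H] as the quotient of the 0-chains of [X] by the boundaries
   of the 1-chains: the linear extension of [cl] to 0-chains is onto, and its
   kernel consists of the boundaries. *)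
Definition is_H0 (H : vectType k) (cl : (I -> R) -> H) : Prop :=
  (forall w : H, exists2 c : seq (k * (I -> R)),
     (forall i, i \in c -> X i.2) & w = \sum_(i <- c) i.1 *: cl i.2) /\
  forall c : seq (k * (I -> R)), (forall i, i \in c -> X i.2) ->
    (\sum_(i <- c) i.1 *: cl i.2 = 0 <->
     exists2 b : seq (k * (R -> I -> R)),
       (forall j, j \in b -> path_in j.2) & coef0 c = coef0 (boundary b)).

End Space.

Variables (Q : quiver) (G : sgraph) (h : filtration Q G).

(* Geometric realization of the subgraph of [G] at [q], in barycentric
   coordinates. *)
Definition realization (q : Q) : set (G -> R) :=
  [set t | [/\ forall v, 0 <= t v, \sum_v t v = 1
    & (exists2 v, leQ (hV h v) q & forall u, t u != 0 -> u = v) \/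
      (exists2 e : gedge G, leQ (hE h e) q &
                            forall u, t u != 0 -> u \in val e)]].

Definition is_H0_rep (H : rep k Q) : Prop :=
  exists cl : forall q, (G -> R) -> H q,
    (forall q, is_H0 (realization q) (cl q)) /\
    forall (a : arrow Q) t, realization (source a) t ->
      map_at H a (cl (source a) t) = cl (target a) t.

End Homology.

(** * Decomposing the zeroth homology of a filtered graph *)

Section MergeForest.
Variables (Q : quiver) (G : sgraph) (h : filtration Q G).

Definition max_level : nat := \max_(v : G) level (hV h v).

(* A union-find structure is given by the set of its classes and a choice of
   representatives.  The pass for the level [l] (a) adds the vertices of level
   [l] and (b) merges the classes of the endpoints of the edges of level [l]. *)
Definition uf_add (P : {set {set G}}) (v : G) : {set {set G}} :=
  [set v] |: P.

Definition uf_union (P : {set {set G}}) (e : {set G}) : {set {set G}} :=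
  (\bigcup_(v in e) finset.pblock P v) |: [set B in P | [disjoint B & e]].

Definition uf_pass (P : {set {set G}}) (l : nat) : {set {set G}} :=
  foldl uf_union
    (foldl uf_add P [seq v <- enum G | level (hV h v) == l])
    [seq val e | e <- enum (gedge G) & level (hE h e) == l].

(* the classes after the passes for [max_level], ..., [l] *)
Definition uf_classes (l : nat) : {set {set G}} :=
  foldl uf_pass finset.set0 (rev (iota l (max_level.+1 - l))).

(* [fnd l] is the find operation after the pass for [l]. *)
Definition valid_find (fnd : nat -> G -> G) : Prop :=
  forall l B, l <= max_level -> B \in uf_classes l ->
    exists2 r, r \in B & forall v, v \in B -> fnd l v = r.

Variable fnd : nat -> G -> G.

Definition uf_representatives (l : nat) : {set G} :=
  [set fnd l v | v in finset.cover (uf_classes l)].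

(* the vertex of level [l] above [q] *)
Definition ancestor (q : Q) (l : nat) : Q :=
  odflt q [pick y | leQ q y && (level y == l)].

Definition merge_vertex : finType :=
  {x : G * 'I_(max_level.+1) | x.1 \in uf_representatives x.2}.

(* A representative of a class at level [l] can be a vertex of [G] of larger
   level, so the image of [(v, l)] is the vertex of level [l] above [hV v]. *)
Definition merge_map (x : merge_vertex) : Q := ancestor (hV h (val x).1) (val x).2.

(* Arrows [(v, l+1) -> (find v, l)], recorded together with the arrow of [Q]
   that they lie over. *)
Definition is_merge_arrow (t : merge_vertex * merge_vertex * arrow Q) : bool :=
  let: (x, y, a) := t in
  [&& val (val x).2 == (val (val y).2).+1,
      (val y).1 == fnd (val (val y).2) (val x).1,
      source a == merge_map x & target a == merge_map y].

Definition merge_arrow : finType := {t | is_merge_arrow t}.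

Definition merge_forest : quiver :=
  @Quiver merge_vertex merge_arrow (fun b => (val b).1.1) (fun b => (val b).1.2).

Fact merge_forest_source (b : merge_arrow) : source (val b).2 = merge_map (val b).1.1.
Proof. by case: b => -[[x y] a] /= /and4P[_ _ /eqP]. Qed.
Fact merge_forest_target (b : merge_arrow) : target (val b).2 = merge_map (val b).1.2.
Proof. by case: b => -[[x y] a] /= /and4P[_ _ _ /eqP]. Qed.

Definition merge_forest_over : qmorph merge_forest Q :=
  @QMorph merge_forest Q merge_map (fun b => (val b).2)
    merge_forest_source merge_forest_target.

(* [S] is a possible result of running [prune_tree] on every connected
   component. *)
Definition prune_forest (S : {set arrow merge_forest}) : Prop :=
  forall C : component merge_forest,
    prune_tree (full_on_over merge_forest_over (val C))
      [set b : arrow (full_on (val C)) | val b \in S].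

End MergeForest.

(** * Running time *)

(* A timed computation returns a value and its number of steps.  The model is
   a random access machine with unit cost: [step] performs a bounded number of
   elementary operations (reading or writing an entry of a table, comparing,
   extending a list), [each] runs through a list and charges every iteration,
   and [alloc] charges the size of the allocated table.  The tables [key] and
   [R] of [run_tree] and [st_map] of [run_merge_forest] are not charged: their
   entries are written before they are read, so they need no initialization. *)
Definition timed (A : Type) : Type := (A * nat)%type.

Definition ret A (a : A) : timed A := (a, 0).
Definition step A (a : A) : timed A := (a, 1).
Definition alloc A B (n : nat) (t : A -> B) : timed (A -> B) := (t, n).
Definition bind A B (m : timed A) (g : A -> timed B) : timed B :=
  let r := g m.1 in (r.1, m.2 + r.2).

Notation "'let*' p ':=' m 'in' n" := (bind m (fun p => n))
  (at level 200, p strict pattern, n at level 200, right associativity).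

Fixpoint each I A (s : seq I) (st : A) (body : I -> A -> timed A) : timed A :=
  if s is i :: s' then
    let* _ := step tt in let* st' := body i st in each s' st' body
  else ret st.

Definition upd (A : eqType) B (t : A -> B) (a : A) (b : B) : A -> B :=
  fun x => if x == a then b else t x.

(* Quivers given by lists of vertices and arrows. *)
Section Lists.
Variables (X Y : eqType) (src tgt : Y -> X) (vs : seq X) (arrs : seq Y).

Definition in_arrows : timed (X -> seq Y) :=
  let* t := alloc (size vs) (fun=> [::]) in
  each arrs t (fun b t =>
    let* x := step (tgt b) in let* l := step (t x) in step (upd t x (b :: l))).

Definition list_sinks : timed (seq X) :=
  let* out := alloc (size vs) (fun=> false) in
  let* out := each arrs out (fun b out =>
    let* x := step (src b) in step (upd out x true)) in
  each vs [::] (fun x rs =>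
    let* o := step (out x) in step (if o then rs else x :: rs)).

(* the vertices below those of [l], level by level, the deepest level first *)
Fixpoint layers (t : X -> seq Y) (fuel : nat) (l : seq X)
    (acc : seq (seq X)) : timed (seq (seq X)) :=
  if fuel is n.+1 then
    if l is [::] then step acc else
    let* l' := each l [::] (fun x l' =>
      let* bs := step (t x) in
      each bs l' (fun b l' => let* p := step (src b) in step (p :: l'))) in
    layers t n l' (l :: acc)
  else ret acc.

(* An implementation of [prune_tree] for the trees of a disjoint union of rooted
   trees.  The relation is stored in the table [R], in which a vertex with
   exactly one predecessor shares the row and column of this predecessor:
   [key] sends a vertex to the vertex whose row and column it uses.  If [x] and
   [y] have unique predecessors [p] and [q], then [x] is related to [y] iff
   [p] is related to [q], so nothing has to be done for such a pair.  Visiting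
   all the pairs would not be quadratic in the size of a graph [G], since the
   output of [merge_forest] can have of the order of [gsize G] levels with of
   the order of [gsize G] vertices each. *)
Variables (V : eqType) (f : X -> V).

Section Relation.
Variables (t : X -> seq Y) (key : X -> X).

Definition related (R : X * X -> bool) (p q : X) : timed bool :=
  let* kp := step (key p) in let* kq := step (key q) in step (R (kp, kq)).

(* One step of the greedy selection at a vertex: the first list consists of
   arrows from pairwise incomparable predecessors, the second one of the arrows
   to be deleted. *)
Definition compete (R : X * X -> bool) (b : Y) (AD : seq Y * seq Y) :
    timed (seq Y * seq Y) :=
  let* p := step (src b) in
  let* dominated := each AD.1 false (fun a acc =>
    let* r := related R p (src a) in step (acc || r)) in
  if dominated then step (AD.1, b :: AD.2) else
  each AD.1 ([:: b], AD.2) (fun a AD' =>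
    let* r := related R (src a) p in
    step (if r then (AD'.1, a :: AD'.2) else (a :: AD'.1, AD'.2))).

Definition prune (R : X * X -> bool) (x : X) (K : Y -> bool) :
    timed (Y -> bool) :=
  let* bs := step (t x) in
  let* AD := each bs ([::], [::]) (compete R) in
  each AD.2 K (fun b K => step (upd K b false)).

Definition compare (x y : X) (R : X * X -> bool) : timed (X * X -> bool) :=
  let* same := step (f x == f y) in
  let* bs := step (t x) in
  let* cs := step (t y) in
  let* ok := each bs same (fun b ok =>
    let* found := each cs false (fun c found =>
      let* r := related R (src b) (src c) in step (found || r)) in
    step (ok && found)) in
  let* kx := step (key x) in
  let* ky := step (key y) in
  step (upd R (kx, ky) ok).

End Relation.

(* The second component collects the vertices that do not have exactly one
   predecessor. *)
Definition set_key (t : X -> seq Y) (x : X) (kN : (X -> X) * seq X) :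
    timed ((X -> X) * seq X) :=
  let* bs := step (t x) in
  if bs is [:: b] then
    let* p := step (src b) in
    let* kp := step (kN.1 p) in
    step (upd kN.1 x kp, kN.2)
  else step (upd kN.1 x x, x :: kN.2).

Definition pass (t : X -> seq Y) (l : seq X)
    (st : (Y -> bool) * (X -> X) * (X * X -> bool)) :
    timed ((Y -> bool) * (X -> X) * (X * X -> bool)) :=
  let: (K, key, R) := st in
  let* K := each l K (prune t key R) in
  let* kN := each l (key, [::]) (set_key t) in
  let* R := each kN.2 R (fun x R => each l R (fun y R =>
    let* R := compare t kN.1 x y R in compare t kN.1 y x R)) in
  ret (K, kN.1, R).

Definition run_tree (t : X -> seq Y) (r : X) (K : Y -> bool) :
    timed (Y -> bool) :=
  let* ls := layers t (size vs).+1 [:: r] [::] in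
  let* st := each ls (K, id, fun=> false) (pass t) in
  ret st.1.1.

(* Each tree of the disjoint union is reached from its root. *)
Definition run_forest : timed (seq Y) :=
  let* t := in_arrows in
  let* rs := list_sinks in
  let* K := alloc (size arrs) (fun=> true) in
  let* K := each rs K (run_tree t) in
  each arrs [::] (fun b acc =>
    let* s := step (K b) in step (if s then b :: acc else acc)).

End Lists.

Definition run_prune_tree (T Q : quiver) (f : qmorph T Q) : timed (seq (arrow T)) :=
  run_forest source target (enum T) (enum (arrow T)) f.

Section Run2.
Variables (Q : quiver) (G : sgraph) (h : filtration Q G).

Definition run_level : timed (Q -> nat) :=
  let* t := in_arrows target (enum Q) (enum (arrow Q)) in
  let* rs := list_sinks source (enum Q) (enum (arrow Q)) in
  let* ls := layers source t #|Q|.+1 rs [::] in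
  let* n := each ls 0 (fun _ n => step n.+1) in
  let* lev := alloc #|Q| (fun=> 0) in
  let* r := each ls (lev, n.-1) (fun l st =>
    let* lev := each l st.1 (fun x lev => step (upd lev x st.2)) in
    step (lev, st.2.-1)) in
  ret r.1.

Definition run_succ : timed (Q -> Q) :=
  let* s := alloc #|Q| id in
  each (enum (arrow Q)) s (fun a s => step (upd s (source a) (target a))).

(* Union-find with constant time find: [uf] is the table of representatives
   and [mem] lists the elements. *)
Definition run_union (mem : seq G) (v w : G) (uf : G -> G) : timed (G -> G) :=
  let* v' := step (uf v) in
  let* w' := step (uf w) in
  if v' == w' then step uf else
  each mem uf (fun u uf =>
    let* u' := step (uf u) in step (if u' == w' then upd uf u v' else uf)).

Record merge_state := MergeState {
  st_uf : G -> G;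
  st_mem : seq G;
  st_anc : G -> Q;              (* [v] to [ancestor (hV h v) l] *)
  st_reps : seq G;
  st_vs : seq (G * nat);
  st_arrs : seq ((G * nat) * (G * nat));
  st_map : G * nat -> Q }.

Definition run_merge_pass (lev : Q -> nat) (succ : Q -> Q) (l : nat) (st : merge_state) :
    timed merge_state :=
  let* r := each (enum G) (st_uf st, st_mem st, st_anc st) (fun v r =>
    let: (uf, mem, anc) := r in
    let* lv := step (lev (hV h v)) in
    if lv == l then step (upd uf v v, v :: mem, upd anc v (hV h v)) else
    if l < lv then
      let* q := step (succ (anc v)) in step (uf, mem, upd anc v q)
    else ret r) in
  let: (uf, mem, anc) := r in
  let* uf := each (enum (gedge G)) uf (fun e uf =>
    let* le := step (lev (hE h e)) in
    if le == l then
      if enum (val e) is [:: v; w] then run_union mem v w uf else ret uf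
    else ret uf) in
  let* reps := each mem [::] (fun v reps =>
    let* v' := step (uf v) in step (if v' == v then v :: reps else reps)) in
  let* vm := each reps (st_vs st, st_map st) (fun v vm =>
    let* q := step (anc v) in
    step ((v, l) :: vm.1, upd vm.2 (v, l) q)) in
  let* arrs := each (st_reps st) (st_arrs st) (fun v arrs =>
    let* w := step (uf v) in step (((v, l.+1), (w, l)) :: arrs)) in
  ret (MergeState uf mem anc reps vm.1 arrs vm.2).

Definition run_merge_forest : timed merge_state :=
  let* lev := run_level in
  let* succ := run_succ in
  let* m := each (enum G) 0 (fun v m =>
    let* lv := step (lev (hV h v)) in step (maxn lv m)) in
  let* uf := alloc #|G| id in
  let* anc := alloc #|G| (hV h) in
  each (rev (iota 0 m.+1))
    (MergeState uf [::] anc [::] [::] [::] (fun x => hV h x.1))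
    (run_merge_pass lev succ).

(* vertices, arrows and map to [Q] of the output *)
Definition run_decompose_H0 : timed (seq (G * nat) * seq ((G * nat) * (G * nat)) *
                         (G * nat -> Q)) :=
  let* st := run_merge_forest in
  let* kept := run_forest fst snd (st_vs st) (st_arrs st) (st_map st) in
  ret (st_vs st, kept, st_map st).

(* The lists represent the quiver [S] over [Q], a result of [prune_forest]. *)
Definition represents (fnd : nat -> G -> G) (S : {set arrow (merge_forest h fnd)})
    (out : seq (G * nat) * seq ((G * nat) * (G * nat)) * (G * nat -> Q)) :
    Prop :=
  let: (vs, arrs, m) := out in
  let name (x : merge_vertex h fnd) : G * nat := ((val x).1, val (val x).2) in
  [/\ perm_eq vs [seq name x | x : merge_vertex h fnd],
      perm_eq arrs [seq (name (@source (merge_forest h fnd) b),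
                          name (@target (merge_forest h fnd) b)) | b in S]
    & forall x, m (name x) = merge_map x].

End Run2.

(** * Restricting the codomain of a filtration *)

Section Restriction.
Variables (Q : quiver) (G : sgraph) (h : filtration Q G).

Definition image_and_root : {set Q} :=
  [set q | [|| sink q, q \in codom (hV h) | q \in codom (hE h)]].

Definition restricted_vertex : finType := {q : Q | q \in image_and_root}.

(* the Hasse quiver of the induced order *)
Definition covers (p : restricted_vertex * restricted_vertex) : bool :=
  [&& p.1 != p.2, leQ (val p.1) (val p.2) &
      [forall z : restricted_vertex,
         leQ (val p.1) (val z) && leQ (val z) (val p.2) ==>
         (z == p.1) || (z == p.2)]].

Definition restricted_quiver : quiver :=
  @Quiver restricted_vertex {p | covers p}
    (fun p => (val p).1) (fun p => (val p).2).

(* [h] with values in the restricted quiver *)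
Definition is_restriction (h' : filtration restricted_quiver G) : Prop :=
  (forall v, val (hV h' v) = hV h v) /\ (forall e, val (hE h' e) = hE h e).

End Restriction.

(* Main.v *)
Require Import Defs.
From HB Require Import structures.
From mathcomp Require Import all_boot all_order all_algebra.
From mathcomp Require Import all_classical all_reals all_analysis.
From mathcomp Require Import zify lra.
Set Implicit Arguments.
Unset Strict Implicit.
Unset Printing Implicit Defensive.
Import Order.TTheory GRing.Theory Num.Theory.
Import numFieldNormedType.Exports.
Local Open Scope nat_scope.

(* A vertex p is related to q by the relation R of Algorithm 1 iff the subtree
   above p maps, over Q and root to root, to the subtree above q.  Hence
   every subtree that the pruning cuts off folds into a retained sibling subtree.
   The signed map "identity minus folding" is natural from the linearization of
   the pruned quiver to that of T, and it is invertible because folding lowers the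
   number of deleted arrows on the way to the root.  A component C of the pruned
   quiver is indecomposable: an idempotent endomorphism is a scalar at the root
   of C, hence 0 there after passing to the complement; by induction on the level
   its entries are then strictly triangular for R, since the remaining
   predecessors of a vertex are incomparable, so it is 0.

   H_0 of a graph is free on its connected components, and in a filtration over a
   rooted tree these are the union-find classes, so H_0(h) is the linearization of
   the merge forest.

   The merge forest may have quadratically many vertices, but at most |G| leaves.
   All vertices with one predecessor on a level inherit the comparisons of their
   predecessors, and the vertices that really branch have total degree linear in
   the number of leaves, so the comparisons still take time O(|G|^2). *)

(** * Rooted trees *)

(** Most of the argument asks only for [graded]: at most one arrow out of each vertex, and levels
    dropping by one along it. Unlike [rooted_tree], this property survives disjoint unions, so it
    serves a tree over $Q$, the merge forest and its components alike. The algorithms leave choices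
    open (selections, representatives), whereas the program makes particular ones. Both sides meet
    in the predicate [pruned], which mentions neither levels nor an order of execution: a set of
    arrows is a possible result exactly if it is [pruned]. The decomposition is proved for every
    [pruned] set, and the program only has to produce one. Computing $R$ level by level is
    legitimate because vertices of different levels lie over different vertices of $Q$, so related
    vertices have equal level. The program runs on lists of names and not on quivers. Therefore
    [similar] is the largest simulation of an arbitrary labelled relation, and it is transported
    along maps that respect predecessors and labels. *)

Section Order.
Variable Q : quiver.
Implicit Types x y z : Q.

Lemma leQ_refl x : leQ x x. Proof. exact: connect0. Qed.

Lemma leQ_trans y x z : leQ x y -> leQ y z -> leQ x z.
Proof. exact: connect_trans. Qed.

Lemma adjP x y :
  reflect (exists2 b : arrow Q, source b = x & target b = y) (adj x y).
Proof.
apply: (iffP existsP) => [[b /andP[/eqP ? /eqP ?]]|[b <- <-]]; exists b => //.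
by rewrite !eqxx.
Qed.

Lemma leQ_arrow (b : arrow Q) : leQ (source b) (target b).
Proof. by apply/connect1/adjP; exists b. Qed.

Lemma sinkPn x : reflect (exists b : arrow Q, source b = x) (~~ sink x).
Proof.
rewrite /sink negb_forall; apply: (iffP existsP) => -[b]; rewrite ?negbK.
  by move/eqP; exists b.
by move=> <-; exists b; rewrite negbK.
Qed.

Lemma leQP x y :
  leQ x y -> x = y \/ exists2 b : arrow Q, source b = x & leQ (target b) y.
Proof.
case/connectP=> -[|z p] /=; first by left.
case/andP=> /adjP[b <- <-] hp ->; right; exists b => //.
by apply/connectP; exists p.
Qed.

Lemma sink_leQ x y : sink x -> leQ x y -> x = y.
Proof.
by move=> sx /leQP[//|[b e]]; case/negP: (introT (sinkPn x) (ex_intro _ b e)).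
Qed.

End Order.

(** * Reduced walks in a tree *)

Section Walks.
Variable Q : quiver.
Implicit Types (x y : Q) (w : seq (arrow Q * bool)) (s : seq (arrow Q)).

Lemma walk_cat x w1 w2 z :
  walk x (w1 ++ w2) z <-> exists2 y, walk x w1 y & walk y w2 z.
Proof.
elim: w1 x => [|d w1 IH] x /=.
  by split=> [h|[y e h]]; [exists x | rewrite e].
split=> [[e /IH[y h1 h2]]|[y [e h1] h2]]; first by exists y.
by split=> //; apply/IH; exists y.
Qed.

Definition reduced w := sorted (fun d e => d.1 != e.1) w.

(** Let [e] later repeat the arrow of [d]. In the same direction it repeats the vertex [dsource d].
    In the opposite direction it starts where [d] ends, which is where the dart right after [d]
    starts; [reduced] keeps [e] from being that dart, so again a vertex repeats. *)
Lemma walk_reduced_uniq_arrows x w z : walk x w z -> reduced w ->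
  uniq [seq dsource d | d <- w] -> uniq [seq d.1 | d <- w].
Proof.
elim: w x => //= d w IH x [_ hw] hred /andP[hd hu].
rewrite (IH _ hw (path_sorted hred) hu) andbT.
apply: contra hd => /mapP[e ein eqde].
have [eb|nb] := eqVneq d.2 e.2.
  by apply/mapP; exists e => //; rewrite /dsource eqde eb.
case: w ein hw hred hu {IH} => [//|e' w] ein [hs hw] /= /andP[hne _] /andP[hu _].
move: ein hne hu; rewrite inE => /orP[/eqP<-|ein]; first by rewrite eqde eqxx.
move=> _ /mapP[]; exists e => //.
rewrite hs /dtarget /dsource eqde.
by move: nb; case: (d.2); case: (e.2).
Qed.

Lemma reduced_cat w1 w2 : reduced (w1 ++ w2) -> reduced w1 /\ reduced w2.
Proof. by move=> h; case: (cat_sorted2 h). Qed.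

(** The cycle condition of [tree_quiver] speaks of walks with distinct arrows and vertices. Between
    two visits to the same vertex lies a shorter nonempty closed reduced walk, so a shortest
    counterexample has distinct vertices, and then distinct arrows. *)
Lemma reduced_closed_walk :
  (forall x w, walk x w x -> uniq [seq d.1 | d <- w] ->
        uniq [seq dsource d | d <- w] -> w = [::]) ->
  forall x w, walk x w x -> reduced w -> w = [::].
Proof.
move=> H x w; have [n] := ubnP (size w); elim: n x w => // n IH x w ltn hw hr.
have [hu|/(uniqPn x)[i [j [ltij]]]] := boolP (uniq [seq dsource d | d <- w]).
  exact: H hw (walk_reduced_uniq_arrows hw hr hu) hu.
rewrite size_map => ltj eqij.
have ltin : i < size w by apply: ltn_trans ltij ltj.
have [d0 _] : exists d, d \in w by case: (w) ltj => // d ? _; exists d; rewrite inE eqxx.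
rewrite !(nth_map d0) // in eqij.
have := hw; rewrite -{1}(cat_take_drop j w) -{1}(cat_take_drop i (take j w)) -catA.
case/walk_cat => a _ /walk_cat[b hab hb].
have := hr; rewrite -{1}(cat_take_drop j w) -{1}(cat_take_drop i (take j w)) -catA.
case/reduced_cat=> _ /reduced_cat[hrab _].
have eb : b = dsource (nth d0 w j).
  by move: hb; rewrite (drop_nth d0 ltj) /= => -[].
have sz : size (drop i (take j w)) = j - i.
  by rewrite size_drop size_take ltj.
have ea : a = dsource (nth d0 w i).
  move: hab; rewrite (drop_nth d0) ?size_take ?ltj //= nth_take //.
  by case.
have eab : a = b by rewrite ea eb.
rewrite -eab in hab.
have ltsz : size (drop i (take j w)) < n by rewrite sz; lia.
by have := IH _ _ ltsz hab hrab => /(congr1 size); rewrite sz /=; lia.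
Qed.

Definition fwd s := [seq (b, true) | b <- s].
Definition bwd s := [seq (b, false) | b <- rev s].

Lemma leQ_walk x y : leQ x y -> exists s, walk x (fwd s) y.
Proof.
case/connectP=> p; elim: p x => [|z p IH] x /=; first by move=> _ ->; exists [::].
case/andP=> /existsP[b /andP[/eqP<- /eqP<-]] hp hy.
by have [s hs] := IH _ hp hy; exists (b :: s).
Qed.

Lemma walk_rev x s y : walk x (fwd s) y -> walk y (bwd s) x.
Proof.
elim: s x => [|b s IH] x /=; first by [].
case=> <- /IH h; rewrite /bwd rev_cons map_rcons -cats1 walk_cat.
by exists (target b).
Qed.

Hypothesis tQ : tree_quiver Q.

Lemma tree_no_loop (b : arrow Q) : source b != target b.
Proof.
apply/eqP=> e; case: tQ => _ _ H.
by have := reduced_closed_walk H (x := source b) (w := [:: (b, true)]);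
  rewrite /= /dtarget /dsource /= -e => /(_ (conj erefl erefl) isT).
Qed.

Lemma fwd_reduced x s y : walk x (fwd s) y -> reduced (fwd s).
Proof.
elim: s x => [//|b [//|c s] IH] x [_ h].
rewrite /reduced /=; apply/andP; split; last exact: IH _ h.
case: h => h _; apply: contraTneq (tree_no_loop b) => /= e.
by move: h; rewrite /dsource /dtarget /= e => ->; rewrite eqxx.
Qed.

Lemma bwd_reduced x s y : walk x (fwd s) y -> reduced (bwd s).
Proof.
move/fwd_reduced; rewrite /reduced /fwd /bwd map_rev rev_sorted.
rewrite !sorted_map; apply: sub_sorted => a b /=; by rewrite eq_sym.
Qed.

Lemma tree_acyclic x s : walk x (fwd s) x -> s = [::].
Proof.
case: (tQ) => _ _ H h; have := reduced_closed_walk H h (fwd_reduced h).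
by case: s {h}.
Qed.

Lemma tree_acyclic_arrow (b : arrow Q) : ~~ leQ (target b) (source b).
Proof.
apply/negP=> /leQ_walk[s hs].
by have /tree_acyclic : walk (source b) (fwd (b :: s)) (source b) by [].
Qed.

Lemma leQ_sink x : exists2 y, sink y & leQ x y.
Proof.
have [n] := ubnP #|[set y | leQ x y]|; elim: n x => // n IH x ltn.
have [sx|/sinkPn[b hb]] := boolP (sink x); first by exists x; rewrite ?leQ_refl.
have xb : leQ x (target b) by rewrite -hb leQ_arrow.
have [|y sy hy] := IH (target b); last by exists y => //; apply: leQ_trans hy.
apply: leq_ltn_trans (_ : #|[set y | leQ x y] :\ x| < _).
  apply: subset_leq_card; apply/fintype.subsetP=> y; rewrite !inE => hy.
  rewrite (leQ_trans xb hy) andbT; apply: contraTneq hy => ->.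
  by rewrite -hb tree_acyclic_arrow.
by move: ltn; rewrite (cardsD1 x [set y | leQ x y]) inE leQ_refl; lia.
Qed.

End Walks.

Section SourceInjective.
Variable T : quiver.
Implicit Types x y : T.

Lemma leQ_measure (lev : T -> nat) x y :
  (forall b : arrow T, lev (target b) < lev (source b)) ->
  leQ x y -> x = y \/ lev y < lev x.
Proof.
move=> hlev /connectP[p]; elim: p x => [|z p IH] x /=; first by left.
case/andP=> /adjP[b <- <-] hp /(IH _ hp)[<-|h]; right; first exact: hlev.
exact: ltn_trans h (hlev b).
Qed.

(** A step of the undirected path against an arrow stays below the sink: the arrow is the only one
    out of its source, so the directed path from there begins with it. *)
Lemma uadj_connect_sink x y : injective (@source T) ->
  connect (@uadj T) x y -> sink y -> leQ x y.
Proof.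
move=> inj /connectP[p]; elim: p x => [|z p IH] x /=; first by move=> _ ->; rewrite leQ_refl.
case/andP=> xz hp hy sy; have {IH}hz := IH _ hp hy sy.
case/orP: xz => /adjP[b eb1 eb2].
  by apply: leQ_trans hz; rewrite -eb1 -eb2 leQ_arrow.
case/leQP: hz => [e|[c ec]].
  by case/negP: (introT (sinkPn z) (ex_intro _ b eb1)); rewrite e.
have ebc : b = c by apply: inj; rewrite eb1 ec.
by rewrite -eb2 ebc.
Qed.

End SourceInjective.

Section RootedTrees.
Variable Q : quiver.
Implicit Types x y z : Q.

(* Walking up against the first of two arrows out of a vertex, from the root,
   and down along the second, gives a reduced closed walk. *)
Lemma rooted_tree_source_inj : rooted_tree Q -> injective (@source Q).
Proof.
case=> tQ /eqP/cards1P[r er] a b eab; apply/eqP/negP=> /negP nab.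
have sinkr x : sink x -> x = r by move=> sx; apply/set1P; rewrite -er inE.
have [x /sinkr-> /leQ_walk[s hs]] := leQ_sink tQ (target a).
have [y /sinkr-> /leQ_walk[t ht]] := leQ_sink tQ (target b).
have wa : walk (source a) (fwd (a :: s)) r by [].
have wb : walk (source a) (fwd (b :: t)) r by [].
have w : walk r (bwd (a :: s) ++ fwd (b :: t)) r.
  by apply/walk_cat; exists (source a) => //; apply: walk_rev.
have := reduced_closed_walk (let: And3 _ _ H := tQ in H) w.
rewrite {1}/bwd rev_cons map_rcons cat_rcons /reduced.
rewrite sorted_cat_cons -map_rcons -rev_cons /= nab.
have := bwd_reduced tQ wa; have := fwd_reduced tQ wb.
rewrite /reduced /bwd /= => -> -> /(_ isT) /(congr1 size).
by rewrite size_cat /= addnS.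
Qed.

End RootedTrees.

(** * Level functions *)

Section Levels.
Variables (T : quiver) (lev : T -> nat).
Hypothesis levS : forall b : arrow T, lev (source b) = (lev (target b)).+1.
Hypothesis lev0 : forall x, sink x = (lev x == 0).
Implicit Types x y : T.

Lemma path_lev x p : path (@adj T) x p -> lev x = lev (last x p) + size p.
Proof.
elim: p x => [|y p IH] x /=; first by rewrite addn0.
by case/andP=> /adjP[b <- <-] /IH; rewrite levS => ->; rewrite addnS.
Qed.

Lemma path_lev_uniq x p : path (@adj T) x p -> uniq (x :: p).
Proof.
move=> hp; apply: (@sorted_uniq _ (fun x y => lev y < lev x)) => /=.
- by move=> a b c h1 h2; apply: ltn_trans h2 h1.
- by move=> a; rewrite ltnn.
by apply: sub_path hp => a b /adjP[c <- <-]; rewrite levS.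
Qed.

Lemma lev_path x : exists p : (lev x).-tuple T, path (@adj T) x p && sink (last x p).
Proof.
have [n] := ubnP (lev x); elim: n x => // n IH x ltn.
case e: (lev x) => [|m].
  by exists [tuple]; rewrite /= lev0 e.
have /sinkPn[b hb] : ~~ sink x by rewrite lev0 e.
have em : lev (target b) = m by apply: succn_inj; rewrite -levS hb.
have [|p] := IH (target b); first by rewrite em; lia.
rewrite em in p *; case/andP=> hp hs.
exists [tuple of target b :: p] => /=.
by rewrite hp hs !andbT; apply/adjP; exists b.
Qed.

(** [level] searches for the length of a path to a sink. Since [lev] drops along a path, paths
    repeat no vertex and the search succeeds within its range; the length found is forced by
    [path_lev]. *)
Lemma level_lev x : level x = lev x.
Proof.
have [p hp] := lev_path x.
have ltx : lev x < #|T|.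
  have /andP[/path_lev_uniq/card_uniqP e _] := hp.
  by rewrite -[lev x](size_tuple p) -[(size p).+1]/(size (x :: p)) -e max_card.
apply/eqP; rewrite eqn_leq /level; set a := (fun n => _); apply/andP; split.
  rewrite leqNgt; apply/negP=> /(before_find 0).
  by rewrite nth_iota // add0n /a => /negbT/negP[]; apply/existsP; exists p.
set n := find _ _.
have [ltn|gen] := ltnP n #|T|; last by apply: leq_trans gen; apply: ltnW.
have : has a (iota 0 #|T|) by rewrite has_find size_iota.
move/(nth_find 0); rewrite -/n nth_iota // add0n /a => /existsP[q /andP[hq]].
by rewrite lev0 => /eqP e; rewrite (path_lev hq) e size_tuple.
Qed.

End Levels.

Record graded (T : quiver) : Prop := Graded {
  source_inj : injective (@source T);
  levelS : forall b : arrow T, level (source b) = (level (target b)).+1 }.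

Section Graded.
Variable T : quiver.
Implicit Types x y : T.

Lemma sink_level x : sink x = (level x == 0).
Proof.
have : 0 < #|T| by apply/card_gt0P; exists x.
rewrite /level; case: #|T| => // n _ /=.
set b := [exists _, _]; suff -> : b = sink x by case: (sink x).
by apply/existsP/idP => [[p]|sx]; [rewrite tuple0|exists [tuple]].
Qed.

Lemma lev_graded (lev : T -> nat) : injective (@source T) ->
  (forall b : arrow T, lev (source b) = (lev (target b)).+1) ->
  (forall x, sink x = (lev x == 0)) -> graded T.
Proof. by move=> inj lS l0; split=> // b; rewrite !(level_lev lS l0). Qed.

(** The number of vertices above [x], minus one, serves as level function: the only arrow [b] out of
    a vertex adds exactly [source b] to the vertices above [target b], and acyclicity makes it a new
    one. *)
Lemma rooted_tree_graded : rooted_tree T -> graded T.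
Proof.
move=> rT; have inj := rooted_tree_source_inj rT; case: rT => tT _.
pose up x := [set y | leQ x y].
have upS (b : arrow T) : #|up (source b)| = #|up (target b)|.+1.
  rewrite (cardsD1 (source b)) inE leQ_refl add1n; congr _.+1; apply: eq_card => y.
  rewrite !inE; apply/andP/idP=> [[ny] /leQP[e|[c /inj->]//]|h].
    by rewrite e eqxx in ny.
  rewrite (leQ_trans (leQ_arrow b) h); split=> //.
  by apply: contraTneq h => ->; apply: tree_acyclic_arrow.
have up1 x : 0 < #|up x| by apply/card_gt0P; exists x; rewrite inE leQ_refl.
apply: (@lev_graded (fun x => #|up x|.-1)) => // [b|x]; first by rewrite upS /= prednK.
have [sx|] := boolP (sink x).
  rewrite (_ : up x = [set x]) ?cards1 //; apply/setP=> y; rewrite !inE.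
  by apply/idP/eqP => [/(sink_leQ sx)->|->]; rewrite ?leQ_refl.
by case/sinkPn=> b <-; rewrite upS; apply/esym/negbTE; rewrite -lt0n up1.
Qed.

Hypothesis gT : graded T.

Lemma level_lt_card x : level x < #|T|.
Proof.
have l0 := sink_level; have lS := levelS gT.
have [p /andP[/(path_lev_uniq lS)/card_uniqP e _]] := lev_path lS l0 x.
by rewrite -[level x](size_tuple p) -[(size p).+1]/(size (x :: p)) -e max_card.
Qed.

Lemma leq_level_height x : level x <= height T.
Proof. exact: (leq_bigmax x). Qed.

End Graded.

Section RootedTreeCriterion.
Variables (T : quiver) (lev : T -> nat) (r : T).
Hypothesis inj : injective (@source T).
Hypothesis lev_lt : forall b : arrow T, lev (target b) < lev (source b).
Hypothesis sink1 : forall x, sink x -> x = r.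
Implicit Types x y : T.

Lemma leQ_root x : leQ x r.
Proof.
have [n] := ubnP (lev x); elim: n x => // n IH x ltn.
have [/sink1->|/sinkPn[b hb]] := boolP (sink x); first exact: leQ_refl.
apply: leQ_trans (IH (target b) _); first by rewrite -hb leQ_arrow.
by apply: leq_trans (lev_lt b) _; rewrite hb -ltnS.
Qed.

(* A closed walk leaves a vertex of maximal measure through its only outgoing
   arrow and also comes back through this arrow. *)
Lemma rooted_tree_criterion : rooted_tree T.
Proof.
split; last first.
  apply/eqP/cards1P; exists r; apply/setP=> x; rewrite !inE.
  apply/idP/eqP => [/sink1//|->]; apply/negPn/negP=> /sinkPn[b hb].
  have : leQ (target b) r by apply: leQ_root.
  rewrite -hb; case/connectP=> p hp.
  have lev_path z q : path (@adj T) z q -> lev (last z q) <= lev z.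
    elim: q z => [//|w q IH] z /= /andP[/adjP[c <- <-] /IH h].
    exact: leq_trans h (ltnW (lev_lt c)).
  by move=> e; have := lev_path _ _ hp; rewrite -e leqNgt lev_lt.
split; first by apply/card_gt0P; exists r.
  move=> x y; have [s hs] := leQ_walk (leQ_root x).
  have [t /walk_rev ht] := leQ_walk (leQ_root y).
  by exists (fwd s ++ bwd t); apply/walk_cat; exists r.
move=> x w hw ua us.
case e: w => [//|d0 w0]; exfalso.
have [d din dmax] : exists2 d, d \in w & {in w, forall c, lev (dsource c) <= lev (dsource d)}.
  have : w != [::] by rewrite e.
  elim: (w) => // c [|c' v] IH _; first by exists c => [|c']; rewrite inE ?eqxx // => /eqP->.
  have [//|d din dmax] := IH; have [h|h] := leqP (lev (dsource c)) (lev (dsource d)).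
    exists d => [|y]; first by rewrite inE din orbT.
    by rewrite inE => /orP[/eqP->//|]; apply: dmax.
  exists c => [|y]; first by rewrite inE eqxx.
  by rewrite inE => /orP[/eqP->//|/dmax h']; apply: leq_trans h' (ltnW h).
have [w1 [w2 ew]] : exists w1 w2, w = w1 ++ d :: w2.
  by case/splitPr: din => w1 w2; exists w1, w2.
have hrot : walk (dsource d) (d :: w2 ++ w1) (dsource d).
  move: hw; rewrite ew => /walk_cat[z h1 h2]; rewrite -cat_cons; apply/walk_cat.
  by case: (h2) => ez _; exists x; rewrite ez.
have pw : perm_eq w (d :: w2 ++ w1) by rewrite ew -cat_cons perm_catC.
have {ua} : uniq [seq c.1 | c <- d :: w2 ++ w1] by rewrite -(perm_uniq (perm_map _ pw)).
have {}dmax : {in d :: w2 ++ w1, forall c, lev (dsource c) <= lev (dsource d)}.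
  by move=> c; rewrite -(perm_mem pw); apply: dmax.
move: (w2 ++ w1) hrot dmax => v [_ hv] dmax uv.
have d2 : d.2.
  have : lev (dtarget d) <= lev (dsource d).
    case: v hv dmax {uv} => [<-//|c v] [<- _] dmax; apply: dmax.
    by rewrite !inE eqxx orbT.
  by rewrite /dtarget /dsource; case: d.2 => //; rewrite leqNgt lev_lt.
have [c cin [ct cs]] : exists2 c, c \in d :: v & dtarget c = dsource d /\
      lev (dsource c) <= lev (dsource d).
  have : exists2 c, c \in d :: v & dtarget c = dsource d.
    elim: v d {d2 dmax uv din ew pw} (dsource d) hv => [|c v IH] d z /=.
      by exists d; rewrite ?inE.
    by case=> _ /IH[c' cin h]; exists c' => //; rewrite inE cin orbT.
  by case=> c cin h; exists c => //; split=> //; apply: dmax.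
have c2 : ~~ c.2.
  apply/negP=> c2; move: cs ct; rewrite /dtarget /dsource c2 d2 => cs ct.
  by rewrite -ct leqNgt lev_lt in cs.
have ecd : c.1 = d.1.
  by apply: inj; move: ct; rewrite /dtarget /dsource (negbTE c2) d2.
move: uv cin; rewrite /= inE => /andP[nd _] /orP[/eqP ecd'|cin].
  by rewrite ecd' d2 in c2.
by rewrite -ecd map_f in nd.
Qed.

End RootedTreeCriterion.

(** * Simulations and the pruned quiver *)

Section Similarity.
Variables (X V : Type) (pr : X -> X -> Prop) (f : X -> V).

(** [pr p x] stands for [p] being a predecessor of [x], and [f] for the map to the vertices of $Q$.
    Through simulations the preorder is defined without a recursion on levels. *)
Definition simulation (r : X -> X -> Prop) : Prop :=
  forall x y, r x y ->
    f x = f y /\ forall p, pr p x -> exists2 q, pr q y & r p q.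

Definition similar (x y : X) : Prop := exists2 r, simulation r & r x y.

Lemma similar_simulation : simulation similar.
Proof.
move=> x y [r hr /hr[exy h]]; split=> // p /h[q hq rpq].
by exists q => //; exists r.
Qed.

Lemma similar_label x y : similar x y -> f x = f y.
Proof. by case/similar_simulation. Qed.

Lemma similar_pred x y p :
  similar x y -> pr p x -> exists2 q, pr q y & similar p q.
Proof. by case/similar_simulation=> _; apply. Qed.

Lemma similar_refl x : similar x x.
Proof. by exists eq => // {}x y ->; split=> // p hp; exists p. Qed.

Lemma similar_trans y x z : similar x y -> similar y z -> similar x z.
Proof.
move=> hxy hyz; exists (fun a c => exists2 b, similar a b & similar b c); last by exists y.
move=> a c [b hab hbc]; split; first by rewrite (similar_label hab) (similar_label hbc).
move=> p /(similar_pred hab)[q /(similar_pred hbc)[s hs hqs] hpq].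
by exists s => //; exists q.
Qed.

(** Adding the single pair [(x, y)] to the largest simulation gives a simulation again. *)
Lemma similarI x y : f x = f y ->
  (forall p, pr p x -> exists2 q, pr q y & similar p q) -> similar x y.
Proof.
move=> exy h; exists (fun a b => similar a b \/ (a = x /\ b = y)); last by right.
move=> a b [/similar_simulation[eab hab]|[-> ->]]; split=> // p.
  by case/hab=> q; exists q; try left.
by case/h=> q; exists q; try left.
Qed.

End Similarity.

(** The third hypothesis makes the image of [i] closed under predecessors. The labels may live in
    different types, so only their equalities are compared. Instances are the inclusion of a
    component and the names that the program gives to vertices. *)
Lemma similar_transfer (X Y V W : Type) (pr : X -> X -> Prop) (f : X -> V)
    (prY : Y -> Y -> Prop) (g : Y -> W) (i : Y -> X) :
  (forall y z, g y = g z <-> f (i y) = f (i z)) ->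
  (forall p y, prY p y -> pr (i p) (i y)) ->
  (forall p y, pr p (i y) -> exists2 p', i p' = p & prY p' y) ->
  forall y z, similar prY g y z <-> similar pr f (i y) (i z).
Proof.
move=> hfg hpr hpr' y z; split=> h.
  exists (fun a b => exists y z, [/\ i y = a, i z = b & similar prY g y z]); last by exists y, z.
  move=> a b [{h}y [{}z [<- <- h]]]; split; first exact/hfg/similar_label/h.
  move=> p /hpr'[p' <-] /(similar_pred h)[q hq hpq].
  by exists (i q); [apply: hpr|exists p', q].
exists (fun y z => similar pr f (i y) (i z)) => // {h}y {}z h.
split; first exact/hfg/similar_label/h.
by move=> p /hpr/(similar_pred h)[q /hpr'[q' <- hq']]; exists q'.
Qed.

Section Pruned.
Variables (T Q : quiver) (f : qmorph T Q).

Definition sim_over : T -> T -> Prop := similar (fun p x : T => adj p x) f.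

(** Each deleted arrow is dominated by a kept one with the same target, and no kept arrow dominates
    another one. *)
Definition pruned (S : {set arrow T}) : Prop :=
  (forall b, b \notin S -> exists2 c, c \in S &
     target c = target b /\ sim_over (source b) (source c)) /\
  (forall b c, b \in S -> c \in S -> target b = target c ->
     sim_over (source b) (source c) -> b = c).

Hypothesis gT : graded T.
Hypothesis level_f : forall x y, f x = f y -> level x = level y.

Lemma sim_level x y : sim_over x y -> level x = level y.
Proof. by move=> h; apply: level_f; apply: similar_label h. Qed.

(** The value of $R$ after the pass for [l]. Testing the level of the first vertex is enough since
    similar vertices have equal levels. *)
Definition sim_table (l : nat) : {set T * T} :=
  [set xy | (l <= level xy.1) && `[< sim_over xy.1 xy.2 >]].

Lemma level_pred (p x : T) : p \in predecessors x -> level p = (level x).+1.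
Proof. by rewrite inE => /adjP[b <- <-]; apply: levelS gT b. Qed.

Lemma sim_table_rec l : sim_table l = sim_table l.+1 :|: [set xy : T * T |
  [&& level xy.1 == l, level xy.2 == l, f xy.1 == f xy.2 &
      [forall p in predecessors xy.1, exists q in predecessors xy.2,
         (p, q) \in sim_table l.+1]]].
Proof.
apply/setP=> -[x y]; rewrite finset.in_setU !finset.in_set /=.
apply/idP/idP=> [/andP[lex /asboolP s]|/orP[/andP[ltx ->]|]].
- move: lex; rewrite leq_eqVlt => /orP[/eqP el|->]; last by rewrite (introT (asboolP _) s).
  apply/orP; right; rewrite -(sim_level s) -el eqxx (similar_label s) eqxx /=.
  apply/forall_inP=> p hp; have := hp; rewrite inE => /(similar_pred s)[q hq spq].
  apply/exists_inP; exists q; first by rewrite inE.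
  by rewrite inE /= (level_pred hp) -el leqnn; apply/asboolP.
- by rewrite ltnW.
case/and4P=> /eqP lx /eqP ly /eqP efxy /forall_inP h; rewrite lx leqnn /=.
apply/asboolP/similarI=> // p hp; have /h/exists_inP[q] : p \in predecessors x by rewrite inE.
by rewrite !inE => hq /andP[_ /asboolP spq]; exists q.
Qed.

Lemma sim_table_height : sim_table (height T).+1 = finset.set0.
Proof. by apply/setP=> -[x y]; rewrite !inE ltnNge leq_level_height. Qed.

Lemma sim_table_in l (x y : T) : l <= level x -> (x, y) \in sim_table l <-> sim_over x y.
Proof. by rewrite inE /= => ->; split=> [/asboolP|/asboolP]. Qed.

Lemma selection_sim x A : selection (sim_table (level x).+1) x A <->
  [/\ A \subset predecessors x,
      forall p, p \in predecessors x -> exists2 a, a \in A & sim_over p a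
    & forall a b, a \in A -> b \in A -> sim_over a b -> a = b].
Proof.
have tab p q : p \in predecessors x -> (p, q) \in sim_table (level x).+1 <-> sim_over p q.
  by move=> /level_pred lp; apply: sim_table_in; rewrite lp.
split=> [[/maxsetP[/andP[sA /'forall_in_forall_inP iA] _] cA]|[sA cA iA]].
  split=> // [p hp|a b aA bA sab].
    by have [a aA /(tab _ _ hp)] := cA p hp; exists a.
  apply/eqP/negPn/negP=> nab; have := iA a aA b bA; rewrite nab /=.
  by rewrite (proj2 (tab a b (fintype.subsetP sA _ aA)) sab).
split; last by move=> p hp; have [a aA /(tab _ _ hp)] := cA p hp; exists a.
apply/maxsetP; split.
  rewrite sA; apply/'forall_in_forall_inP => a aA b bA; apply/implyP=> nab.
  by apply: contra nab => /(tab _ _ (fintype.subsetP sA _ aA)) /(iA _ _ aA bA)->.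
move=> B /andP[sB /'forall_in_forall_inP iB] sAB; apply/eqP; rewrite finset.eqEsubset sAB andbT.
apply/fintype.subsetP=> b bB; have hb := fintype.subsetP sB _ bB.
have [a aA /(tab _ _ hb) sba] := cA b hb.
have := iB b bB a (fintype.subsetP sAB _ aA); rewrite sba /=.
by case: eqP => // ->.
Qed.

Lemma prune_tree_pruned S : prune_tree f S -> pruned S.
Proof.
case=> st [st0 stS eS].
(* The selections of the separate passes are collected in one function, with a dummy value above the
   height. *)
have {stS} /boolp.choice[A hA] : forall l, exists A : T -> {set T}, l <= height T ->
    [/\ forall x, level x = l -> selection (st l.+1).2 x (A x),
      (st l).1 = (st l.+1).1 :\: [set b | (level (target b) == l) &&
                                (source b \notin A (target b))]
    & (st l).2 = (st l.+1).2 :|: [set xy : T * T |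
        [&& level xy.1 == l, level xy.2 == l, f xy.1 == f xy.2 &
            [forall p in predecessors xy.1, exists q in predecessors xy.2,
               (p, q) \in (st l.+1).2]]]].
  by move=> l; case: (leqP l (height T)) => [/stS[A hA]|_]; [exists A|exists (fun=> finset.set0)].
(* Downwards from [(height T).+1]: the arrows with target of level below [l] are all still present,
   and [A] has decided about the others. *)
have inv l : l <= (height T).+1 ->
    (st l).2 = sim_table l /\
    (st l).1 = [set b | (level (target b) < l) ||
                        (source b \in A (level (target b)) (target b))].
  move/subnKC; move: (_ - l) => d; elim: d l => [|d IH] l.
    rewrite addn0 => ->; rewrite st0 sim_table_height; split=> //=.
    by apply/setP=> b; rewrite !inE ltnS leq_level_height.
  move=> el; have lel : l <= height T by lia.
  have [e2 e1] : (st l.+1).2 = sim_table l.+1 /\ (st l.+1).1 = [set b |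
     (level (target b) < l.+1) || (source b \in A (level (target b)) (target b))].
    by apply: IH; lia.
  have [_ -> ->] := hA l lel; rewrite e1 e2 -sim_table_rec; split=> //.
  apply/setP=> b; rewrite !inE ltnS leq_eqVlt.
  by case: (eqVneq (level (target b)) l) => [->|_]; rewrite ?ltnn //= ?andbT ?negbK.
have selA x : selection (sim_table (level x).+1) x (A (level x) x).
  have lex := leq_level_height x; have [h _ _] := hA _ lex.
  by have [<- _] := inv (level x).+1 lex; apply: h.
have inS b : (b \in S) = (source b \in A (level (target b)) (target b)).
  by rewrite eS; have [_ ->] := inv 0 isT; rewrite inE ltn0.
split=> [b _|b c].
  have /selection_sim[sA cA _] := selA (target b).
  have [|a aA sba] := cA (source b); first by rewrite inE; apply/adjP; exists b.
  have := fintype.subsetP sA _ aA; rewrite inE => /adjP[c ec et]; exists c.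
    by rewrite inS et ec.
  by rewrite et ec.
rewrite !inS => bS cS e s; apply: (source_inj gT).
have /selection_sim[_ _ h] := selA (target b); apply: h => //.
by rewrite e.
Qed.

(** A run that produces [S] selects at [x] the sources of the kept arrows into [x]. *)
Lemma pruned_prune_tree S : pruned S -> prune_tree f S.
Proof.
case=> cS iS; exists (fun l => ([set b | (level (target b) < l) || (b \in S)], sim_table l)).
split=> [|l _|].
- rewrite sim_table_height; congr (_, _); apply/setP=> b.
  by rewrite !inE ltnS leq_level_height.
- exists (fun x => [set source b | b in [set b in S | target b == x]]); split.
  + move=> x <-; apply/selection_sim; split.
    * apply/fintype.subsetP=> _ /imsetP[b + ->]; rewrite !inE => /andP[_ /eqP<-].
      by apply/adjP; exists b.
    * move=> p; rewrite inE => /adjP[b <- <-]; have [bS|/cS[c hc [ec s]]] := boolP (b \in S).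
        exists (source b); last exact: similar_refl.
        by apply/imsetP; exists b; rewrite // inE bS /=.
      by exists (source c) => //; apply/imsetP; exists c; rewrite // inE hc ec /=.
    move=> _ _ /imsetP[b + ->] /imsetP[c + ->]; rewrite !inE.
    move=> /andP[bS /eqP eb] /andP[bC /eqP ec] s; congr source.
    by apply: iS => //; rewrite eb ec.
  + apply/setP=> b; rewrite !inE ltnS.
    case: (ltngtP (level (target b)) l) => [||_] //=.
    rewrite negbK andbT; apply/idP/imsetP=> [bS|[c]].
      by exists b; rewrite // inE bS /=.
    by rewrite inE => /andP[cS' _] /(source_inj gT)->.
  + by rewrite -sim_table_rec.
by apply/setP=> b; rewrite inE.
Qed.

End Pruned.

(** * Connected components *)

Section Components.
Variable T : quiver.
Implicit Types (x y : T) (C : component T).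

Lemma uadj_connect_sym : connect_sym (@uadj T).
Proof. by apply: sym_connect_sym => x y; rewrite /uadj orbC. Qed.

Lemma component_of_proof x : [set y | connect (@uadj T) x y] \in components T.
Proof. by apply/imsetP; exists x. Qed.

Definition component_of x : component T :=
  exist (fun A => A \in components T) _ (component_of_proof x).

Lemma component_ofP x C : x \in val C -> C = component_of x.
Proof.
case: C => /= C hC xC; apply: val_inj => /=; case/imsetP: hC xC => z _ ->.
rewrite inE => hz; apply/setP=> y; rewrite !inE.
exact: (same_connect uadj_connect_sym hz).
Qed.

Lemma mem_component_of x : x \in val (component_of x).
Proof. by rewrite /= inE connect0. Qed.

Lemma component_connect C x y : x \in val C -> (y \in val C) = connect (@uadj T) x y.
Proof. by move/component_ofP=> ->; rewrite /= inE. Qed.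

Lemma component_nonempty C : exists x, x \in val C.
Proof. by case: C => /= C /imsetP[x _ ->]; exists x; rewrite inE connect0. Qed.

Lemma component_arrow C (b : arrow T) : (source b \in val C) = (target b \in val C).
Proof.
have h : connect (@uadj T) (source b) (target b).
  by apply: connect1; apply/orP; left; apply/adjP; exists b.
apply/idP/idP=> /component_connect ->; last by rewrite uadj_connect_sym.
exact: h.
Qed.

Variables (Q : quiver) (f : qmorph T Q).

Lemma full_on_arrow C (b : arrow T) : target b \in val C ->
  exists c : arrow (full_on (val C)), val c = b.
Proof.
move=> hb; have h : (source b \in val C) && (target b \in val C).
  by rewrite component_arrow hb.
by exists (exist (fun b => (source b \in val C) && (target b \in val C)) b h).
Qed.

Lemma adj_full_on C (x y : full_on (val C)) : adj x y <-> adj (val x) (val y).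
Proof.
split=> /adjP[b eb1 eb2]; first by rewrite -eb1 -eb2; apply/adjP; exists (val b).
have [|c ec] := @full_on_arrow C b; first by rewrite eb2 (valP y).
by apply/adjP; exists c; apply: val_inj; rewrite /= ec.
Qed.

Lemma sim_full_on C (x y : full_on (val C)) :
  sim_over (full_on_over f (val C)) x y <-> sim_over f (val x) (val y).
Proof.
apply: (similar_transfer (i := val)) => [{}x {}y //|{}x {}y /adj_full_on//|p {}x].
case/adjP=> b eb1 eb2; have [|c ec] := @full_on_arrow C b; first by rewrite eb2 (valP x).
exists (source c); first by rewrite /= ec.
by apply/adj_full_on; rewrite /= ec; apply/adjP; exists b.
Qed.

(** Similarity looks only at the subtrees above two vertices, and arrows with a common target lie in
    one component. This relates the algorithm, which prunes the trees one at a time, to the program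
    and to the linear algebra, which treat the whole forest. *)
Lemma pruned_components (S : {set arrow T}) : pruned f S <->
  forall C, pruned (full_on_over f (val C)) [set b : arrow (full_on (val C)) | val b \in S].
Proof.
split=> [[cS iS] C|h].
  split=> [b|b c]; rewrite !inE.
    move/cS=> [c hc [ec s]]; have [|d ed] := @full_on_arrow C c.
      by rewrite ec; case/andP: (valP b).
    exists d; first by rewrite inE ed.
    by split; [apply: val_inj; rewrite /= ed|apply/sim_full_on; rewrite /= ed].
  move=> bS cS' /(congr1 val) e h; apply: val_inj; apply: iS => //.
  exact: (proj1 (@sim_full_on C _ _) h).
split=> [b bS|b c bS cS e s].
  pose C := component_of (target b); have [cS _] := h C.
  have [c ec] := full_on_arrow (mem_component_of (target b)).
  have [|d] := cS c; first by rewrite inE ec.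
  rewrite inE => dS [/(congr1 val) /= ed /(proj1 (@sim_full_on C _ _)) /= s].
  exists (val d) => //; split; first (rewrite ed; apply: (f_equal (@target T) ec)).
  by have <- : source (val c) = source b by rewrite ec.
pose C := component_of (target b); have [_ iS] := h C.
have [b' eb] := full_on_arrow (mem_component_of (target b)).
have [|c' ec] := @full_on_arrow C c; first by rewrite -e mem_component_of.
rewrite -eb -ec; congr val; apply: iS; rewrite ?inE ?eb ?ec //.
  by apply: val_inj; rewrite /= eb ec.
by apply/sim_full_on; rewrite /= eb ec.
Qed.

Hypothesis gT : graded T.

Lemma sink_full_on C (x : full_on (val C)) : sink x = sink (val x).
Proof.
apply: negb_inj; apply/sinkPn/sinkPn=> -[b eb]; first by exists (val b); rewrite -eb.
have [|c ec] := @full_on_arrow C b; first by rewrite -component_arrow eb (valP x).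
by exists c; apply: val_inj; rewrite /= ec.
Qed.

Lemma level_full_on_S C (b : arrow (full_on (val C))) :
  level (val (source b)) = (level (val (target b))).+1.
Proof. exact: levelS gT (val b). Qed.

Lemma level_full_on_0 C (x : full_on (val C)) : sink x = (level (val x) == 0).
Proof. by rewrite sink_full_on sink_level. Qed.

Lemma level_full_on C (x : full_on (val C)) : level x = level (val x).
Proof. exact: (level_lev (@level_full_on_S C) (@level_full_on_0 C)). Qed.

Lemma graded_full_on C : graded (full_on (val C)).
Proof.
apply: (lev_graded _ (@level_full_on_S C) (@level_full_on_0 C)).
by move=> b c /(congr1 val) /= /(source_inj gT) /val_inj.
Qed.

End Components.

(** * Linearizations *)

Section LinearAlgebra.
Local Open Scope ring_scope.
Variable k : fieldType.

Lemma linfunE (U V : vectType k) (f : U -> V) : linear f -> linfun f =1 f.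
Proof.
move=> lf; pose m := GRing.isLinear.Build k U V _ f lf.
by pose F : {linear U -> V} := HB.pack f m; apply: (lfunE F).
Qed.

Section DirectSumMaps.
Variables (I : finType) (V : I -> vectType k).

Lemma dsum_projE i (v : dsum V) : dsum_proj V i v = v i.
Proof. by rewrite linfunE // => c u w; rewrite !ffunE. Qed.

Lemma dsum_injE i (w : V i) :
  dsum_inj V i w = finfun (dfwith (fun j => 0 : V j) i w) :> dsum V.
Proof.
rewrite linfunE // => c u v; apply/ffunP=> j; rewrite !ffunE.
have [<-|nij] := eqVneq i j; first by rewrite !dfwithin.
by rewrite !dfwithout // scaler0 addr0.
Qed.

End DirectSumMaps.
End LinearAlgebra.

(** * Coordinates and matrices *)

Section Coordinates.
Local Open Scope ring_scope.
Variables (k : fieldType) (T Q : quiver) (g : qmorph T Q).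
Let M := linearization k g.
Implicit Types (q : Q) (y : T).

(* Vectors of the linearization are handled through their coordinates, which
   are indexed by all vertices of [T] and vanish outside of the fiber. *)
Definition co q y (v : M q) : k^o :=
  if insub y is Some z then (v : dsum (fun=> k^o : vectType k)) (z : fiber g q) else 0.

Definition mk q (c : T -> k) : M q :=
  [ffun z : fiber g q => c (val z) : k^o] : dsum (fun=> k^o : vectType k).

Lemma co_linear q y : linear (@co q y).
Proof.
move=> c u v; rewrite /co; case: insubP => [z _ _|_]; last by rewrite scaler0 addr0.
by rewrite !ffunE.
Qed.

HB.instance Definition _ q y :=
  GRing.isLinear.Build k (M q) k^o _ (@co q y) (@co_linear q y).

Lemma co_out q y v : g y != q -> @co q y v = 0.
Proof. by move=> h; rewrite /co insubN. Qed.

Lemma co_mk q y c : co y (mk q c) = if g y == q then c y else 0.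
Proof.
rewrite /co; case: insubP => [z -> <-|/negbTE->//]; by rewrite ffunE.
Qed.

Lemma co_inj q (v w : M q) : (forall y, g y = q -> co y v = co y w) -> v = w.
Proof.
move=> h; apply/ffunP=> z; have := h (val z) (eqP (valP z)).
by rewrite /co valK.
Qed.

Definition bas q y : M q := mk q (fun x => (x == y)%:R).

Lemma co_bas q y x : co x (bas q y) = ((x == y) && (g x == q))%:R.
Proof. by rewrite co_mk; case: eqP; rewrite ?andbF ?andbT. Qed.

Lemma bas_expand q (v : M q) : v = \sum_y co y v *: bas q y.
Proof.
apply: co_inj => x e; rewrite linear_sum (bigD1 x) //= linearZ /= co_bas eqxx e eqxx.
rewrite big1 ?addr0 => [|y ny]; first by rewrite /GRing.scale /= mulr1.
by rewrite linearZ /= co_bas eq_sym (negbTE ny) scaler0.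
Qed.

Lemma co_map_at a (v : M (source a)) x :
  co x (map_at M a v) =
  \sum_(b | (on_arrow g b == a) && (target b == x)) co (source b) v.
Proof.
have step b : co x ((dsum_inj (fun y : fiber g (target a) => k^o) (in_target b) \o
        (\1 \o dsum_proj (fun y : fiber g (source a) => k^o) (in_source b)))%VF v) =
   if target (val b) == x then co (source (val b)) v else 0.
  rewrite !comp_lfunE id_lfunE dsum_projE dsum_injE /co.
  have -> : insub (source (val b)) = Some (in_source b).
    case: insubP => [z _ ez|]; last by rewrite fiber_source.
    by congr Some; apply: val_inj.
  case: insubP => [z gz ez|gx]; last first.
    by case: eqP => // ex; rewrite -ex fiber_target in gx.
  rewrite ffunE; have [e|ne] := eqVneq (in_target b) z.
    by rewrite -e dfwithin -ez -e eqxx.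
  rewrite dfwithout //; case: eqP => // e; case/eqP: ne.
  by apply: val_inj; rewrite /= e ez.
rewrite /M /linearization /push_forward /= sum_lfunE linear_sum.
transitivity (\sum_(b : arrow_fiber g a)
    if target (val b) == x then co (source (val b)) v else 0).
  by apply: eq_bigr => b _; apply: step.
rewrite -(big_sub [pred b | on_arrow g b == a]
  (fun b => if target b == x then co (source b) v else 0)).
by rewrite -big_mkcondr.
Qed.

Lemma map_at_bas (b : arrow T) a : injective (@source T) -> on_arrow g b = a ->
  map_at M a (bas (source a) (source b)) = bas (target a) (target b).
Proof.
move=> inj oa; apply: co_inj => y ey; rewrite co_bas ey eqxx andbT co_map_at.
have es : g (source b) = source a by rewrite -oa on_source.
rewrite big_mkcond (bigD1 b) // oa eqxx andTb co_bas eqxx es eqxx big1.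
  by rewrite /= addr0 eq_sym; case: eqP.
move=> c nc; rewrite co_bas.
have [e|_] := eqVneq (source c) (source b); last by case: ifP.
by rewrite (inj _ _ e) eqxx in nc.
Qed.

End Coordinates.

Section MatrixMaps.
Local Open Scope ring_scope.
Variables (k : fieldType) (T T' Q : quiver) (g : qmorph T Q) (g' : qmorph T' Q).
Variable m : T -> T' -> k.

(** An entry [m y y'] matters only if [y] and [y'] both lie over [q]; [co] and [mk] discard the
    others. *)
Definition mxhom q : 'Hom(linearization k g q, linearization k g' q) :=
  linfun (fun v => @mk k _ _ g' q (fun y' => \sum_y co y v * m y y')).

Lemma mxhomE q v : mxhom q v = @mk k _ _ g' q (fun y' => \sum_y co y v * m y y').
Proof.
rewrite linfunE // => c u w; apply: co_inj => y' e.
rewrite linearP /= !co_mk e eqxx /GRing.scale /= mulr_sumr -big_split /=.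
by apply: eq_bigr => y _; rewrite linearP /= /GRing.scale /= mulrDl mulrA.
Qed.

Lemma co_mxhom q v y' : g' y' = q -> co y' (mxhom q v) = \sum_y co y v * m y y'.
Proof. by move=> e; rewrite mxhomE co_mk e eqxx. Qed.

(** The square at the arrow [a], evaluated on the basis vector of [y] and read off at [x']: on the
    left the matrix acts before the structure map, on the right after it. *)
Definition mx_natural : Prop := forall a y x', g y = source a -> g' x' = target a ->
  \sum_(b | (on_arrow g' b == a) && (target b == x')) m y (source b) =
  \sum_(b | (on_arrow g b == a) && (source b == y)) m (target b) x'.

Lemma mxhom_natural : mx_natural -> forall (a : arrow Q) v,
  mxhom (target a) (map_at (linearization k g) a v) =
  map_at (linearization k g') a (mxhom (source a) v).
Proof.
move=> nat a v; apply: co_inj => x' e; rewrite co_mxhom // co_map_at.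
transitivity (\sum_(b | on_arrow g b == a) co (source b) v * m (target b) x').
  rewrite (partition_big (@target T) xpredT) //=; apply: eq_bigr => x _.
  by rewrite co_map_at mulr_suml; apply: eq_bigr => b /andP[_ /eqP->].
transitivity (\sum_y co y v * \sum_(b | (on_arrow g' b == a) && (target b == x')) m y (source b)).
  rewrite (partition_big (@source T) xpredT) //=; apply: eq_bigr => y _.
  have [ey|ny] := eqVneq (g y) (source a).
    by rewrite nat // mulr_sumr; apply: eq_bigr => b /andP[_ /eqP->].
  rewrite co_out // mul0r big1 // => b /andP[_ /eqP->]; by rewrite co_out // mul0r.
under eq_bigr do rewrite mulr_sumr.
rewrite exchange_big; apply: eq_bigr => b /andP[/eqP eb _].
by rewrite co_mxhom // -eb on_source.
Qed.

Definition mxrep (nat : mx_natural) : rep_hom (linearization k g) (linearization k g') :=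
  RepHom (mxhom_natural nat).

End MatrixMaps.

Section RepIso.
Local Open Scope ring_scope.
Variables (k : fieldType) (Q : quiver).
Implicit Types M N : rep k Q.

Definition rep_iso M N : Prop := exists (phi : rep_hom M N) (psi : rep_hom N M),
  (forall x v, psi x (phi x v) = v) /\ (forall x w, phi x (psi x w) = w).

Lemma bijective_rep_iso M N (phi : rep_hom M N) :
  (forall x, bijective (phi x)) -> rep_iso M N.
Proof.
move=> bij.
have ex x : exists g : 'Hom(N x, M x), cancel (phi x) g /\ cancel g (phi x).
  case: (bij x) => g fK gK; exists (linfun g).
  have gE : linfun g =1 g.
    apply: linfunE => c u v; apply: (can_inj fK).
    by rewrite gK linearP /= !gK.
  by split=> v; rewrite gE.
pose psi x := projT1 (cid (ex x)).
have hpsi x : cancel (phi x) (psi x) /\ cancel (psi x) (phi x) := projT2 (cid (ex x)).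
have nat (a : arrow Q) (v : N (source a)) :
    psi (target a) (map_at N a v) = map_at M a (psi (source a) v).
  apply: (can_inj (hpsi (target a)).1).
  by rewrite hom_natural (hpsi (target a)).2 (hpsi (source a)).2.
exists phi, (RepHom nat); split=> x; first exact: (hpsi x).1.
exact: (hpsi x).2.
Qed.

Lemma rep_iso_sym M N : rep_iso M N -> rep_iso N M.
Proof. by case=> phi [psi [h1 h2]]; exists psi, phi. Qed.

Definition rep_comp L M N (psi : rep_hom M N) (phi : rep_hom L M) : rep_hom L N.
Proof.
apply: (@RepHom _ _ L N (fun x => (psi x \o phi x)%VF)) => a v.
by rewrite !comp_lfunE !hom_natural.
Defined.

Lemma rep_compE L M N (psi : rep_hom M N) (phi : rep_hom L M) x v :
  rep_comp psi phi x v = psi x (phi x v).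
Proof. by rewrite /= comp_lfunE. Qed.

Lemma direct_sum_iso M N (I : finType) (W : I -> rep k Q) :
  rep_iso M N -> is_direct_sum N W -> is_direct_sum M W.
Proof.
case=> f [f' [fK f'K]] [inj [proj [h1 h2 h3]]].
exists (fun i => rep_comp f' (inj i)), (fun i => rep_comp (proj i) f); split.
- by move=> i x w; rewrite !rep_compE f'K h1.
- by move=> i j x w nij; rewrite !rep_compE f'K h2.
move=> x v; rewrite -{1}(fK x v) {1}(h3 x (f x v)) linear_sum.
by apply: eq_bigr => i _; rewrite !rep_compE.
Qed.

End RepIso.

Section ComponentSum.
Local Open Scope ring_scope.
Variables (k : fieldType) (T Q : quiver) (g : qmorph T Q).
Implicit Types C D : component T.
Let gC C := full_on_over g (val C).

Let into (C : component T) (y : full_on (val C)) (x : T) : k := (val y == x)%:R.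
Let onto (C : component T) (x : T) (y : full_on (val C)) : k := (x == val y)%:R.

(** An arrow with one end in a component has both ends there, so its target alone decides whether it
    belongs to the component. *)
Lemma sum_full_on C (P : pred (arrow T)) (F : arrow T -> k) :
  \sum_(b : arrow (full_on (val C)) | P (val b)) F (val b) =
  \sum_(b | (target b \in val C) && P b) F b.
Proof.
rewrite big_mkcond.
rewrite -(big_sub [pred b : arrow T | (source b \in val C) && (target b \in val C)]
  (fun b => if P b then F b else 0)) -big_mkcondr.
by apply: eq_bigl => b /=; rewrite unfold_in /= component_arrow andbb.
Qed.

Lemma into_natural C : mx_natural (gC C) g (@into C).
Proof.
move=> a y x' _ _.
transitivity (\sum_(b : arrow (full_on (val C)) |
   (on_arrow g (val b) == a) && (source (val b) == val y)) (target (val b) == x')%:R : k); last first.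
  by apply: eq_bigl => b; rewrite -(inj_eq val_inj).
rewrite (sum_full_on C (fun b => (on_arrow g b == a) && (source b == val y))
   (fun b => (target b == x')%:R)).
rewrite [LHS]big_mkcond [RHS]big_mkcond; apply: eq_bigr => b _ /=; rewrite /into (eq_sym (val y)).
case: (on_arrow g b == a); rewrite ?andbF //=.
have [e|_] := eqVneq (source b) (val y); last by rewrite andbF; case: ifP.
by rewrite andbT -component_arrow e (valP y); case: ifP.
Qed.

Lemma onto_natural C : mx_natural g (gC C) (@onto C).
Proof.
move=> a y x' _ _.
transitivity (\sum_(b : arrow (full_on (val C)) |
   (on_arrow g (val b) == a) && (target (val b) == val x')) (y == source (val b))%:R : k).
  by apply: eq_bigl => b; rewrite -(inj_eq val_inj).
rewrite (sum_full_on C (fun b => (on_arrow g b == a) && (target b == val x'))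
   (fun b => (y == source b)%:R)).
rewrite [LHS]big_mkcond [RHS]big_mkcond; apply: eq_bigr => b _ /=; rewrite /onto (eq_sym y).
case: (on_arrow g b == a); rewrite ?andbF //=.
have [->|_] := eqVneq (target b) (val x'); last by rewrite andbF; case: ifP.
by rewrite andbT (valP x'); case: ifP.
Qed.

Lemma co_onto C q (v : linearization k g q) (y : full_on (val C)) : g (val y) = q ->
  co y (mxhom g (gC C) (@onto C) q v) = co (val y) v.
Proof.
move=> e; rewrite co_mxhom // (bigD1 (val y)) //= /onto eqxx mulr1 big1 ?addr0 // => x nx.
by rewrite (negbTE nx) mulr0.
Qed.

Lemma co_into C q (v : linearization k (gC C) q) (y : full_on (val C)) : g (val y) = q ->
  co (val y) (mxhom (gC C) g (@into C) q v) = co y v.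
Proof.
move=> e; rewrite co_mxhom // (bigD1 y) //= /into eqxx mulr1 big1 ?addr0 // => x nx.
by rewrite (inj_eq val_inj) (negbTE nx) mulr0.
Qed.

Lemma co_into_out C q (v : linearization k (gC C) q) x : g x = q -> x \notin val C ->
  co x (mxhom (gC C) g (@into C) q v) = 0.
Proof.
move=> e nx; rewrite co_mxhom // big1 // => y _; rewrite /into.
case: eqP => [eyx|_]; last by rewrite mulr0.
by rewrite -eyx (valP y) in nx.
Qed.

Lemma components_direct_sum :
  is_direct_sum (linearization k g) (fun C : component T => linearization k (gC C)).
Proof.
exists (fun C => mxrep (@into_natural C)), (fun C => mxrep (@onto_natural C)); split.
- by move=> C q w; apply: co_inj => y e; rewrite /= co_onto // co_into.
- move=> C D q w nCD; apply: co_inj => y e; rewrite /= co_onto // linear0.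
  rewrite co_into_out //; apply: contraNN nCD => /component_ofP->.
  by rewrite -(component_ofP (valP y)).
move=> q v; apply: co_inj => x e; rewrite linear_sum.
pose y : full_on (val (component_of x)) := exist (fun z => z \in _) x (mem_component_of x).
rewrite (bigD1 (component_of x)) //= (co_into _ (y := y)) // co_onto // big1 ?addr0 // => C nC.
by rewrite co_into_out //; apply: contraNN nC => /component_ofP->.
Qed.

End ComponentSum.

Section TreeRec.
Variables (T : quiver) (A : Type) (a0 : A) (step : arrow T -> A -> A).
Hypothesis gT : graded T.

(** Recursion along the unique path to the root. A quiver offers no structural recursion, so the
    level serves as fuel; [tree_recS] shows that it suffices. *)
Fixpoint tree_rec_fuel n (x : T) : A :=
  if n is n'.+1 then
    if [pick b : arrow T | source b == x] is Some b
    then step b (tree_rec_fuel n' (target b)) else a0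
  else a0.

Definition tree_rec x := tree_rec_fuel (level x) x.

Lemma tree_recS (b : arrow T) : tree_rec (source b) = step b (tree_rec (target b)).
Proof.
rewrite /tree_rec (levelS gT) /=; case: pickP => [c /eqP/(source_inj gT)->//|/(_ b)].
by rewrite eqxx.
Qed.

Lemma tree_rec0 x : sink x -> tree_rec x = a0.
Proof. by rewrite sink_level /tree_rec => /eqP->. Qed.

End TreeRec.

(** * The summands of a linearization *)

Section PrunedSummands.
Variables (k : fieldType) (T Q : quiver) (f : qmorph T Q) (S : {set arrow T}).
Hypothesis gT : graded T.
Hypothesis injQ : injective (@source Q).
Hypothesis level_f : forall x y, f x = f y -> level x = level y.
Hypothesis sink_f : forall x, sink x -> sink (f x).
Hypothesis pS : pruned f S.
Let fS := keep_arrows_over f S.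

(** An arrow of $Q$ is determined by its source, so compatibility on vertices yields compatibility
    on arrows. *)
Lemma on_arrow_eq (b : arrow T) a : f (source b) = source a -> on_arrow f b = a.
Proof. by move=> e; apply: injQ; rewrite on_source. Qed.

(** Similarity may answer with a deleted arrow, but this one is dominated by a kept arrow with the
    same target, and similarity is transitive. *)
Lemma sim_kept (p x y : T) : adj p x -> sim_over f x y ->
  exists c, [/\ c \in S, target c = y & sim_over f p (source c)].
Proof.
move=> px sxy; have [q /adjP[d <- ed] hq] := similar_pred sxy px.
have [dS|/(pS.1)[c cS [ec s]]] := boolP (d \in S); first by exists d.
by exists c; split=> //; [rewrite ec|apply: similar_trans hq s].
Qed.

Definition up_set (x : T) : {set T} := [set y | `[< sim_over f x y >]].

Lemma mem_up_set x y : reflect (sim_over f x y) (y \in up_set x).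
Proof. by rewrite inE; apply: asboolP. Qed.

(** A choice of a kept predecessor of [y] to which the subtree above [p] maps; it exists whenever
    [p] precedes a vertex that is similar to [y]. *)
Definition candidate (p y : T) : option T :=
  omap source [pick c in S | (target c == y) && `[< sim_over f p (source c) >]].

(* A morphism over [Q], defined on the components of the subquiver that are cut
   off by deleted arrows, which sends each of them into components that are cut
   off less often. *)
Definition fold_map : T -> option T :=
  tree_rec None (fun b o => if b \in S then obind (candidate (source b)) o
                            else candidate (source b) (target b)).

(** Counts the deleted arrows on the path to the root; identity minus folding is triangular with
    respect to it. *)
Definition cut_depth : T -> nat :=
  tree_rec 0 (fun b n => if b \in S then n else n.+1).

Lemma candidateP p x y : adj p x -> sim_over f x y ->
  exists c, [/\ c \in S, target c = y, sim_over f p (source c) &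
                candidate p y = Some (source c)].
Proof.
move=> px sxy; have [c [cS ec sc]] := sim_kept px sxy; rewrite /candidate.
case: pickP => [d /and3P[dS /eqP ed /asboolP sd]|/(_ c)]; first by exists d.
by rewrite cS ec eqxx; case: asboolP.
Qed.

Lemma fold_map_cut b : b \notin S -> exists c, [/\ c \in S, target c = target b,
  sim_over f (source b) (source c) & fold_map (source b) = Some (source c)].
Proof.
move=> bS; rewrite /fold_map tree_recS // (negbTE bS).
by apply: candidateP (similar_refl _ _ _); apply/adjP; exists b.
Qed.

Lemma fold_mapP x y : fold_map x = Some y -> sim_over f x y /\ cut_depth y < cut_depth x.
Proof.
have [n] := ubnP (level x); elim: n x y => // n IH x y ltn.
have [sx|/sinkPn[b eb]] := boolP (sink x); first by rewrite /fold_map tree_rec0.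
move: ltn; rewrite -{x}eb levelS // => ltn.
have [bS|bS] := boolP (b \in S); last first.
  have [c [cS ec sc ->]] := fold_map_cut bS; case=> <-; split=> //.
  by rewrite /cut_depth !tree_recS // cS (negbTE bS) ec.
rewrite {1}/fold_map tree_recS // bS -/fold_map.
case e : (fold_map (target b)) => [z|//] /=.
have [s lt] := IH _ _ ltn e.
have [|c [cS ec sc ->]] := candidateP _ s (p := source b); first by apply/adjP; exists b.
case=> <-; split=> //; move: lt.
by rewrite /cut_depth !(tree_recS _ _ gT b) (tree_recS _ _ gT c) // cS bS ec.
Qed.

Lemma fold_map_kept b : b \in S ->
  if fold_map (target b) is Some y then
    exists c, [/\ c \in S, target c = y, sim_over f (source b) (source c)
                & fold_map (source b) = Some (source c)]
  else fold_map (source b) = None.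
Proof.
move=> bS; rewrite {2 3}/fold_map tree_recS // bS -/fold_map.
case e : (fold_map (target b)) => [y|//].
by apply: candidateP (fold_mapP e).1; apply/adjP; exists b.
Qed.

Local Open Scope ring_scope.

Definition fold_mx (x : keep_arrows S) (y : T) : k :=
  (x == y :> T)%:R - (fold_map x == Some y)%:R.

Lemma sum_over_target (a : arrow Q) d x' : on_arrow f d = a ->
  \sum_(b | (on_arrow f b == a) && (target b == x')) (source d == source b)%:R
  = (target d == x')%:R :> k.
Proof.
move=> ed; rewrite big_mkcond (bigD1 d) //= ed !eqxx /= big1 ?addr0.
  by case: eqP.
move=> b nb; case: ifP => // _; case: eqP => // /(source_inj gT) e.
by rewrite e eqxx in nb.
Qed.

(** Let [b0] be the arrow of [T] out of [y]. If it is kept, folding commutes with it. If it is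
    deleted, [a] sends the basis vector of [y] to 0 in the pruned quiver, and its image dies in [T]
    too: the fold of [y] is the source of an arrow with the same target as [b0], so the two terms
    cancel. *)
Lemma fold_mx_natural : mx_natural fS f fold_mx.
Proof.
move=> a y x' ey ex'.
(* A sink of [T] lies over a sink of $Q$, but [a] starts at the image of [y]. *)
have /sinkPn[b0 eb0] : ~~ sink (y : T).
  by apply/negP=> /sink_f; rewrite [f y]ey; apply/negP/sinkPn; exists a.
have on0 : on_arrow f b0 = a by apply: on_arrow_eq; rewrite eb0.
have lhs : \sum_(b | (on_arrow f b == a) && (target b == x')) fold_mx y (source b) =
   (target b0 == x')%:R - (if fold_map (source b0) is Some z then
     \sum_(b | (on_arrow f b == a) && (target b == x')) (z == source b)%:R else 0) :> k.
  rewrite -(sum_over_target x' on0) /fold_mx sumrB -eb0; congr (_ - _).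
  case: (fold_map _) => [z|]; last by rewrite big1.
  by apply: eq_bigr => b _; rewrite (inj_eq Some_inj).
have rhs : \sum_(b | (on_arrow fS b == a) && (source b == y)) fold_mx (target b) x' =
   if b0 \in S then fold_mx (target b0) x' else 0.
  have [bS|bS] := boolP (b0 \in S).
    pose b1 : arrow (keep_arrows S) := exist (fun b => b \in S) b0 bS.
    rewrite (bigD1 b1) /=; last by rewrite on0 eb0 !eqxx.
    rewrite big1 ?addr0 // => c /andP[/andP[_ /eqP ec]] /eqP[]; apply: val_inj.
    by apply: (source_inj gT); rewrite /= eb0 -ec.
  rewrite big1 // => c /andP[_ /eqP ec]; case/negP: bS.
  by rewrite (_ : b0 = val c) ?(valP c) //; apply: (source_inj gT); rewrite eb0 -ec.
have on_sim c : sim_over f (source b0) (source c) -> on_arrow f c = a.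
  by move=> s; apply: on_arrow_eq; rewrite -(similar_label s) eb0.
rewrite [LHS]lhs [RHS]rhs; have [bS|bS] := boolP (b0 \in S); last first.
  have [c [_ ec /on_sim oc ->]] := fold_map_cut bS.
  by rewrite sum_over_target // ec subrr.
rewrite /fold_mx; have := fold_map_kept bS.
case: (fold_map (target b0)) => [z [c [_ ec /on_sim oc ->]]|->]; last by [].
by rewrite sum_over_target // ec.
Qed.

(** The coordinate of the image at [x] is that of [v] minus those at the vertices folded onto [x],
    which have larger [cut_depth]. So the coordinates of a vector in the kernel vanish from the
    largest depth downwards, by induction on [N - cut_depth x]. *)
Lemma fold_mx_inj q : injective (mxhom fS f fold_mx q).
Proof.
apply/lker0P; rewrite -subv0; apply/subvP => v; rewrite memv_ker => /eqP v0.
suff -> : v = 0 by rewrite mem0v.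
apply: co_inj => x ex; rewrite linear0.
pose N := \max_(x : T) cut_depth x.
have [n] := ubnP (N - cut_depth x); elim: n x ex => // n IH x ex ltn.
have : @co k T Q f q x (mxhom fS f fold_mx q v) = 0 by rewrite v0 linear0.
rewrite co_mxhom // (bigD1 x) //= /fold_mx eqxx.
have -> : fold_map x == Some x = false.
  by apply/negP=> /eqP/fold_mapP[_]; rewrite ltnn.
rewrite subr0 mulr1 big1 ?addr0 // => y nyx.
rewrite (negbTE nyx) sub0r; case: eqP => [/fold_mapP[s lt]|_]; last by rewrite oppr0 mulr0.
rewrite IH ?mul0r //; first by rewrite /= (similar_label s).
have : (cut_depth y <= N)%N by apply: (leq_bigmax y).
by move: ltn lt; lia.
Qed.

(** Deleting arrows leaves the vertices alone, so at each [q] the two spaces coincide and the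
    injective map is an endomorphism of a finite dimensional space. *)
Lemma keep_arrows_iso : rep_iso (linearization k f) (linearization k fS).
Proof.
apply: rep_iso_sym; apply: (bijective_rep_iso (phi := mxrep fold_mx_natural)) => q.
have h : lker (mxhom fS f fold_mx q : 'End(linearization k f q)) == 0%VS.
  exact/lker0P/fold_mx_inj.
by exists ((mxhom fS f fold_mx q : 'End(linearization k f q))^-1)%VF;
  [apply: lker0_lfunK|apply: lker0_lfunVK].
Qed.

Lemma pruned_direct_sum : is_direct_sum (linearization k f)
  (fun C : component (keep_arrows S) => linearization k (full_on_over fS (val C))).
Proof. exact: direct_sum_iso keep_arrows_iso (components_direct_sum k fS). Qed.

Section Component.
Variable C : component (keep_arrows S).
Let K := full_on (val C).
Let g : qmorph K Q := full_on_over fS (val C).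
Let vK (y : K) : T := val y.
Let aK (b : arrow K) : arrow T := val (val b).

Lemma lift_target (c : arrow T) (y : K) : c \in S -> target c = vK y ->
  exists d : arrow K, target d = y /\ aK d = c.
Proof.
move=> cS ec; pose c1 : arrow (keep_arrows S) := exist (fun b => b \in S) c cS.
have [|d ed] := @full_on_arrow _ C c1; first by rewrite /= ec (valP y).
exists d; split; last by rewrite /aK ed.
by apply: val_inj; rewrite /= ed /= ec.
Qed.

(** The root of a component need not be a root of [T]: it is the vertex of smallest level, whose
    outgoing arrow may have been deleted. Any sink of the component lies above it, hence equals
    it. *)
Lemma component_root : exists r : K, [/\ sink r,
  forall y, sink y -> y = r & forall y, (level (vK r) <= level (vK y))%N].
Proof.
have injS : injective (@source (keep_arrows S)).
  by move=> b c /(source_inj gT)/val_inj.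
have levS (b : arrow (keep_arrows S)) : (level (target b : T) < level (source b : T))%N.
  by rewrite /= levelS.
have [z zC] := component_nonempty C.
pose z' : K := exist (fun z => z \in val C) z zC.
case: (arg_minnP (fun y : K => level (vK y)) (P := xpredT) (i0 := z')) => // r _ rmin.
have sinkE (y : K) : sink y = sink (val y).
  apply: negb_inj; apply/sinkPn/sinkPn=> -[b eb]; first by exists (val b); rewrite -eb.
  have [|c ec] := @full_on_arrow _ C b; first by rewrite -component_arrow eb (valP y).
  by exists c; apply: val_inj; rewrite /= ec.
have sr : sink r.
  apply/negPn/negP=> /sinkPn[b eb]; have := rmin (target b) isT.
  by rewrite leqNgt -eb levS.
exists r; split=> // [y sy|y]; last exact: rmin.
have cry : connect (@uadj (keep_arrows S)) (val r) (val y).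
  by rewrite -(component_connect _ (valP r)) (valP y).
have := uadj_connect_sink injS cry; rewrite -sinkE => /(_ sy) h.
by apply: val_inj; apply/esym/(sink_leQ _ h); rewrite -sinkE.
Qed.

Section Idempotent.
Variable E : rep_hom (linearization k g) (linearization k g).
Hypothesis EE : forall q v, E q (E q v) = E q v.
Variable r : K.
Hypothesis sink_r : forall y : K, sink y -> y = r.
Hypothesis level_r : forall y, (level (vK r) <= level (vK y))%N.
Hypothesis Er : forall v, E (g r) v = 0.

Definition entry q (y z : K) : k := co z (E q (bas k g q y)).

Lemma source_injK : injective (@source K).
Proof. by move=> b c /(congr1 val) /= /(source_inj gT)/val_inj/val_inj. Qed.

Lemma on_arrowK (b : arrow K) a : g (source b) = source a -> on_arrow g b = a.
Proof. exact: on_arrow_eq. Qed.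

Lemma entry_target (b : arrow K) a x : on_arrow g b = a -> g x = target a ->
  entry (target a) (target b) x =
  \sum_(c | (on_arrow g c == a) && (target c == x)) entry (source a) (source b) (source c).
Proof.
move=> oa ex; rewrite -co_map_at -hom_natural (map_at_bas _ _ oa) //.
exact: source_injK.
Qed.

(** By naturality, an entry between the targets of two arrows is the sum, over all arrows into the
    second target, of entries between sources. If it is nonzero, so is one of the summands; climbing
    the subtrees in this way gives a simulation. *)
Lemma entry_sim q (y z : K) : g y = q -> g z = q -> entry q y z != 0 ->
  sim_over f (vK y) (vK z).
Proof.
(* A predecessor in [T] may have been cut off from the component. Composing with similarity allows
   replacing it by a kept one before the entries are used. *)
move=> ey ez nz; exists (fun a b => exists q (y z : K),
  [/\ g y = q, g z = q, entry q y z != 0, sim_over f a (vK y) & vK z = b]); last first.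
  by exists q, y, z; split=> //; apply: similar_refl.
move=> a _ [{ey ez nz}q [{}y [{}z [ey ez nz s <-]]]].
split; first by rewrite (similar_label s) [LHS]ey -ez.
move=> p pa; have [c [cS ec sc]] := sim_kept pa s.
have [d [ed eda]] := lift_target cS ec.
pose a' := on_arrow g d.
have eq : q = target a' by rewrite -ey -ed on_target.
have : entry (target a') (target d) z != 0 by rewrite -eq ed.
rewrite entry_target // -?eq // => nzs.
have [b /andP[/eqP ob /eqP eb] nb] : exists2 b, (on_arrow g b == a') && (target b == z) &
    entry (source a') (source d) (source b) != 0.
  apply/exists_inP; apply: contraR nzs; rewrite negb_exists_in => /forall_inP h.
  by rewrite big1 // => b /h; rewrite negbK => /eqP.
exists (vK (source b)).
  by apply/adjP; exists (aK b); rewrite // -eb.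
exists (source a'), (source d), (source b); split=> //.
- by rewrite -on_source.
- by rewrite -on_source ob.
- by move: sc; rewrite -eda.
Qed.

Lemma entry_out q (y z : K) : g z != q -> entry q y z = 0.
Proof. exact: co_out. Qed.

(* Below a level where the idempotent vanishes, its entries are strictly
   triangular for the preorder: the entries from [y] to the children of a
   vertex add up to zero, and siblings are incomparable. *)
Lemma entry_zero n q (y z : K) :
  level (vK y) = n -> g y = q -> g z = q -> entry q y z = 0.
Proof.
elim: n q y z => [|n IH] q y z ly ey ez.
  have /sink_r ey' : sink y.
    by apply/negPn/negP=> /sinkPn[b eb]; move: ly; rewrite -eb /vK /= levelS.
  by rewrite /entry -ey ey' Er linear0.
have strict (x w : K) : level (vK x) = n.+1 -> g x = q -> g w = q -> entry q x w != 0 ->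
    sim_over f (vK x) (vK w) /\ ~ sim_over f (vK w) (vK x).
  move=> lx ex ew nz; split; first exact: entry_sim nz.
  have nsink u : level (vK u) = n.+1 -> u != r -> exists b : arrow K, source b = u.
    by move=> lu nur; apply/sinkPn; apply: contra nur => /sink_r->.
  have nr u : g u = q -> level (vK u) = n.+1 -> u != r.
    move=> eu lu; apply: contraNneq nz => eur.
    by rewrite /entry -eu eur Er linear0.
  have lw : level (vK w) = n.+1 by rewrite -lx; apply: level_f; rewrite [LHS]ew.
  have [c ec] := nsink _ lx (nr _ ex lx).
  have [d ed] := nsink _ lw (nr _ ew lw).
  pose a := on_arrow g c.
  have ea : source a = q by rewrite /a on_source ec.
  have oa : on_arrow g d = a by apply: on_arrowK; rewrite ed ew ea.
  have lc : level (vK (target c)) = n.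
    by apply: succn_inj; rewrite -lx -ec /vK /= levelS.
  have : entry (target a) (target c) (target d) = 0.
    by apply: IH => //; rewrite -on_target // oa.
  rewrite entry_target ?ea ?ec //; last by rewrite -on_target oa.
  have -> : \sum_(b | (on_arrow g b == a) && (target b == target d)) entry q x (source b) =
      entry q x w + \sum_(b | [&& (on_arrow g b == a), (target b == target d) & b != d])
        entry q x (source b).
    rewrite (bigD1 d); last by rewrite oa !eqxx.
    by rewrite ed; congr (_ + _); apply: eq_bigl => b; rewrite andbA.
  (* The entries from [x] to the children of [target d] add up to zero. Were [w] also similar to
     [x], it would be similar to every other child with a nonzero entry, which is excluded for kept
     siblings. *)
  move=> /eqP; rewrite addr_eq0 => /eqP sum swx.
  have : \sum_(b | [&& (on_arrow g b == a), (target b == target d) & b != d])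
      entry q x (source b) != 0.
    by apply: contraNneq nz => e0; rewrite sum e0 oppr0.
  apply/negP; rewrite negbK big1 // => b /and3P[/eqP ob /eqP eb nbd].
  apply/eqP; apply: contraNT nbd => nzb; apply/eqP/esym.
  apply: val_inj; apply: val_inj; apply: (pS.2 (aK d) (aK b)).
  - exact: (valP (val d)).
  - exact: (valP (val b)).
  - by rewrite -[RHS]/(vK (target b)) eb.
  rewrite -[source (aK d)]/(vK (source d)) ed; apply: similar_trans swx _.
  by apply: entry_sim nzb => //; rewrite -ea -ob on_source.
(* Induction on the number of vertices to which [y] is similar. After writing [E] as [E] composed
   with [E], every intermediate [w] with a nonzero entry from [y] has a strictly smaller up-set, so
   the entries from [w] vanish. *)
have [m] := ubnP #|up_set (vK y)|.
elim: m y z ly ey ez => // m IHm y z ly ey ez ltm.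
rewrite /entry -EE (bas_expand (E q (bas k g q y))) !linear_sum big1 // => w _.
rewrite !linearZ /= -/(entry q y w) -/(entry q w z).
have [ew|/entry_out->] := eqVneq (g w) q; last by rewrite scale0r.
have [->|nz] := eqVneq (entry q y w) 0; first by rewrite scale0r.
have lw : level (vK w) = n.+1 by rewrite -ly; apply: level_f; rewrite [LHS]ew.
rewrite (IHm w z) ?scaler0 //; apply: (@leq_trans #|up_set (vK y)|); last exact: ltm.
have [s ns] := strict _ _ ly ey ew nz.
apply: proper_card; apply/fintype.properP; split.
  by apply/fintype.subsetP=> u /mem_up_set h; apply/mem_up_set; apply: similar_trans s h.
exists (vK y); first by apply/mem_up_set; apply: similar_refl.
by apply/mem_up_set.
Qed.

Lemma idempotent_zero q v : E q v = 0.
Proof.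
rewrite (bas_expand v) linear_sum big1 // => y _; rewrite linearZ /=.
have [ey|ny] := eqVneq (g y) q; last by rewrite co_out // scale0r.
suff -> : E q (bas k g q y) = 0 by rewrite scaler0.
apply: co_inj => z ez; rewrite linear0; exact: (@entry_zero (level (vK y))).
Qed.

End Idempotent.

(** Only the root lies over its image, since any other vertex there would have the same level and an
    arrow to a lower one. So one of two complementary summands vanishes on this line, and the
    idempotent projecting onto it is 0. *)
Lemma component_indecomposable : indecomposable (linearization k g).
Proof.
have [r [sr sink_r level_r]] := component_root.
have line (v : linearization k g (g r)) : v = co r v *: bas k g (g r) r.
  rewrite {1}(bas_expand v) (bigD1 r) //= big1 ?addr0 // => y nyr.
  have [ey|ny] := eqVneq (g y) (g r); last by rewrite co_out // scale0r.
  case/eqP: nyr; apply: sink_r; apply/negPn/negP=> /sinkPn[b eb].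
  have := level_r (target b); rewrite -(level_f ey) -/(vK y) -eb.
  by rewrite /vK /= levelS // ltnn.
split.
  move=> /(_ (g r) (bas k g (g r) r)) /(congr1 (@co k K Q g (g r) r)).
  by rewrite linear0 co_bas !eqxx => /eqP; rewrite oner_eq0.
move=> W [inj [proj [h1 h2 h3]]].
have zero b : (forall w : W b (g r), w = 0) -> zero_rep (W b).
  move=> w0 q w; rewrite -(h1 b q w) -(h1 b q (proj b q _)).
  have E0 : rep_comp (inj b) (proj b) q (inj b q w) = 0.
    apply: (idempotent_zero _ sink_r) => [p v|v]; first by rewrite !rep_compE h1.
    by rewrite rep_compE (w0 (proj b _ v)) linear0.
  by move: E0; rewrite rep_compE => ->; rewrite linear0.
have [w0|/existsNP[w1 /eqP nz1]] := pselect (forall w : W true (g r), w = 0).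
  by left; apply: zero.
right; apply: zero => w0.
pose c1 : k := co r (inj true (g r) w1).
have nzc : c1 != 0.
  apply: contraNneq nz1 => c0; rewrite -(h1 true _ w1) [inj true _ w1]line -/c1.
  by rewrite c0 scale0r linear0.
pose c0 : k := co r (inj false (g r) w0).
(* On a line the two images are proportional, and the projection to the [false] summand kills the
   image of the [true] one. *)
have e : inj false (g r) w0 = (c0 / c1) *: inj true (g r) w1.
  by rewrite [in RHS](line (inj true _ w1)) -/c1 scalerA divfK // {1}(line (inj false _ w0)).
by rewrite -(h1 false _ w0) e linearZ /= h2 // scaler0.
Qed.

End Component.

Lemma pruned_summands_of : summands_of f S (linearization k f).
Proof.
by split; [apply: pruned_direct_sum|apply: component_indecomposable].
Qed.

End PrunedSummands.

(** * Running time of Algorithm 1 *)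

Section Specifications.

Lemma sum_const_seq (I : Type) (s : seq I) c : \sum_(i <- s) c = c * size s.
Proof. by rewrite big_const_seq count_predT iter_addn_0. Qed.

(** A Hoare triple with a cost bound. Value and cost are treated together since the cost of a
    computation depends on what is known about earlier results. *)
Definition spec A (m : timed A) (n : nat) (P : A -> Prop) : Prop := P m.1 /\ m.2 <= n.

Lemma spec_bind A B (m : timed A) (g : A -> timed B) n1 n2 n P Q :
  spec m n1 P -> (forall a, P a -> spec (g a) n2 Q) -> n1 + n2 <= n ->
  spec (bind m g) n Q.
Proof.
move=> [hP h1] hg le; have [hQ h2] := hg _ hP; split=> //=.
by apply: leq_trans le; apply: leq_add.
Qed.

Lemma spec_step A B (a : A) (g : A -> timed B) n Q :
  spec (g a) n Q -> spec (bind (step a) g) n.+1 Q.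
Proof. by case. Qed.

Lemma spec_step_end A (a : A) n (P : A -> Prop) : P a -> 0 < n -> spec (step a) n P.
Proof. by []. Qed.

Lemma spec_ret A (a : A) n (P : A -> Prop) : P a -> spec (ret a) n P.
Proof. by []. Qed.

Lemma spec_alloc A B C (t : A -> B) m n (g : (A -> B) -> timed C) Q :
  spec (g t) n Q -> spec (bind (alloc m t) g) (m + n) Q.
Proof. by case=> hQ h; split=> //=; rewrite leq_add2l. Qed.

Lemma spec_weaken A (m : timed A) n n' (P Q : A -> Prop) :
  spec m n P -> (forall a, P a -> Q a) -> n <= n' -> spec m n' Q.
Proof. by move=> [hP h] hQ le; split; [apply: hQ|apply: leq_trans le]. Qed.

(** The invariant speaks of the processed prefix. Each iteration is charged one step more than its
    body. *)
Lemma spec_each (I : eqType) A (s : seq I) (st : A) body (C : I -> nat)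
    (Inv : seq I -> A -> Prop) n :
  Inv [::] st ->
  (forall done i rest a, s = done ++ i :: rest -> Inv done a ->
     spec (body i a) (C i) (Inv (rcons done i))) ->
  \sum_(i <- s) (C i).+1 <= n -> spec (each s st body) n (Inv s).
Proof.
move=> h0 hS le.
have gen done rest a : s = done ++ rest -> Inv done a ->
    spec (each rest a body) (\sum_(i <- rest) (C i).+1) (Inv s).
  elim: rest done a => [|i rest IH] done a es ha; first by rewrite cats0 in es; rewrite es.
  rewrite /= big_cons addSn; apply: spec_step; apply: spec_bind (leqnn _).
    exact: hS es ha.
  by move=> b hb; apply: (IH (rcons done i)); rewrite // cat_rcons.
exact: spec_weaken (gen [::] s st (erefl _) h0) _ le.
Qed.

Lemma spec_loop (I : eqType) A c (Inv : seq I -> A -> Prop) s (st : A) body n P :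
  Inv [::] st ->
  (forall done i rest a, s = done ++ i :: rest -> Inv done a ->
     spec (body i a) c (Inv (rcons done i))) ->
  c.+1 * size s <= n -> (forall a, Inv s a -> P a) -> spec (each s st body) n P.
Proof.
move=> h0 hS le hP; apply: spec_weaken (spec_each (C := fun=> c) h0 hS (leqnn _)) hP _.
by rewrite sum_const_seq.
Qed.

(** Layers are visited from the deepest one, so an induction that peels off the first layer has to
    split off the last iteration. *)
Lemma spec_each_rcons (I : eqType) A (s : seq I) i (st : A) body n1 n2 n P Q0 :
  spec (each s st body) n1 P -> (forall a, P a -> spec (body i a) n2 Q0) ->
  n1 + n2.+1 <= n -> spec (each (rcons s i) st body) n Q0.
Proof.
move=> h1 h2 le; have e : each (rcons s i) st body =
    ((bind (each s st body) (fun a => bind (body i a) (@ret _))).1,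
     (bind (each s st body) (fun a => bind (body i a) (@ret _))).2.+1).
  elim: s st {h1} => [|c s IH] st /=.
    by rewrite /bind /= !addn0 add1n.
  by rewrite /bind /= in IH *; rewrite IH /= !addn0; congr (_, _); lia.
have [h3 h4] := h1; have [h5 h6] := h2 _ h3.
rewrite e; split=> //=; apply: leq_trans le.
by rewrite addn0 addnS ltnS leq_add.
Qed.

End Specifications.

Section RunForest.
Variables (X Y : eqType) (src tgt : Y -> X) (vs : seq X) (arrs : seq Y).
Variables (V : eqType) (f : X -> V).

(** Reversed because the program pushes each arrow to the front of its list. *)
Definition arrows_into x : seq Y := rev [seq b <- arrs | tgt b == x].
Let indeg x := size (arrows_into x).

Lemma mem_arrows_into b x : (b \in arrows_into x) = (b \in arrs) && (tgt b == x).
Proof. by rewrite mem_rev mem_filter andbC. Qed.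

Lemma in_arrows_spec : spec (in_arrows tgt vs arrs) (size vs + 4 * size arrs)
  (fun t => t =1 arrows_into).
Proof.
apply: spec_alloc.
apply: (@spec_loop _ _ 3 (fun done t => t =1 fun x => rev [seq b <- done | tgt b == x])) => //.
move=> done b rest t _ ht; do 2!apply: spec_step; apply: spec_step_end => // x.
rewrite /upd filter_rcons [tgt b == x]eq_sym !ht.
by case: eqP => [->|//]; rewrite rev_rcons.
Qed.

Definition out_arrow x := has (fun b => src b == x) arrs.

Lemma list_sinks_spec : spec (list_sinks src vs arrs) (4 * size vs + 3 * size arrs)
  (fun rs => rs = rev [seq x <- vs | ~~ out_arrow x]).
Proof.
rewrite (_ : 4 * _ + _ = size vs + (3 * size arrs + 3 * size vs)); last by lia.
apply: spec_alloc.
apply: (@spec_bind _ _ _ _ (3 * size arrs) (3 * size vs) _ (fun out => out =1 out_arrow)) => //.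
  apply: (@spec_loop _ _ 2 (fun done t => t =1 fun x => has (fun b => src b == x) done)) => //.
  move=> done b rest t _ ht; apply: spec_step; apply: spec_step_end => // x.
  by rewrite /upd has_rcons ht [src b == x]eq_sym; case: eqP.
move=> out hout.
apply: (@spec_loop _ _ 2 (fun done rs => rs = rev [seq x <- done | ~~ out_arrow x])) => //.
move=> done x rest rs _ ->; apply: spec_step; apply: spec_step_end => //.
by rewrite hout filter_rcons; case: (out_arrow x) => //=; rewrite rev_rcons.
Qed.

Definition next_layer (l : seq X) : seq X := rev (flatten [seq map src (arrows_into x) | x <- l]).

Fixpoint layer_list n (l : seq X) : seq (seq X) :=
  if n is n'.+1 then
    if l is [::] then [::] else l :: layer_list n' (next_layer l)
  else [::].

Lemma layersS t n x l acc : layers src t n.+1 (x :: l) acc =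
  let* l' := each (x :: l) [::] (fun x l' =>
      let* bs := step (t x) in
      each bs l' (fun b l' => let* p := step (src b) in step (p :: l'))) in
  layers src t n l' ((x :: l) :: acc).
Proof. by []. Qed.

Lemma layers_spec t n l acc : t =1 arrows_into ->
  spec (layers src t n l acc)
    (1 + \sum_(l' <- layer_list n l) \sum_(x <- l') (2 + 3 * indeg x))
    (fun ls => ls = rev (layer_list n l) ++ acc).
Proof.
move=> ht; elim: n l acc => [|n IH] l acc; first by [].
case: l => [|x0 l0]; first by [].
rewrite layersS; set l := x0 :: l0.
rewrite (_ : layer_list n.+1 l = l :: layer_list n (next_layer l)) // big_cons.
apply: (@spec_bind _ _ _ _ (\sum_(x <- l) (2 + 3 * indeg x))
   (1 + \sum_(l' <- layer_list n (next_layer l)) \sum_(x <- l') (2 + 3 * indeg x)) _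
   (fun l' => l' = next_layer l)).
- apply: (@spec_each _ _ _ _ _ (fun x => 1 + 3 * indeg x)
    (fun done l' => l' = next_layer done)) => //.
  move=> done x rest l' _ ->; apply: spec_step; rewrite ht.
  apply: (@spec_loop _ _ 2
    (fun bs l' => l' = rev (flatten [seq map src (arrows_into x) | x <- done] ++ map src bs))) => //.
  + by rewrite cats0.
  + move=> bs b rest' l1 _ ->; apply: spec_step; apply: spec_step_end => //.
    by rewrite map_rcons -rcons_cat rev_rcons.
  by move=> l1 ->; rewrite /next_layer map_rcons flatten_rcons.
- move=> _ ->; apply: spec_weaken (IH _ _) _ (leqnn _) => ls ->.
  by rewrite rev_cons cat_rcons.
by lia.
Qed.

Hypothesis uniq_vs : uniq vs.
Hypothesis uniq_arrs : uniq arrs.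
Hypothesis src_vs : {in arrs, forall b, src b \in vs}.
Hypothesis tgt_vs : {in arrs, forall b, tgt b \in vs}.
Hypothesis src_inj : {in arrs &, injective src}.
Variable lev : X -> nat.
Hypothesis levS : {in arrs, forall b, lev (src b) = (lev (tgt b)).+1}.
Hypothesis lev0 : {in vs, forall x, out_arrow x = (0 < lev x)}.
Hypothesis lev_vs : {in vs, forall x, lev x <= size vs}.
(** On bare lists this replaces a morphism to a quiver whose arrows are determined by their
    sources. *)
Hypothesis f_tgt : {in arrs &, forall b c, f (src b) = f (src c) -> f (tgt b) = f (tgt c)}.

Definition list_pred (p x : X) : Prop := exists2 b, b \in arrs & src b = p /\ tgt b = x.
Definition sim_list : X -> X -> Prop := similar list_pred f.
Definition simb p q : bool := `[< sim_list p q >].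

Lemma simbP p q : reflect (sim_list p q) (simb p q).
Proof. exact: asboolP. Qed.

Lemma simb_refl p : simb p p.
Proof. by apply/simbP; apply: similar_refl. Qed.

Lemma simb_trans q p r : simb p q -> simb q r -> simb p r.
Proof. by move=> /simbP h1 /simbP h2; apply/simbP; apply: similar_trans h1 h2. Qed.

Lemma simb_rec x y : simb x y = (f x == f y) &&
  all (fun b => has (fun c => simb (src b) (src c)) (arrows_into y)) (arrows_into x).
Proof.
apply/simbP/andP=> [s|[/eqP e /allP h]].
  split; first by rewrite (similar_label s).
  apply/allP=> b; rewrite mem_arrows_into => /andP[bA /eqP eb].
  have [|q [c cA [<- ec]] sbc] := similar_pred s (p := src b); first by exists b.
  by apply/hasP; exists c; [rewrite mem_arrows_into cA ec eqxx|apply/simbP].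
apply: similarI => // p [b bA [<- eb]].
have /h/hasP[c] : b \in arrows_into x by rewrite mem_arrows_into bA eb eqxx.
by rewrite mem_arrows_into => /andP[cA /eqP ec] /simbP s; exists (src c) => //; exists c.
Qed.

Lemma uniq_arrows_into x : uniq (arrows_into x).
Proof. by rewrite rev_uniq filter_uniq. Qed.

Lemma related_spec key (R : X * X -> bool) p q A (g : bool -> timed A) n Q :
  spec (g (R (key p, key q))) n Q -> spec (bind (related key R p q) g) n.+3 Q.
Proof. by case=> h1 h2; split. Qed.

Section AtVertex.
Variables (key : X -> X) (R : X * X -> bool) (x : X).
Hypothesis table_ok : {in arrows_into x &, forall b c,
  R (key (src b), key (src c)) = simb (src b) (src c)}.

Definition compete_inv (done : seq Y) (AD : seq Y * seq Y) : Prop :=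
  [/\ perm_eq (AD.1 ++ AD.2) done,
      {in AD.1 &, forall a c, simb (src a) (src c) -> a = c}
    & {in done, forall b, exists2 a, a \in AD.1 & simb (src b) (src a)}].

(** If [b] is not dominated, the candidates that it dominates move to the second list, and what they
    dominated is dominated by [b] by transitivity. Each of the two scans runs over at most [indeg x]
    candidates, with 5 steps for each. *)
Lemma compete_spec done b rest AD : arrows_into x = done ++ b :: rest ->
  compete_inv done AD ->
  spec (compete src key R b AD) (10 * indeg x + 3) (compete_inv (rcons done b)).
Proof.
move=> earr [pAD iAD cAD].
have sz : size AD.1 <= indeg x.
  rewrite /indeg earr size_cat -(perm_size pAD) size_cat /=; lia.
have sub a : a \in AD.1 -> a \in arrows_into x.
  move=> ha; rewrite earr mem_cat -(perm_mem pAD) mem_cat ha //.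
have bx : b \in arrows_into x by rewrite earr mem_cat inE eqxx orbT.
rewrite addnC; apply: spec_step.
apply: (@spec_bind _ _ _ _ (5 * indeg x) (2 + 5 * indeg x) _
  (fun r => r = has (fun a => simb (src b) (src a)) AD.1)); last by lia.
  apply: (@spec_loop _ _ 4
    (fun dn r => r = has (fun a => simb (src b) (src a)) dn)); rewrite ?leq_mul2l ?sz //.
  move=> dn a rst r eAD ->; apply: related_spec; apply: spec_step_end => //.
  by rewrite has_rcons orbC table_ok // sub // eAD mem_cat inE eqxx orbT.
move=> _ ->; case: hasP => [[a aAD sba]|nodom].
  apply: spec_step_end => //; split=> //=.
      apply/permP=> p; have /permP/(_ p) := pAD.
    by rewrite -cats1 !count_cat /=; lia.
  move=> c; rewrite mem_rcons inE => /orP[/eqP->|/cAD//].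
  by exists a.
apply: (spec_weaken (n := 5 * indeg x) (P := fun AD' : seq Y * seq Y =>
  AD'.1 = rev [seq a <- AD.1 | ~~ simb (src a) (src b)] ++ [:: b] /\
  AD'.2 = rev [seq a <- AD.1 | simb (src a) (src b)] ++ AD.2)); last by lia.
  apply: (@spec_loop _ _ 4 (fun dn (AD' : seq Y * seq Y) =>
      AD'.1 = rev [seq a <- dn | ~~ simb (src a) (src b)] ++ [:: b] /\
      AD'.2 = rev [seq a <- dn | simb (src a) (src b)] ++ AD.2)); rewrite ?leq_mul2l ?sz //.
  move=> dn a rst AD' eAD [e1 e2]; apply: related_spec; apply: spec_step_end => //.
  rewrite table_ok //; last by rewrite sub // eAD mem_cat inE eqxx orbT.
  by rewrite !filter_rcons; case: simb => /=; rewrite e1 e2 rev_rcons.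
move=> [AD1 AD2] /= [-> ->]; split=> /=.
- apply/permP=> p; have /permP/(_ p) := pAD.
  have : count p [seq a <- AD.1 | simb (src a) (src b)] +
         count p [seq a <- AD.1 | ~~ simb (src a) (src b)] = count p AD.1.
    by rewrite -count_cat; apply/permP/permEl/perm_filterC.
  by rewrite -cats1 !count_cat !count_rev /=; lia.
- move=> a c; rewrite !mem_cat !mem_rev !mem_filter !inE.
  case/orP=> [/andP[nab aA]|/eqP->]; case/orP=> [/andP[ncb cA]|/eqP->] // s.
  + by apply: iAD => //; apply/simbP.
  + by case/negP: nab; apply/simbP.
  + by case: nodom; exists c => //; apply/simbP.
move=> c; rewrite mem_rcons inE => /orP[/eqP->|/cAD[a aA sca]].
  by exists b; rewrite ?simb_refl // mem_cat inE eqxx orbT.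
have [sab|nsab] := boolP (simb (src a) (src b)).
  by exists b; [rewrite mem_cat inE eqxx orbT|apply: simb_trans sca sab].
by exists a; rewrite // mem_cat mem_rev mem_filter nsab aA.
Qed.

Definition pruned_at (K : Y -> bool) : Prop :=
  {in arrows_into x, forall b, exists2 c, c \in arrows_into x & K c /\ simb (src b) (src c)}
  /\ {in arrows_into x &, forall b c, K b -> K c -> simb (src b) (src c) -> b = c}.

Lemma prune_spec t (K : Y -> bool) : t =1 arrows_into -> {in arrows_into x, forall b, K b} ->
  spec (prune src t key R x K) (16 * indeg x ^ 2 + 1)
    (fun K' => (forall b, b \notin arrows_into x -> K' b = K b) /\ pruned_at K').
Proof.
move=> ht hK; rewrite addn1; apply: spec_step; rewrite ht.
apply: (@spec_bind _ _ _ _ (indeg x * (10 * indeg x + 4)) (2 * indeg x) _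
   (compete_inv (arrows_into x))).
- apply: (@spec_each _ _ _ _ _ (fun=> 10 * indeg x + 3) compete_inv); first by split.
    by move=> done b rest AD earr; apply: compete_spec earr.
  by rewrite sum_const_seq mulnC -addnS.
- move=> AD [pAD iAD cAD].
  apply: (@spec_loop _ _ 1 (fun dn K' => K' =1 fun b => K b && (b \notin dn))).
  + by move=> b; rewrite andbT.
  + move=> dn b rst K' _ hK'; apply: spec_step_end => // c.
    rewrite /upd mem_rcons inE hK'; case: eqP => [->|//]; by rewrite andbF.
  + by rewrite leq_mul2l /indeg -(perm_size pAD) size_cat leq_addl.
  move=> K' hK'.
  have uAD : uniq (AD.1 ++ AD.2) by rewrite (perm_uniq pAD) uniq_arrows_into.
  have K1 b : b \in arrows_into x -> K' b = (b \in AD.1).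
    move=> bx; rewrite hK' hK //=; move: bx uAD; rewrite -(perm_mem pAD) mem_cat cat_uniq.
    case/orP=> h /and3P[_ /hasPn nh _]; last by rewrite h (negbTE (nh _ h)).
    by rewrite h; apply/negP=> /nh; rewrite h.
  have in1 a : a \in AD.1 -> a \in arrows_into x by rewrite -(perm_mem pAD) mem_cat => ->.
  split=> [b nb|].
    rewrite hK'; case: (boolP (b \in AD.2)) => [h|_]; last by rewrite andbT.
    by rewrite -(perm_mem pAD) mem_cat h orbT in nb.
  split=> [b /cAD[a aA s]|b c bx cx].
    by exists a; [exact: in1|rewrite K1 // in1].
  by rewrite !K1 //; apply: iAD.
by rewrite expnS expn1; nia.
Qed.

End AtVertex.

Lemma compare_spec t key (R : X * X -> bool) x y : t =1 arrows_into ->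
  (forall b c, b \in arrows_into x -> c \in arrows_into y ->
     R (key (src b), key (src c)) = simb (src b) (src c)) ->
  spec (compare src f t key x y R) (6 * ((1 + indeg x) * (1 + indeg y)))
    (fun R' => R' = upd R (key x, key y) (simb x y)).
Proof.
move=> ht hR; apply: (spec_weaken (n := 6 + indeg x * (2 + 5 * indeg y))
  (P := fun R' => R' = upd R (key x, key y) (simb x y))) => //; last by nia.
rewrite 3!addSn; do 3!apply: spec_step; rewrite !ht.
apply: (@spec_bind _ _ _ _ (indeg x * (2 + 5 * indeg y)) 3 _ (fun r => r = simb x y)).
- rewrite simb_rec.
  apply: (@spec_each _ _ _ _ _ (fun=> 1 + 5 * indeg y) (fun dn r => r = (f x == f y) &&
    all (fun b => has (fun c => simb (src b) (src c)) (arrows_into y)) dn)).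
  + by rewrite andbT.
  + move=> dn b rst r ex ->.
    apply: (@spec_bind _ _ _ _ (5 * indeg y) 1 _
      (fun r => r = has (fun c => simb (src b) (src c)) (arrows_into y))); last by rewrite addnC.
      apply: (@spec_loop _ _ 4
        (fun dn r => r = has (fun c => simb (src b) (src c)) dn)) => //.
      move=> dc c rc r' ey ->; apply: related_spec; apply: spec_step_end => //.
      rewrite has_rcons orbC hR //; first by rewrite ex mem_cat inE eqxx orbT.
      by rewrite ey mem_cat inE eqxx orbT.
    by move=> _ ->; apply: spec_step_end => //; rewrite all_rcons -andbA [has _ _ && _]andbC.
  by rewrite sum_const_seq mulnC -addSn.
- by move=> _ ->; do 2!apply: spec_step; apply: spec_step_end.
by lia.
Qed.

Lemma mem_next_layer l p :
  p \in next_layer l <-> exists2 x, x \in l & exists2 b, b \in arrows_into x & src b = p.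
Proof.
rewrite mem_rev; split=> [/flattenP[_ /mapP[x xl ->] /mapP[b bx ->]]|[x xl [b bx <-]]].
  by exists x => //; exists b.
by apply/flattenP; exists (map src (arrows_into x)); apply: map_f.
Qed.

Definition at_level j (l : seq X) : Prop :=
  [/\ uniq l, {subset l <= vs} & {in l, forall x, lev x = j}].

Lemma lev_src b x : b \in arrows_into x -> lev (src b) = (lev x).+1.
Proof. by rewrite mem_arrows_into => /andP[/levS-> /eqP->]. Qed.

Lemma next_layer_at_level j l : at_level j l -> at_level j.+1 (next_layer l).
Proof.
case=> ul sl ll; split.
- rewrite rev_uniq; elim: l ul {sl ll} => //= x l IH /andP[xl ul].
  rewrite cat_uniq IH // andbT; apply/andP; split.
    rewrite map_inj_in_uniq ?uniq_arrows_into // => b c.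
    by rewrite !mem_arrows_into => /andP[bA _] /andP[cA _]; apply: src_inj.
  apply/hasPn=> p /flattenP[_ /mapP[y yl ->] /mapP[b by' ->]].
  apply/mapP=> -[c cx e]; move: by' cx; rewrite !mem_arrows_into.
  move=> /andP[bA /eqP eb] /andP[cA /eqP ec]; case/negP: xl.
  by rewrite -ec -(src_inj bA cA e) eb.
- move=> p /mem_next_layer[x _ [b + <-]]; rewrite mem_arrows_into => /andP[+ _].
  exact: src_vs.
by move=> p /mem_next_layer[x xl [b bx <-]]; rewrite (lev_src bx) ll.
Qed.

(** By [f_tgt] the predecessors already settle the comparison of labels, so the vertices can share a
    table entry with them. *)
Lemma simb_single x y b c : arrows_into x = [:: b] -> arrows_into y = [:: c] ->
  simb x y = simb (src b) (src c).
Proof.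
move=> ex ey; rewrite simb_rec ex ey /= orbF andbT.
have [s|] := boolP (simb (src b) (src c)); last by rewrite andbF.
have : b \in arrows_into x by rewrite ex inE.
have : c \in arrows_into y by rewrite ey inE.
rewrite !mem_arrows_into => /andP[cA /eqP<-] /andP[bA /eqP<-].
by rewrite andbT; apply/eqP/f_tgt => //; exact: similar_label (elimT (simbP _ _) s).
Qed.

Definition new_key (key : X -> X) (l : seq X) (x : X) : X :=
  if x \in l then if arrows_into x is [:: b] then key (src b) else x else key x.

Lemma set_keys_spec t key l j : t =1 arrows_into -> at_level j l ->
  spec (each l (key, [::]) (set_key src t)) (5 * size l)
    (fun kN => kN.1 =1 new_key key l /\ kN.2 = rev [seq x <- l | indeg x != 1]).
Proof.
move=> ht [ul sl ll].
apply: (@spec_each _ _ _ _ _ (fun=> 4) (fun dn kN =>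
  kN.1 =1 new_key key dn /\ kN.2 = rev [seq x <- dn | indeg x != 1])).
- by split.
- move=> dn x rst [k N] el [/= hk hN]; apply: spec_step; rewrite ht filter_rcons /indeg.
  case ex : (arrows_into x) => [|b [|c bs]] /=.
  + apply: spec_step_end => //=; split; last by rewrite hN rev_rcons.
    move=> z; rewrite /upd /new_key mem_rcons inE; case: eqP => [->|_] /=; first by rewrite ex.
    exact: hk.
  + apply: spec_step; apply: spec_step => /=; apply: spec_step_end => //; split=> //= z.
    rewrite /upd /new_key mem_rcons inE; case: eqP => [->|_] /=; last exact: hk.
    (* The predecessor lies one level deeper, so its key has not been changed in this loop. *)
    rewrite ex hk /new_key ifN //; apply/negP=> pd.
    have xl : x \in l by rewrite el mem_cat inE eqxx orbT.
    have pl : src b \in l by rewrite el mem_cat pd.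
    have := lev_src (b := b) (x := x); rewrite ex inE eqxx => /(_ isT).
    by rewrite (ll _ pl) (ll _ xl) => /n_Sn.
  + apply: spec_step_end => //=; split; last by rewrite hN rev_rcons.
    move=> z; rewrite /upd /new_key mem_rcons inE; case: eqP => [->|_] /=; first by rewrite ex.
    exact: hk.
by rewrite sum_const_seq.
Qed.

(** The middle condition protects the table: the keys in use have level at least [j], so rows and
    columns opened later, at smaller levels, are not among theirs. *)
Definition table_inv j (l : seq X) (key : X -> X) (R : X * X -> bool) : Prop :=
  [/\ {in l &, injective key}, {in l, forall p, j <= lev (key p)}
    & {in l &, forall p q, R (key p, key q) = simb p q}].

(** [D] collects the vertices treated so far, including those of earlier trees. *)
Definition kept_inv (D : seq X) (K : Y -> bool) : Prop :=
  {in D, forall x, pruned_at x K} /\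
  forall x, x \notin D -> {in arrows_into x, forall b, K b}.

Lemma prune_layer_spec t key R l D K : t =1 arrows_into -> uniq l ->
  {in l, forall x, x \notin D} ->
  {in next_layer l &, forall p q, R (key p, key q) = simb p q} ->
  kept_inv D K ->
  spec (each l K (prune src t key R)) (\sum_(x <- l) (16 * indeg x ^ 2 + 2))
    (kept_inv (l ++ D)).
Proof.
move=> ht ul lD hR K0.
apply: (@spec_each _ _ _ _ _ (fun x => 16 * indeg x ^ 2 + 1) (fun dn => kept_inv (dn ++ D))) => //.
  move=> dn x rst {K0}K el [hK1 hK2].
  have xD : x \notin dn ++ D.
    rewrite mem_cat negb_or lD ?el ?mem_cat ?inE ?eqxx ?orbT // andbT.
    by move: ul; rewrite el cat_uniq /= => /and3P[_ /norP[]].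
  have xl : x \in l by rewrite el mem_cat inE eqxx orbT.
  apply: spec_weaken (prune_spec _ ht (hK2 _ xD)) _ (leqnn _).
    by move=> b c bx cx; apply: hR; apply/mem_next_layer; exists x => //; [exists b|exists c].
  move=> K' [eK pK]; have eK' z b : z != x -> b \in arrows_into z -> K' b = K b.
    move=> zx bz; apply: eK; apply: contra zx => bx; move: bz bx.
    by rewrite !mem_arrows_into => /andP[_ /eqP<-] /andP[_].
  split=> [z|z]; rewrite cat_rcons mem_cat inE orbCA -mem_cat.
    have [->//|zx /=] := eqVneq z x => /hK1[h1 h2]; split.
      by move=> b bz; have [c cz [Kc s]] := h1 b bz; exists c; rewrite // (eK' z).
    by move=> b c bz cz; rewrite !(eK' z) //; apply: h2.
  by rewrite negb_or => /andP[zx /hK2 h] b bz; rewrite (eK' z) // h.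
by rewrite big_seq [in leqRHS]big_seq; apply: leq_sum => x _; rewrite addn2 addn1.
Qed.

(** Only pairs that involve a vertex without exactly one predecessor are compared. Such a pair
    writes to an entry with a key of level [j], whereas all entries read have keys of larger level,
    so no write disturbs a later read. As [W] bounds the weight of the layer, comparing [x] with all
    of it costs of the order of [(1 + indeg x) * W]. *)
Lemma pass_spec t l j D W K key R : t =1 arrows_into -> at_level j l ->
  \sum_(y <- l) (1 + indeg y) <= W ->
  {in l, forall x, x \notin D} ->
  table_inv j.+1 (next_layer l) key R -> kept_inv D K ->
  spec (pass src f t l (K, key, R))
    (\sum_(x <- l) (16 * indeg x ^ 2 + 7) +
     \sum_(x <- l | indeg x != 1) 14 * ((1 + indeg x) * W.+1))
    (fun st => kept_inv (l ++ D) st.1.1 /\ table_inv j l st.1.2 st.2).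
Proof.
move=> ht al hW lD [injk levk hR] K0; have [ul sl ll] := al.
have aln := next_layer_at_level al; have [_ _ lln] := aln.
apply: (@spec_bind _ _ _ _ _ (5 * size l +
  \sum_(x <- l | indeg x != 1) 14 * ((1 + indeg x) * W.+1)) _ (kept_inv (l ++ D))).
- exact: prune_layer_spec.
- move=> K' hK'.
  apply: spec_bind (set_keys_spec key ht al) _ (leqnn _) => -[k N0] [/= hk ->].
  have kl x : x \in l -> k x = if arrows_into x is [:: b] then key (src b) else x.
    by move=> xl; rewrite hk /new_key xl.
  have kn p : p \in next_layer l -> k p = key p.
    move=> pn; rewrite hk /new_key ifN //; apply/negP=> /ll e.
    by have := lln _ pn; rewrite e => /n_Sn.
  have kN x : x \in l -> indeg x != 1 -> k x = x.
    by move=> xl; rewrite kl // /indeg; case: (arrows_into x) => [|b []].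
  have srcn x b : x \in l -> b \in arrows_into x -> src b \in next_layer l.
    by move=> xl bx; apply/mem_next_layer; exists x => //; exists b.
  have k1 x : x \in l -> indeg x = 1 -> exists2 b, arrows_into x = [:: b] &
      k x = key (src b) /\ src b \in next_layer l.
    move=> xl; rewrite kl // /indeg; case ex : (arrows_into x) => [|b []] // _.
    by exists b => //; split=> //; apply: (srcn x); rewrite // ex inE.
  have levk1 x : x \in l -> indeg x = 1 -> j < lev (k x).
    by move=> xl /(k1 _ xl)[b _ [-> bn]]; apply: levk.
  have kinj : {in l &, injective k}.
    move=> x y xl yl e.
    have [dx|dx] := eqVneq (indeg x) 1; have [dy|dy] := eqVneq (indeg y) 1.
    + move: e; have [b bx [-> bn]] := k1 _ xl dx; have [c cy [-> cn]] := k1 _ yl dy.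
      move=> /(injk _ _ bn cn) e.
      have : b \in arrows_into x by rewrite bx inE.
      have : c \in arrows_into y by rewrite cy inE.
      rewrite !mem_arrows_into => /andP[cA /eqP<-] /andP[bA /eqP<-].
      by rewrite (src_inj bA cA e).
    + by have := levk1 _ xl dx; rewrite e kN // ll // ltnn.
    + by have := levk1 _ yl dy; rewrite -e kN // ll // ltnn.
    by move: e; rewrite !kN.
  pose good (R : X * X -> bool) x y := R (k x, k y) = simb x y.
  pose reads (R : X * X -> bool) := {in next_layer l &, forall p q, R (key p, key q) = simb p q}.
  have upd_good R' x y : x \in l -> y \in l -> let R'' := upd R' (k x, k y) (simb x y) in
      good R'' x y /\ {in l &, forall a b, good R' a b -> good R'' a b}.
    move=> xl yl R''; split; first by rewrite /good /R'' /upd eqxx.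
    move=> a b al' bl; rewrite /good /R'' /upd.
    by case: eqP => // -[/(kinj _ _ al' xl)-> /(kinj _ _ bl yl)->].
  have upd_reads R' x y : x \in l -> y \in l -> (indeg x != 1) || (indeg y != 1) ->
      reads R' -> reads (upd R' (k x, k y) (simb x y)).
    move=> xl yl d hR' p q pn qn; rewrite /upd; case: eqP => [[e1 e2]|_]; last exact: hR'.
    case/orP: d => d.
      by have := levk _ pn; rewrite e1 kN // ll // ltnn.
    by have := levk _ qn; rewrite e2 kN // ll // ltnn.
  have cmp R' x y : x \in l -> y \in l -> reads R' ->
      spec (compare src f t k x y R') (6 * ((1 + indeg x) * (1 + indeg y)))
        (fun R'' => R'' = upd R' (k x, k y) (simb x y)).
    move=> xl yl hR'; apply: compare_spec => // b c bx cy.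
    have bn := srcn _ _ xl bx; have cn := srcn _ _ yl cy.
    by rewrite !kn // hR'.
  pose N := rev [seq x <- l | indeg x != 1].
  have memN x : x \in N = (indeg x != 1) && (x \in l) by rewrite mem_rev mem_filter.
  apply: (@spec_bind _ _ _ _ (\sum_(x <- l | indeg x != 1) 14 * ((1 + indeg x) * W.+1)) 0 _
    (fun R' => reads R' /\ {in N & l, forall x y, good R' x y /\ good R' y x})); last by rewrite addn0.
    apply: (@spec_each _ _ _ _ _ (fun x => 13 * ((1 + indeg x) * W))
      (fun dn R' => reads R' /\ {in dn & l, forall x y, good R' x y /\ good R' y x})).
    + by split.
    + move=> dn x rst R' eN [hR' gR'].
      have xN : x \in N by rewrite /N eN mem_cat inE eqxx orbT.
      have dnl z : z \in dn -> z \in l.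
        by move=> zd; have : z \in N by [rewrite /N eN mem_cat zd]; rewrite memN => /andP[].
      have /andP[dx xl] := etrans (esym (memN x)) xN.
      apply: (@spec_weaken _ _ _ _ (fun R' => [/\ reads R',
           {in dn & l, forall x y, good R' x y /\ good R' y x} &
           {in l, forall y, good R' x y /\ good R' y x}])); last exact: leqnn.
        (* Two comparisons with factor 6, one for either order of the pair. *)
        apply: (@spec_each _ _ _ _ _ (fun y => 12 * ((1 + indeg x) * (1 + indeg y)))
          (fun dn' R' => [/\ reads R',
           {in dn & l, forall x y, good R' x y /\ good R' y x} &
           {in dn', forall y, good R' x y /\ good R' y x}])).
        * by split.
        * move=> dn' y rst' R1 el [r1 g1 g1'].
          have yl : y \in l by rewrite el mem_cat inE eqxx orbT.
          have dnl' z : z \in dn' -> z \in l by move=> zd; rewrite el mem_cat zd.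
          apply: spec_bind (cmp _ _ _ xl yl r1) _ _ => [_ ->|].
            have [u1 u2] := upd_good R1 _ _ xl yl.
            have r2 := upd_reads R1 _ _ xl yl (introT orP (or_introl dx)) r1.
            apply: spec_weaken (cmp _ _ _ yl xl r2) _ (leqnn _) => _ ->.
            have [v1 v2] := upd_good (upd R1 (k x, k y) (simb x y)) _ _ yl xl.
            split.
            + by apply: upd_reads => //; rewrite dx orbT.
            + move=> a b ad bl; have [h1 h2] := g1 a b ad bl.
              by split; apply: v2 => //; try exact: dnl; apply: u2 => //; exact: dnl.
            move=> z; rewrite mem_rcons inE => /orP[/eqP->|zd].
              by split=> //; apply: v2.
            have [h1 h2] := g1' z zd; have zl := dnl' _ zd.
            by split; apply: v2 => //; apply: u2.
          by rewrite [(1 + indeg y) * _]mulnC; lia.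
        apply: leq_trans (_ : \sum_(y <- l) 13 * ((1 + indeg x) * (1 + indeg y)) <= _).
          by apply: leq_sum => y _; nia.
        by rewrite -!big_distrr /= !leq_mul2l hW !orbT.
      move=> R2 [r2 g2 g2']; split=> // z y; rewrite mem_rcons inE => /orP[/eqP->|zd] yl.
        exact: g2'.
      exact: g2.
    rewrite (perm_big _ (permEl (perm_rev _))) big_filter.
    by apply: leq_sum => x _; nia.
  move=> R' [hR' gN]; apply: spec_ret => /=; split=> //; split=> //.
    move=> x xl; have [dx|dx] := eqVneq (indeg x) 1; first exact/ltnW/levk1.
    by rewrite kN // ll.
  move=> x y xl yl.
  have [dx|dx] := eqVneq (indeg x) 1; last by have [] := gN x y; rewrite ?memN ?dx.
  have [dy|dy] := eqVneq (indeg y) 1; last by have [] := gN y x; rewrite ?memN ?dy.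
  have [b bx [-> bn]] := k1 _ xl dx; have [c cy [-> cn]] := k1 _ yl dy.
  by rewrite (simb_single bx cy) hR'.
rewrite addnA leq_add2r -sum1_size big_distrr /= -big_split /=.
by apply: leq_sum => x _; lia.
Qed.

Lemma layer_list_nil n : layer_list n [::] = [::].
Proof. by case: n. Qed.

Lemma layer_list_lev n j l : at_level j l ->
  {in flatten (layer_list n l), forall x, j <= lev x}.
Proof.
elim: n j l => [//|n IH] j l al x; case: l al => [//|y l] al /=.
rewrite -cat_cons mem_cat => /orP[xl|]; first by case: al => _ _ ->.
by move/(IH _ _ (next_layer_at_level al))/ltnW.
Qed.

Variable W : nat.
Hypothesis layer_weight : forall j, \sum_(y <- vs | lev y == j) (1 + indeg y) <= W.

Lemma at_level_weight j l : at_level j l -> \sum_(y <- l) (1 + indeg y) <= W.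
Proof.
case=> ul sl ll; apply: leq_trans (layer_weight j); rewrite -[leqRHS]big_filter.
apply: (@uniq_sub_le_big _ addn leq leqnn (fun x y => leq_addr y x)) => //.
  by rewrite filter_uniq.
by move=> y yl; rewrite mem_filter sl // ll // eqxx.
Qed.

(** The induction runs all deeper layers and then makes one more pass. The bound [size vs < n + j]
    says that the fuel lasts, as no level exceeds [size vs]. *)
Lemma run_layers_spec t n l j D K : t =1 arrows_into -> at_level j l ->
  size vs < n + j -> {in flatten (layer_list n l), forall x, x \notin D} ->
  kept_inv D K ->
  spec (each (rev (layer_list n l)) (K, id, fun=> false) (pass src f t))
    (\sum_(l' <- layer_list n l) (\sum_(x <- l') (16 * indeg x ^ 2 + 8) +
       \sum_(x <- l' | indeg x != 1) 14 * ((1 + indeg x) * W.+1)))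
    (fun st => kept_inv (flatten (layer_list n l) ++ D) st.1.1 /\ table_inv j l st.1.2 st.2).
Proof.
move=> ht; elim: n l j => [|n IH] l j al ltn lD hK.
  case: l al lD => [|x l] [_ sl ll] lD; first by apply: spec_ret.
  have xl : x \in x :: l by rewrite inE eqxx.
  by have := lev_vs (sl _ xl); rewrite (ll _ xl); lia.
case: l al lD => [|x0 l0] al lD; first by apply: spec_ret.
move: al lD; set l := x0 :: l0 => al.
rewrite (_ : layer_list n.+1 l = l :: layer_list n (next_layer l)) // rev_cons big_cons => lD.
have aln := next_layer_at_level al.
apply: spec_each_rcons.
- apply: IH aln _ _ hK; first by rewrite addnS -addSn.
  by move=> x /flattenP[l1 hl1 xl1]; apply: lD; apply/flattenP; exists l1; rewrite // inE hl1 orbT.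
- move=> [[K' key] R] [/= hK' tK'].
  have lD' : {in l, forall x, x \notin flatten (layer_list n (next_layer l)) ++ D}.
    move=> x xl; rewrite mem_cat negb_or (lD x) ?andbT; last first.
      by apply/flattenP; exists l; rewrite ?inE ?eqxx.
    apply/negP=> /(layer_list_lev aln); have [_ _ ll] := al.
    by rewrite ll // ltnn.
  apply: spec_weaken (pass_spec ht al (at_level_weight al) lD' tK' hK') _ (leqnn _).
  by move=> st; rewrite catA.
(* The iteration over the layers is charged too; a layer is nonempty, so raising 7 to 8 pays for
   it. *)
have le8 : (\sum_(x <- l) (16 * indeg x ^ 2 + 7)).+1 <= \sum_(x <- l) (16 * indeg x ^ 2 + 8).
  rewrite /l !big_cons -addSn leq_add //; first by lia.
  by apply: leq_sum => x _; lia.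
by move: le8; lia.
Qed.

(** The square pays for the greedy selection, the linear term for collecting the layers, the last
    summand for the comparisons. *)
Definition vertex_cost x : nat := 16 * indeg x ^ 2 + 3 * indeg x + 12 +
  (indeg x != 1) * (14 * ((1 + indeg x) * W.+1)).

Lemma run_tree_spec t r K D : t =1 arrows_into -> r \in vs -> lev r = 0 ->
  {in flatten (layer_list (size vs).+1 [:: r]), forall x, x \notin D} ->
  kept_inv D K ->
  spec (run_tree src vs f t r K)
    (1 + \sum_(x <- flatten (layer_list (size vs).+1 [:: r])) vertex_cost x)
    (kept_inv (flatten (layer_list (size vs).+1 [:: r]) ++ D)).
Proof.
move=> ht rv lr lD hK; set n := (size vs).+1.
have al : at_level 0 [:: r] by split=> // x; rewrite inE => /eqP->.
apply: spec_bind (layers_spec n [:: r] [::] ht) _ _ => [_ ->|].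
  rewrite cats0; apply: spec_bind (run_layers_spec ht al _ lD hK) _ (leqnn _).
    by rewrite addn0.
  by move=> st [h _]; apply: (@spec_ret _ _ 0).
rewrite addn0 -addnA leq_add2l big_flatten /= -big_split /=; apply: leq_sum => l' _.
rewrite addnA [X in _ + X]big_mkcond -!big_split /=.
apply: leq_sum => x _; rewrite /vertex_cost; case: eqP => _ /=; lia.
Qed.

Lemma next_layer_perm l1 l2 : perm_eq l1 l2 -> perm_eq (next_layer l1) (next_layer l2).
Proof.
move=> p; rewrite /next_layer !perm_rev perm_sym perm_rev perm_sym.
exact/perm_flatten/perm_map.
Qed.

Lemma next_layer_cat l1 l2 :
  perm_eq (next_layer (l1 ++ l2)) (next_layer l1 ++ next_layer l2).
Proof. by rewrite /next_layer map_cat flatten_cat rev_cat perm_catC. Qed.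

Lemma layer_list_perm n l1 l2 : perm_eq l1 l2 ->
  perm_eq (flatten (layer_list n l1)) (flatten (layer_list n l2)).
Proof.
elim: n l1 l2 => [//|n IH] l1 l2 p.
have e l : flatten (layer_list n.+1 l) = l ++ flatten (layer_list n (next_layer l)).
  by case: l => //=; rewrite layer_list_nil.
by rewrite !e; apply: perm_cat => //; apply/IH/next_layer_perm.
Qed.

Lemma flatten_layer_listS n l :
  flatten (layer_list n.+1 l) = l ++ flatten (layer_list n (next_layer l)).
Proof. by case: l => //=; rewrite layer_list_nil. Qed.

Lemma layer_list_cat n l1 l2 :
  perm_eq (flatten (layer_list n (l1 ++ l2)))
          (flatten (layer_list n l1) ++ flatten (layer_list n l2)).
Proof.
elim: n l1 l2 => [//|n IH] l1 l2; rewrite !flatten_layer_listS.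
apply: (perm_trans (y := l1 ++ l2 ++ (flatten (layer_list n (next_layer l1)) ++
    flatten (layer_list n (next_layer l2))))).
  rewrite -catA !perm_cat2l; apply: perm_trans (IH _ _).
  exact/layer_list_perm/next_layer_cat.
by rewrite -catA perm_cat2l perm_catCA.
Qed.

(** Every vertex of positive level has an outgoing arrow, so the layer after the complete level [j]
    is the complete level [j.+1]. *)
Lemma layer_list_all n j l : perm_eq l [seq x <- vs | lev x == j] ->
  perm_eq (flatten (layer_list n l)) [seq x <- vs | j <= lev x < j + n].
Proof.
elim: n j l => [|n IH] j l pl.
  rewrite addn0 (eq_filter (a2 := pred0)) ?filter_pred0 // => x /=.
  by apply/andP=> -[h1 h2]; lia.
rewrite flatten_layer_listS.
have al : at_level j l.
  split; first by rewrite (perm_uniq pl) filter_uniq.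
    by move=> x; rewrite (perm_mem pl) mem_filter => /andP[].
  by move=> x; rewrite (perm_mem pl) mem_filter => /andP[/eqP].
have [un sn ln] := next_layer_at_level al.
have pn : perm_eq (next_layer l) [seq x <- vs | lev x == j.+1].
  apply: uniq_perm => //; first by rewrite filter_uniq.
  move=> x; rewrite mem_filter; apply/idP/andP=> [xn|[/eqP lx xv]].
    by rewrite ln ?sn.
  have /hasP[b bA /eqP eb] : out_arrow x by rewrite lev0 // lx.
  apply/mem_next_layer; exists (tgt b).
    rewrite (perm_mem pl) mem_filter tgt_vs // andbT.
    by have := levS bA; rewrite eb lx => -[->].
  by exists b; rewrite // mem_arrows_into bA eqxx.
apply: (perm_trans (y := [seq x <- vs | lev x == j] ++ [seq x <- vs | j < lev x < j.+1 + n])).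
  by apply: perm_cat => //; apply: IH.
apply/permP=> p; rewrite count_cat !count_filter -count_predUI.
rewrite [X in _ + X](eq_count (a2 := pred0)); last first.
  by move=> x /=; case: eqP => [->|_]; rewrite ?ltnn /= ?andbF.
rewrite count_pred0 addn0; apply: eq_count => x /=; case: (p x) => //=.
by rewrite addSnnS; case: ltngtP => //= <-; rewrite addnS ltnS leq_addr.
Qed.

Definition pruned_list (kept : seq Y) : Prop :=
  [/\ uniq kept, {subset kept <= arrs},
      {in arrs, forall b, exists2 c, c \in kept &
         tgt c = tgt b /\ sim_list (src b) (src c)}
    & {in kept &, forall b c, tgt b = tgt c -> sim_list (src b) (src c) -> b = c}].

Lemma run_forest_spec :
  spec (run_forest src tgt vs arrs f)
    (5 * size vs + 12 * size arrs + \sum_(x <- vs) (vertex_cost x + 2)) pruned_list.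
Proof.
rewrite /run_forest.
apply: (@spec_bind _ _ _ _ _ (4 * size vs + 8 * size arrs + \sum_(x <- vs) (vertex_cost x + 2))
   _ _ _ in_arrows_spec) => [t ht|]; last by lia.
apply: (@spec_bind _ _ _ _ _ (5 * size arrs + \sum_(x <- vs) (vertex_cost x + 2))
   _ _ _ list_sinks_spec) => [rs ers|]; last by lia.
apply: (spec_weaken (n := size arrs + (4 * size arrs + \sum_(x <- vs) (vertex_cost x + 2)))
  (P := pruned_list)) => //; last by lia.
apply: spec_alloc.
pose all_layers l := flatten (layer_list (size vs).+1 l).
have prs : perm_eq (all_layers rs) vs.
  have p0 : perm_eq rs [seq x <- vs | lev x == 0].
    rewrite ers perm_rev (eq_in_filter (a2 := fun x => lev x == 0)) // => x xv.
    by rewrite lev0 // lt0n negbK.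
  apply: perm_trans (layer_list_all _ p0) _.
  by rewrite (eq_in_filter (a2 := predT)) ?filter_predT // => x /lev_vs; rewrite add0n ltnS.
have rsv r : r \in rs -> r \in vs /\ lev r = 0.
  rewrite ers mem_rev mem_filter => /andP[+ rv]; rewrite lev0 // -leqNgt leqn0.
  by move/eqP.
have cat_layers done rest : rs = done ++ rest ->
    perm_eq vs (all_layers done ++ all_layers rest).
  by move=> e; rewrite perm_sym -(permPr prs) e perm_sym layer_list_cat.
have cat1 l r : perm_eq (all_layers (rcons l r)) (all_layers [:: r] ++ all_layers l).
  by rewrite -cats1; apply: perm_trans (layer_list_cat _ _ _) _; rewrite perm_catC.
apply: (@spec_bind _ _ _ _ (\sum_(x <- vs) (vertex_cost x + 2)) (4 * size arrs) _
  (kept_inv vs)); last by lia.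
  pose C r := 1 + \sum_(x <- all_layers [:: r]) vertex_cost x.
  apply: (spec_weaken (P := kept_inv (all_layers rs))).
    apply: (@spec_each _ _ _ _ _ C (fun dn => kept_inv (all_layers dn))).
    - by split.
    - move=> dn r rst K e hK; have [rv lr] : r \in vs /\ lev r = 0.
        by apply: rsv; rewrite e mem_cat inE eqxx orbT.
      apply: spec_weaken (run_tree_spec ht rv lr _ hK) _ (leqnn _).
        (* Trees of different roots are disjoint, because together their layers list [vs] without
           repetition. *)
        have e' : rs = rcons dn r ++ rst by rewrite cat_rcons.
        have /perm_uniq := cat_layers _ _ e'; rewrite uniq_vs cat_uniq => /esym/andP[+ _].
        rewrite (perm_uniq (cat1 _ _)) cat_uniq => /and3P[_ /hasPn h _] x xr.
        by apply/negP=> xd; case/negP: (h _ xd).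
      move=> K' [h1 h2]; split=> [x|x]; rewrite (perm_mem (cat1 _ _)); [exact: h1|exact: h2].
    exact: leqnn.
  - by move=> K [h1 h2]; split=> [x|x]; rewrite -(perm_mem prs); [exact: h1|exact: h2].
  have eC l : \sum_(r <- l) (C r).+1 = 2 * size l + \sum_(x <- all_layers l) vertex_cost x.
    elim: l => [|r l IH]; first by rewrite !big_nil.
    rewrite big_cons IH -cat1s (perm_big _ (layer_list_cat _ _ _)) big_cat /C.
    set a := bigop _ _ _; set b := bigop _ _ _; rewrite size_cat /=; lia.
  rewrite eC (perm_big _ prs) [leqRHS]big_split /= addnC leq_add2l.
  rewrite sum_const_seq leq_mul2l /=.
  by rewrite ers size_rev size_filter count_size.
move=> K [hK _]; apply: (spec_weaken (n := 4 * size arrs)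
  (P := fun l => l = rev [seq b <- arrs | K b])) => //.
  apply: (@spec_each _ _ _ _ _ (fun=> 3) (fun dn l => l = rev [seq b <- dn | K b])) => //.
    move=> dn b rst l e ->; apply: spec_step; apply: spec_step_end => //.
    by rewrite filter_rcons; case: (K b); rewrite ?rev_rcons.
  by rewrite sum_const_seq.
have arrow_pruned b : b \in arrs -> pruned_at (tgt b) K /\ b \in arrows_into (tgt b).
  by move=> bA; split; [apply: hK; apply: tgt_vs|rewrite mem_arrows_into bA eqxx].
move=> _ ->; split.
- by rewrite rev_uniq filter_uniq.
- by move=> b; rewrite mem_rev mem_filter => /andP[].
- move=> b /arrow_pruned[[h _] bx]; have [c + [Kc /simbP s]] := h b bx.
  rewrite mem_arrows_into => /andP[cA /eqP ec]; exists c => //.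
  by rewrite mem_rev mem_filter Kc.
move=> b c; rewrite !mem_rev !mem_filter => /andP[Kb bA] /andP[Kc cA] e s.
have [[_ h] bx] := arrow_pruned b bA; apply: h => //; last exact/simbP.
by rewrite mem_arrows_into cA e eqxx.
Qed.

Lemma sum_indeg s : uniq s -> \sum_(y <- s) indeg y = count (fun b => tgt b \in s) arrs.
Proof.
have e y : indeg y = count (fun b => tgt b == y) arrs by rewrite /indeg size_rev size_filter.
elim: s => [|y s IH] /= us; first by rewrite big_nil (eq_count (a2 := pred0)) // count_pred0.
case/andP: us => ys us; rewrite big_cons IH // e -count_predUI.
rewrite [X in _ + X](eq_count (a2 := pred0)) ?count_pred0 ?addn0.
  by apply: eq_count => b; rewrite /= inE.
by move=> b /=; case: eqP => [->|//]; rewrite (negbTE ys).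
Qed.

Lemma size_arrs : size arrs <= size vs.
Proof.
rewrite -(size_map src); apply: uniq_leq_size; first by rewrite map_inj_in_uniq.
by move=> _ /mapP[b bA ->]; apply: src_vs.
Qed.

(* The weight of a vertex that is not a leaf is at most [3 * indeg x - 3], and
   over all vertices these bounds add up to at most 0 since a forest has fewer
   arrows than vertices. *)
Lemma branching_weight : \sum_(x <- vs) (indeg x != 1) * (1 + indeg x) <=
  4 * count (fun x => indeg x == 0) vs.
Proof.
have h : \sum_(x <- vs) (indeg x != 1) * (1 + indeg x) + 3 * size vs <=
    3 * \sum_(x <- vs) indeg x + 4 * count (fun x => indeg x == 0) vs.
  rewrite -sum1_size -sum1_count !big_distrr /= [X in _ <= _ + X]big_mkcond /= -!big_split /=.
  by apply: leq_sum => x _; case: (indeg x) => [|[|d]] //=; lia.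
have e : \sum_(x <- vs) indeg x <= size vs.
  by rewrite sum_indeg //; apply: leq_trans (count_size _ _) size_arrs.
by move: h e; lia.
Qed.

(** A vertex with one predecessor costs a constant. At the others [indeg x < W] makes the selection
    of the order of [(1 + indeg x) * W] too, and [branching_weight] bounds the sum of these
    [1 + indeg x] by the number of leaves. *)
Lemma run_forest_cost : spec (run_forest src tgt vs arrs f)
  (50 * size vs + 120 * (count (fun x => indeg x == 0) vs * W.+1)) pruned_list.
Proof.
apply: spec_weaken run_forest_spec _ _ => //.
have le1 : \sum_(x <- vs) (vertex_cost x + 2) <= \sum_(x <- vs)
    (3 * indeg x + 30 + 30 * (((indeg x != 1) * (1 + indeg x)) * W.+1)).
  rewrite big_seq [in leqRHS]big_seq; apply: leq_sum => x xv; rewrite /vertex_cost.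
  have ltW : indeg x < W.
    have al : at_level (lev x) [:: x] by split=> // y; rewrite inE => /eqP->.
    by have := at_level_weight al; rewrite big_seq1.
  case: eqVneq ltW => [->|nd] /=; first by lia.
  by rewrite !mul1n; nia.
have le2 := branching_weight; have le3 := size_arrs.
have le4 : \sum_(x <- vs) indeg x <= size vs.
  by rewrite sum_indeg //; apply: leq_trans (count_size _ _) size_arrs.
move: le1; set Sv := \sum_(x <- vs) (vertex_cost x + 2).
have -> : \sum_(x <- vs) (3 * indeg x + 30 + 30 * (((indeg x != 1) * (1 + indeg x)) * W.+1)) =
    3 * (\sum_(x <- vs) indeg x) + 30 * size vs +
    30 * ((\sum_(x <- vs) (indeg x != 1) * (1 + indeg x)) * W.+1).
  elim: (vs) => [|x s IH]; first by rewrite !big_nil.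
  by rewrite !big_cons IH /=; lia.
move=> le1.
have le5 := leq_mul le2 (leqnn W.+1).
by move: le1 le3 le4 le5; lia.
Qed.

End RunForest.

Lemma out_arrow_enum (T : quiver) (x : T) :
  out_arrow source (enum (arrow T)) x = (0 < level x).
Proof.
rewrite lt0n -sink_level; apply/hasP/sinkPn=> [[b _ /eqP eb]|[b eb]]; exists b => //.
  by rewrite mem_enum.
exact/eqP.
Qed.

Section PruneTreeRun.
Variables (T Q : quiver) (f : qmorph T Q).
Hypothesis gT : graded T.
Hypothesis injQ : injective (@source Q).

Lemma sim_list_enum x y : sim_list source target (enum (arrow T)) f x y <-> sim_over f x y.
Proof.
apply: (similar_transfer (i := id)) => // p {}x.
  by case=> b _ [eb1 eb2]; apply/adjP; exists b.
by case/adjP=> b eb1 eb2; exists p => //; exists b; rewrite ?mem_enum.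
Qed.

Lemma run_prune_tree_spec : spec (run_prune_tree f) (300 * qsize T ^ 2)
  (fun kept => pruned f [set b | b \in kept]).
Proof.
(* The crude weight of the whole quiver suffices here, since [qsize T] bounds the number of leaves
   as well. *)
have W j : \sum_(y <- enum T | level y == j) (1 + size (arrows_into target (enum (arrow T)) y))
    <= qsize T.
  apply: leq_trans (_ : \sum_(y <- enum T) (1 + size (arrows_into target (enum (arrow T)) y)) <= _).
    by rewrite big_mkcond leq_sum // => y _; case: ifP.
  rewrite big_split /= sum1_size -cardE /qsize leq_add2l sum_indeg ?enum_uniq //.
  by rewrite cardE count_size.
have f_tgt : {in enum (arrow T) &, forall b c : arrow T,
    f (source b) = f (source c) -> f (target b) = f (target c)}.
  move=> b c _ _ e; have /injQ : source (on_arrow f b) = source (on_arrow f c).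
    by rewrite !on_source.
  by rewrite -!on_target => ->.
have lv : {in enum T, forall x : T, level x <= size (enum T)}.
  by move=> x _; rewrite -cardE ltnW // level_lt_card.
have := @run_forest_cost _ _ source target (enum T) (enum (arrow T)) _ f
  (enum_uniq _) (enum_uniq _) (fun b _ => mem_enum _ _) (fun b _ => mem_enum _ _)
  (fun b c _ _ => @source_inj _ gT b c) (@level T) (fun b _ => levelS gT b)
  (fun x _ => out_arrow_enum x) lv f_tgt _ W.
move/spec_weaken; apply.
- move=> kept [_ _ h1 h2]; split=> [b _|b c].
    have [|c cK [ec /sim_list_enum s]] := h1 b; first by rewrite mem_enum.
    by exists c; rewrite ?inE.
  by rewrite !inE => bK cK e s; apply: h2 => //; apply/sim_list_enum.
have le := count_size (fun x => size (arrows_into target (enum (arrow T)) x) == 0) (enum T).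
have szT : size (enum T) <= qsize T by rewrite -cardE leq_addr.
have leLs := leq_trans le szT.
move: szT leLs; move: (count _ _) (size _) (qsize T) => L n s len leLs.
have := leq_mul leLs (leqnn s); rewrite -mulnn mulnS.
have : s <= s * s by case: (s) => // s'; rewrite leq_pmull.
by lia.
Qed.

End PruneTreeRun.

(** * Algorithms 2 and 3 *)

Section Ancestors.
Variable Q : quiver.
Hypothesis gQ : graded Q.
Implicit Types q x y z : Q.

Lemma level_target (b : arrow Q) : level (target b) < level (source b).
Proof. by rewrite levelS. Qed.

Lemma leQ_level x y : leQ x y -> level y <= level x.
Proof. by case/(leQ_measure level_target) => [->|/ltnW]. Qed.

(** Only one arrow leaves each vertex, so the vertices above [q] form a chain, ordered by level. *)
Lemma leQ_chain q y z : leQ q y -> leQ q z -> level z <= level y -> leQ y z.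
Proof.
case/connectP=> p; elim: p q => [|w p IH] q /=; first by move=> _ ->.
case/andP=> /adjP[b <- <-] hp ey /leQP[<-|[c ec hz]] le.
  have : leQ (target b) y by apply/connectP; exists p.
  by move/leQ_level; rewrite leqNgt (leq_trans (level_target b) le).
by apply: (IH (target b)) => //; rewrite -(source_inj gQ ec).
Qed.

Lemma leQ_same_level q y z : leQ q y -> leQ q z -> level y = level z -> y = z.
Proof.
move=> qy qz e; have := leQ_chain qy qz; rewrite e leqnn => /(_ isT).
by case/(leQ_measure level_target) => [//|]; rewrite e ltnn.
Qed.

Lemma ancestorP q l : l <= level q -> leQ q (ancestor q l) /\ level (ancestor q l) = l.
Proof.
rewrite /ancestor => le; case: pickP => [y /andP[h /eqP e]//|h]; exfalso.
have [n] := ubnP (level q); elim: n q le h => // n IH q le h lt.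
have [e|ne] := eqVneq (level q) l; first by have := h q; rewrite leQ_refl e eqxx.
have /sinkPn[b eb] : ~~ sink q by rewrite sink_level; apply: contra ne => /eqP e0; move: le; rewrite e0 leqn0 eq_sym.
have lb : level q = (level (target b)).+1 by rewrite -eb levelS.
apply: (IH (target b)) => [|y|]; [by lia| |by lia].
apply/negP=> /andP[ty ly]; have := h y; rewrite ly andbT => /negP; apply.
by apply: leQ_trans ty; rewrite -eb leQ_arrow.
Qed.

Lemma ancestor_eq q y : leQ q y -> ancestor q (level y) = y.
Proof.
move=> qy; have [h1 h2] := ancestorP (leQ_level qy).
exact: leQ_same_level h1 qy h2.
Qed.

Lemma ancestor_trans q y l : leQ q y -> l <= level y -> ancestor q l = ancestor y l.
Proof.
move=> qy le; have [h1 h2] := ancestorP le.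
by rewrite -{1}h2 ancestor_eq // (leQ_trans qy).
Qed.

Lemma leQ_ancestor x q : leQ x q <-> level q <= level x /\ ancestor x (level q) = q.
Proof.
split=> [h|[h <-]]; first by rewrite ancestor_eq // leQ_level.
exact: (ancestorP h).1.
Qed.

Lemma ancestor_arrow (a : arrow Q) q l : l < level q -> source a = ancestor q l.+1 ->
  target a = ancestor q l.
Proof.
move=> lt e; have [h1 h2] := ancestorP lt.
have la : level (target a) = l by apply: succn_inj; rewrite -levelS // e h2.
rewrite -la ancestor_eq //; apply: leQ_trans h1 _; rewrite -e; exact: leQ_arrow.
Qed.

Lemma ancestor_level q : ancestor q (level q) = q.
Proof. by apply: ancestor_eq; apply: leQ_refl. Qed.

End Ancestors.

(** * Union-find structures *)

Section UnionFind.
Variables (G : sgraph) (r : rel G).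
Hypothesis r_sym : symmetric r.

Definition uf_fiber (D : {set G}) (phi : G -> G) (v : G) : {set G} :=
  [set w in D | phi w == phi v].

(* The classes [P] over the set [D] are the fibers of the table [phi] of
   representatives, they are connected for [r], and the edges satisfying [E]
   have been processed. *)
Record uf_inv (D : {set G}) (E : pred (gedge G)) (phi : G -> G) (P : {set {set G}}) : Prop :=
  UfInv {
    uf_rep : {in D, forall v, phi v \in D /\ phi (phi v) = phi v};
    uf_blocks : P = [set uf_fiber D phi v | v in D];
    uf_conn : {in D, forall v, connect r v (phi v)};
    uf_edge : forall e, E e -> {in val e, forall v, v \in D} /\ {in val e &, forall v w, phi v = phi w} }.

Lemma uf_inv_add D E phi P v phi' : uf_inv D E phi P -> v \notin D ->
  phi' =1 upd phi v v -> uf_inv (v |: D) E phi' (uf_add P v).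
Proof.
case=> rep blk conn edg vD hphi.
have phiv : phi' v = v by rewrite hphi /upd eqxx.
have phiD w : w \in D -> phi' w = phi w.
  by move=> wD; rewrite hphi /upd; case: eqP => // ewv; rewrite -ewv wD in vD.
have phin w : w \in D -> phi w != v.
  by move=> wD; apply: contraNneq vD => <-; have [] := rep w wD.
have fibD w : w \in D -> uf_fiber (v |: D) phi' w = uf_fiber D phi w.
  move=> wD; apply/setP=> u; rewrite !inE (phiD w wD).
  have [->|nuv] := eqVneq u v; last by case uD: (u \in D) => //=; rewrite phiD.
  by rewrite phiv eq_sym (negbTE (phin w wD)) (negbTE vD).
have fibv : uf_fiber (v |: D) phi' v = [set v].
  apply/setP=> u; rewrite !inE phiv; have [->|nuv] := eqVneq u v; first by rewrite phiv eqxx.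
  by apply/negP=> /andP[uD /eqP e]; have := phin u uD; rewrite -phiD // e eqxx.
split.
- move=> w; rewrite !inE => /orP[/eqP->|wD]; first by rewrite !phiv eqxx.
  by have [h1 h2] := rep w wD; rewrite !phiD // h1 orbT.
- apply/setP=> B; rewrite /uf_add blk !inE; apply/orP/imsetP.
    case=> [/eqP->|/imsetP[w wD ->]].
      by exists v; rewrite ?inE ?eqxx.
    by exists w; rewrite ?inE ?wD ?orbT // fibD.
  case=> w; rewrite !inE => /orP[/eqP->|wD] ->; first by left; rewrite fibv.
  by right; rewrite fibD //; apply/imsetP; exists w.
- move=> w; rewrite !inE => /orP[/eqP->|wD]; first by rewrite phiv connect0.
  by rewrite phiD //; apply: conn.
move=> e /edg[h1 h2]; split=> [w we|w u we ue]; first by rewrite !inE h1 ?orbT.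
by rewrite !phiD ?h1 //; apply: h2.
Qed.

Lemma uf_pblock D E phi P v : uf_inv D E phi P -> v \in D ->
  finset.pblock P v = uf_fiber D phi v.
Proof.
case=> rep blk conn edg vD; rewrite /finset.pblock.
have h : (uf_fiber D phi v \in P) && (v \in uf_fiber D phi v).
  by rewrite blk imset_f //= inE vD eqxx.
case: pickP => [B /andP[]|/(_ (uf_fiber D phi v))]; last by rewrite /= h.
rewrite blk => /imsetP[w wD ->]; rewrite inE => /andP[_ /eqP e] /=.
by apply/setP=> u; rewrite !inE e.
Qed.

(** The union keeps the representative of [v]. The new table is prescribed on [D] only, as the
    entries of vertices not yet added are arbitrary. *)
Lemma uf_inv_union D E phi P (e : gedge G) v w phi' : uf_inv D E phi P ->
  val e = [set v; w] -> v \in D -> w \in D -> r v w ->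
  {in D, forall u, phi' u = if phi u == phi w then phi v else phi u} ->
  uf_inv D (fun e' => E e' || (e' == e)) phi' (uf_union P (val e)).
Proof.
move=> inv ee vD wD rvw hphi; have [rep blk conn edg] := inv.
have mrg u u' : u \in D -> u' \in D -> phi u = phi u' -> phi' u = phi' u'.
  by move=> uD u'D eu; rewrite !hphi // eu.
have ev : phi' v = phi v by rewrite hphi //; case: ifP.
have ew : phi' w = phi v by rewrite hphi // eqxx.
have fibE u : u \in D -> uf_fiber D phi' u =
    if (phi u == phi v) || (phi u == phi w) then uf_fiber D phi v :|: uf_fiber D phi w
    else uf_fiber D phi u.
  move=> uD; apply/setP=> x; rewrite inE; case xD: (x \in D); last first.
    by case: ifP => _; rewrite !inE xD.
  rewrite !hphi //=.
  have [e1|n1] := eqVneq (phi u) (phi w); have [e2|n2] := eqVneq (phi x) (phi w).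
  - by rewrite orbT !inE xD e2 !eqxx orbT.
  - by rewrite orbT !inE xD (negbTE n2) orbF.
  - rewrite orbF; case: ifP => [/eqP->|n3]; first by rewrite !inE xD e2 !eqxx orbT.
    by rewrite !inE xD e2 eq_sym n3 eq_sym (negbTE n1).
  rewrite orbF; case: ifP => [/eqP->|n3]; last by rewrite !inE xD.
  by rewrite !inE xD (negbTE n2) orbF.
split.
- move=> u uD; rewrite hphi //; case: ifP => euw.
    by have [h1 h2] := rep v vD; split=> //; rewrite hphi // h2; case: ifP.
  by have [h1 h2] := rep u uD; split=> //; rewrite hphi // h2 euw.
- have bc : \bigcup_(x in val e) finset.pblock P x = uf_fiber D phi v :|: uf_fiber D phi w.
    by rewrite ee finset.bigcup_setU !finset.big_set1 !(uf_pblock inv).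
  apply/setP=> B; rewrite /uf_union bc blk !inE; apply/orP/imsetP.
    case=> [/eqP->|/andP[/imsetP[u uD ->] dis]].
      by exists v => //; rewrite fibE // eqxx.
    exists u => //; rewrite fibE //; case: ifP => // h; exfalso.
    case/orP: h => /eqP h; [have := disjointFr dis (x := v)|have := disjointFr dis (x := w)];
      by rewrite ee !inE ?vD ?wD h !eqxx ?orbT => /(_ isT).
  case=> u uD ->; rewrite fibE //; case: ifP => h; first by left.
  right; apply/andP; split; first by apply/imsetP; exists u.
  rewrite disjoint_sym ee; apply/pred0P=> x /=; rewrite !inE.
  apply/negP=> /andP[/orP[]/eqP-> /andP[_ /eqP e']]; by rewrite e' eqxx ?orbT in h.
- move=> u uD; rewrite hphi //; case: eqP => [eu|_]; last exact: conn.
  have csym := sym_connect_sym r_sym.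
  apply: connect_trans (conn u uD) _; rewrite eu csym.
  apply: connect_trans (conn w wD); rewrite csym.
  by apply: connect_trans (conn v vD); rewrite csym; apply: connect1.
move=> e' /orP[/edg[h1 h2]|/eqP->].
  by split=> // u u' ue ue'; apply: mrg; rewrite ?h1 //; apply: h2.
rewrite ee; split=> [u|u u'].
  by rewrite !inE => /orP[]/eqP->.
by rewrite !inE => /orP[]/eqP-> /orP[]/eqP->; rewrite ?ev ?ew.
Qed.

End UnionFind.

Lemma uf_inv_sub (G : sgraph) (r r' : rel G) D (E E' : pred (gedge G)) phi P :
  subrel r r' -> subpred E' E -> uf_inv r D E phi P -> uf_inv r' D E' phi P.
Proof.
move=> sr sE [h1 h2 h3 h4]; split=> // [v vD|e /sE/h4//].
have := h3 v vD; apply: connect_sub => x y /sr; exact: connect1.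
Qed.

(** * The classes at each level *)

Section MergeRun.
Variables (Q : quiver) (G : sgraph) (h : filtration Q G).
Hypothesis gQ : graded Q.
Let m := max_level h.

Definition alive l : {set G} := [set v | l <= level (hV h v)].
Definition edge_at l : pred (gedge G) := fun e => l <= level (hE h e).
Definition edge_rel l : rel G :=
  fun v w => [exists e : gedge G, [&& edge_at l e, v \in val e & w \in val e]].

Definition uf_ok l (phi : G -> G) : Prop :=
  uf_inv (edge_rel l) (alive l) (edge_at l) phi (uf_classes h l).

Lemma edge_rel_sym l : symmetric (edge_rel l).
Proof.
by move=> v w; apply/existsP/existsP=> -[e /and3P[h1 h2 h3]]; exists e; rewrite h1 h2 h3.
Qed.

Lemma edge_relP l v w :
  reflect (exists e : gedge G, [/\ l <= level (hE h e), v \in val e & w \in val e])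
          (edge_rel l v w).
Proof.
by apply: (iffP existsP) => -[e]; [move/and3P=> [h1 h2 h3]|case=> h1 h2 h3]; exists e => //; apply/and3P.
Qed.

Lemma edge_alive l e v : edge_at l e -> v \in val e -> v \in alive l.
Proof. by rewrite inE => le /(hVE h)/(leQ_level gQ); apply: leq_trans. Qed.

Lemma level_le_max v : level (hV h v) <= m.
Proof. exact: (leq_bigmax (F := fun v => level (hV h v))). Qed.

Lemma uf_classes_max : uf_classes h m.+1 = finset.set0.
Proof. by rewrite /uf_classes subnn. Qed.

Lemma uf_classesS l : l <= m -> uf_classes h l = uf_pass h (uf_classes h l.+1) l.
Proof.
by move=> le; rewrite /uf_classes -/m subSn //= subSS rev_cons foldl_rcons.
Qed.

Lemma uf_ok_max phi : uf_ok m.+1 phi.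
Proof.
have d0 v : v \in alive m.+1 -> False by rewrite inE ltnNge level_le_max.
split.
- by move=> v /d0.
- rewrite uf_classes_max; apply/esym/setP=> B; rewrite inE.
  by apply/imsetP=> -[v /d0].
- by move=> v /d0.
move=> e he; split=> [v /(edge_alive he)//|v w /(edge_alive he)/d0//].
Qed.

Lemma uf_ok_connect l phi : uf_ok l phi -> {in alive l &, forall u v,
  phi u = phi v <-> connect (edge_rel l) u v}.
Proof.
case=> rep blk conn edg u v uD vD; split=> [e|].
  apply: connect_trans (conn u uD) _.
  by rewrite e (sym_connect_sym (@edge_rel_sym l)) conn.
case/connectP=> p; elim: p u {uD} => [|w p IH] u /=; first by move=> _ ->.
case/andP=> /edge_relP[e [he ue we]] hp ev; rewrite -(IH w hp ev).
by have [_ h2] := edg e he; apply: h2.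
Qed.

Lemma valid_of_uf_ok fnd : (forall l, l <= m -> uf_ok l (fnd l)) -> valid_find h fnd.
Proof.
move=> ok l B le; have [rep blk _ _] := ok l le; rewrite blk => /imsetP[v vD ->].
have [h1 h2] := rep v vD; exists (fnd l v); first by rewrite inE h1 h2 eqxx.
by move=> w; rewrite inE => /andP[_ /eqP].
Qed.

Section ValidFind.
Variable fnd : nat -> G -> G.
Hypothesis fndV : valid_find h fnd.
Variable phi : nat -> G -> G.
Hypothesis phi_ok : forall l, l <= m -> uf_ok l (phi l).

(** [fnd] is any choice of representatives allowed by [valid_find], while [phi] is a table known to
    satisfy the invariant. Both have the same classes, so what is known about the classes passes
    from [phi] to [fnd]. *)
Lemma fnd_alive l v : l <= m -> v \in alive l ->
  fnd l v \in alive l /\ connect (edge_rel l) v (fnd l v).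
Proof.
move=> le vD; have ok := phi_ok le; have [rep blk _ _] := ok.
have [|r rB hr] := fndV le (B := uf_fiber (alive l) (phi l) v); first by rewrite blk imset_f.
have -> : fnd l v = r by apply: hr; rewrite inE vD eqxx.
move: rB; rewrite inE => /andP[rD /eqP e]; split=> //.
by apply/(uf_ok_connect ok).
Qed.

Lemma fnd_connect l u v : l <= m -> u \in alive l -> v \in alive l ->
  fnd l u = fnd l v <-> connect (edge_rel l) u v.
Proof.
move=> le uD vD; have ok := phi_ok le; split=> [e|].
  have [_ cu] := fnd_alive le uD; have [_ cv] := fnd_alive le vD.
  by apply: connect_trans cu _; rewrite e (sym_connect_sym (@edge_rel_sym l)).
move/(uf_ok_connect ok uD vD) => e; have [rep blk _ _] := ok.
have [|r rB hr] := fndV le (B := uf_fiber (alive l) (phi l) v); first by rewrite blk imset_f.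
by rewrite !hr // inE ?uD ?vD ?e eqxx.
Qed.

Lemma fnd_idem l v : l <= m -> v \in alive l -> fnd l (fnd l v) = fnd l v.
Proof.
move=> le vD; have [h1 h2] := fnd_alive le vD.
by apply/esym/fnd_connect.
Qed.

Lemma cover_uf_classes l : l <= m -> finset.cover (uf_classes h l) = alive l.
Proof.
move=> le; have [_ blk _ _] := phi_ok le; rewrite blk; apply/setP=> v.
apply/finset.bigcupP/idP=> [[B /imsetP[w wD ->]]|vD]; first by rewrite inE => /andP[].
by exists (uf_fiber (alive l) (phi l) v); rewrite ?imset_f // inE vD eqxx.
Qed.

Lemma mem_representatives l v : l <= m ->
  (v \in uf_representatives h fnd l) = (v \in alive l) && (fnd l v == v).
Proof.
move=> le; rewrite /uf_representatives cover_uf_classes //.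
apply/imsetP/andP=> [[w wD ->]|[vD /eqP e]]; last by exists v.
by have [h1 _] := fnd_alive le wD; rewrite h1 fnd_idem.
Qed.

(** Both endpoints lie below the vertex of the edge, whose level is at least [l]. Therefore the
    image of a class in $Q$ does not depend on its representative. *)
Lemma edge_rel_ancestor l v w : edge_rel l v w -> ancestor (hV h v) l = ancestor (hV h w) l.
Proof.
case/edge_relP=> e [le ve we].
by rewrite (ancestor_trans gQ (hVE h ve) le) (ancestor_trans gQ (hVE h we) le).
Qed.

Lemma connect_ancestor l v w : connect (edge_rel l) v w ->
  ancestor (hV h v) l = ancestor (hV h w) l.
Proof.
case/connectP=> p; elim: p v => [|u p IH] v /=; first by move=> _ ->.
by case/andP=> /edge_rel_ancestor-> hp /(IH _ hp).
Qed.

Lemma fnd_ancestor l v : l <= m -> v \in alive l ->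
  ancestor (hV h (fnd l v)) l = ancestor (hV h v) l.
Proof. by move=> le /(fnd_alive le)[_ /connect_ancestor]. Qed.

(** Classes only merge from one pass to the next, so an earlier representative stands for its whole
    class. *)
Lemma fndS l v : l < m -> v \in alive l.+1 -> fnd l (fnd l.+1 v) = fnd l v.
Proof.
move=> lt vD; have [h1 h2] := fnd_alive lt vD.
have sub w : w \in alive l.+1 -> w \in alive l by rewrite !inE; apply: ltnW.
apply/fnd_connect; [exact: ltnW|exact: sub|exact: sub|].
rewrite (sym_connect_sym (@edge_rel_sym l)); apply: connect_sub h2 => x y /edge_relP[e [h3 h4 h5]].
by apply/connect1/edge_relP; exists e; rewrite ltnW.
Qed.

End ValidFind.

End MergeRun.

(** * One pass of the merging program *)

Section MergePass.
Variables (Q : quiver) (G : sgraph) (h : filtration Q G).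
Hypothesis gQ : graded Q.
Let m := max_level h.
Variables (lev : Q -> nat) (succ : Q -> Q).
Hypothesis levE : lev =1 @level Q.
Hypothesis succE : forall a : arrow Q, succ (source a) = target a.

Lemma run_union_spec mem v w (uf : G -> G) :
  spec (run_union mem v w uf) (3 * size mem + 3)
    (fun uf' => {in mem, forall u, uf' u = if uf u == uf w then uf v else uf u}).
Proof.
rewrite addn3; do 2!apply: spec_step; case: eqVneq => [e|ne].
  by apply: spec_step_end => // u _; case: eqP => // ->.
(* [v'] and [w'] are read before the loop, and a vertex already redirected to [v'] is not touched
   again because [v'] differs from [w']. *)
apply: (@spec_loop _ _ 2 (fun dn uf' => uf' =1 fun u =>
    if (u \in dn) && (uf u == uf w) then uf v else uf u)) => //.
  move=> dn u rst uf' _ hu; apply: spec_step; apply: spec_step_end => // x.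
  rewrite mem_rcons inE; have [->|nxu] /= := eqVneq x u; last first.
    by case: ifP => _; rewrite /upd ?(negbTE nxu) hu.
  have huu := hu u; have [eu|nu] := eqVneq (uf u) (uf w).
    case: (boolP (u \in dn)) huu => _; rewrite eu eqxx /= => huu.
      by rewrite huu (negbTE ne).
    by rewrite huu eqxx /upd eqxx.
  by rewrite (negbTE nu) andbF in huu; rewrite huu (negbTE nu) huu.
by move=> uf' hu u um; rewrite hu um.
Qed.

Lemma edge_enum (e : gedge G) :
  exists v w, enum (val e) = [:: v; w] /\ val e = [set v; w].
Proof.
have : size (enum (val e)) = 2 by rewrite -cardE (gedges_card (valP e)).
case ee : (enum (val e)) => [|v [|w []]] // _; exists v, w; split=> //.
by apply/setP=> u; rewrite -mem_enum ee !inE.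
Qed.

Definition alive_upto l (dn : seq G) : {set G} :=
  alive h l.+1 :|: [set v in dn | level (hV h v) == l].

(** Inside the loop the table of ancestors is mixed: visited vertices point to level [l], the others
    still to level [l.+1]. *)
Record add_inv l P (dn : seq G) (st : (G -> G) * seq G * (G -> Q)) : Prop := AddInv {
  add_uf : uf_inv (edge_rel h l) (alive_upto l dn) (edge_at h l.+1) st.1.1
    (foldl (@uf_add G) P [seq v <- dn | level (hV h v) == l]);
  add_uniq : uniq st.1.2;
  add_mem : st.1.2 =i alive_upto l dn;
  add_anc : forall v, v \in dn -> l <= level (hV h v) -> st.2 v = ancestor (hV h v) l;
  add_anc_next : {in alive h l.+1, forall v, v \notin dn -> st.2 v = ancestor (hV h v) l.+1} }.

Lemma add_pass_spec l P uf mem anc :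
  uf_inv (edge_rel h l) (alive h l.+1) (edge_at h l.+1) uf P ->
  uniq mem -> mem =i alive h l.+1 ->
  {in alive h l.+1, forall v, anc v = ancestor (hV h v) l.+1} ->
  spec (each (enum G) (uf, mem, anc) (fun v r =>
    let: (uf, mem, anc) := r in
    let* lv := step (lev (hV h v)) in
    if lv == l then step (upd uf v v, v :: mem, upd anc v (hV h v)) else
    if l < lv then
      let* q := step (succ (anc v)) in step (uf, mem, upd anc v q)
    else ret r)) (4 * #|G|) (add_inv l P (enum G)).
Proof.
move=> huf um hmem hanc.
apply: (@spec_each _ _ _ _ _ (fun=> 3) (add_inv l P)).
- have e : alive_upto l [::] = alive h l.+1 by apply/setP=> v; rewrite !inE orbF.
  by split=> //=; rewrite ?e // => v vD _; apply: hanc.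
- move=> dn v rst [[uf1 mem1] anc1] eG [/= h1 h2 h3 h4 h5].
  have vdn : v \notin dn.
    have := enum_uniq G; rewrite eG cat_uniq => /and3P[_ /norP[vd _] _].
    exact: vd.
  apply: spec_step; rewrite levE; case: eqVneq => [ev|nv].
    apply: spec_step_end => //.
    have e : alive_upto l (rcons dn v) = v |: alive_upto l dn.
      apply/setP=> u; rewrite !inE mem_rcons inE.
      by case: (eqVneq u v) => [->|_] //=; rewrite ev eqxx orbT.
    have nD : v \notin alive_upto l dn by rewrite !inE ev ltnn (negbTE vdn).
    split=> /=.
    + by rewrite e filter_rcons ev eqxx foldl_rcons; apply: (uf_inv_add h1).
    + by rewrite h3 nD.
    + by move=> u; rewrite e !inE h3 !inE.
    + move=> u; rewrite mem_rcons inE /upd; case: eqVneq => [-> _ _|nuv /= ud le].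
        by rewrite -ev ancestor_level.
      exact: h4.
    move=> u uD; rewrite mem_rcons inE negb_or /upd => /andP[/negbTE-> ud].
    exact: h5.
  have e : alive_upto l (rcons dn v) = alive_upto l dn.
    apply/setP=> u; rewrite !inE mem_rcons inE.
    by case: (eqVneq u v) => [->|_] //=; rewrite (negbTE nv) !andbF.
  have ef : [seq v <- rcons dn v | level (hV h v) == l] = [seq v <- dn | level (hV h v) == l].
    by rewrite filter_rcons (negbTE nv).
  case: ltnP => [lt|ge].
    apply: spec_step; apply: spec_step_end => //; split; rewrite ?e ?ef //=.
      move=> u; rewrite mem_rcons inE /upd; case: eqVneq => [-> _ _|nuv /= ud le].
        rewrite h5 //; last by rewrite inE.
        have [_ la] := ancestorP gQ lt.
        have /sinkPn[a ea] : ~~ sink (ancestor (hV h v) l.+1) by rewrite sink_level la.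
        by rewrite -ea succE; apply: (ancestor_arrow gQ) ea.
      exact: h4.
    move=> u uD; rewrite mem_rcons inE negb_or /upd => /andP[/negbTE-> ud].
    exact: h5.
  apply: spec_ret; split; rewrite ?e ?ef //=.
    move=> u; rewrite mem_rcons inE => /orP[/eqP->|]; last exact: h4.
    by move=> le; rewrite eqn_leq ge le in nv.
  move=> u uD; rewrite mem_rcons inE negb_or => /andP[_ ud]; exact: h5.
by rewrite sum_const_seq -cardE.
Qed.

Lemma alive_upto_all l : alive_upto l (enum G) = alive h l.
Proof.
by apply/setP=> v; rewrite !inE mem_enum /= [RHS]leq_eqVlt orbC eq_sym.
Qed.

(** Every pass inspects all edges, but an edge is merged only in the pass for its own level. Keeping
    the two costs apart lets the merges of all passes add up to at most
    [#|gedge G| * (3 + 3 * #|G|)]. *)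
Lemma union_pass_spec l P uf mem :
  uf_inv (edge_rel h l) (alive h l) (edge_at h l.+1) uf P -> mem =i alive h l -> uniq mem ->
  spec (each (enum (gedge G)) uf (fun e uf =>
    let* le := step (lev (hE h e)) in
    if le == l then
      if enum (val e) is [:: v; w] then run_union mem v w uf else ret uf
    else ret uf))
    (2 * #|gedge G| + \sum_(e <- enum (gedge G) | level (hE h e) == l) (3 + 3 * #|G|))
    (fun uf' => uf_inv (edge_rel h l) (alive h l) (edge_at h l) uf'
      (foldl (@uf_union G) P [seq val e | e <- enum (gedge G) & level (hE h e) == l])).
Proof.
move=> huf hmem um.
pose E (dn : seq (gedge G)) : pred (gedge G) := fun e => edge_at h l.+1 e || ((e \in dn) && (level (hE h e) == l)).
have szm : size mem <= #|G|.
  by rewrite cardE; apply: uniq_leq_size => // v _; rewrite mem_enum.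
apply: (@spec_weaken _ _ _ _ (fun uf' : G -> G => uf_inv (edge_rel h l) (alive h l) (E (enum (gedge G))) uf'
      (foldl (@uf_union G) P [seq val e | e <- enum (gedge G) & level (hE h e) == l]))).
- apply: (@spec_each _ _ _ _ _ (fun e => 1 + (level (hE h e) == l) * (3 + 3 * #|G|))
    (fun dn uf' => uf_inv (edge_rel h l) (alive h l) (E dn) uf'
      (foldl (@uf_union G) P [seq val e | e <- dn & level (hE h e) == l]))).
  + by apply: uf_inv_sub huf => // e; rewrite /E orbF.
  + move=> dn e rst uf' _ hi; rewrite add1n; apply: spec_step; rewrite levE.
    rewrite filter_rcons; case: eqVneq => [el|nl]; last first.
      apply: spec_ret; apply: uf_inv_sub hi => // e'; rewrite /E mem_rcons inE.
      by case: (eqVneq e' e) => [->|//]; rewrite (negbTE nl) andbF orbC => /= ->.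
    have [v [w [ee ev]]] := edge_enum e; rewrite ee mul1n.
    have inD u : u \in val e -> u \in alive h l by apply: edge_alive; rewrite // /edge_at el.
    have vD : v \in alive h l by apply: inD; rewrite ev !inE eqxx.
    have wD : w \in alive h l by apply: inD; rewrite ev !inE eqxx orbT.
    apply: spec_weaken (run_union_spec mem v w uf') _ _ => [uf'' hu|]; last first.
      by rewrite addnC leq_add2l leq_mul2l szm.
    rewrite map_rcons foldl_rcons.
    have hi' : uf_inv (edge_rel h l) (alive h l) (fun e' => E dn e' || (e' == e)) uf''
        (uf_union (foldl (@uf_union G) P [seq val e | e <- dn & level (hE h e) == l]) (val e)).
      apply: (uf_inv_union (@edge_rel_sym _ _ h l) hi ev vD wD).
        by apply/edge_relP; exists e; rewrite el ev !inE !eqxx orbT.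
      by move=> u uD; apply: hu; rewrite hmem.
    apply: uf_inv_sub hi' => // e'; rewrite /E mem_rcons inE.
    case: (eqVneq e' e) => [->|ne] /=; first by rewrite orbT.
    by rewrite orbF.
  exact: leqnn.
- move=> uf'; apply: uf_inv_sub => // e; rewrite /E mem_enum /edge_at leq_eqVlt => /orP[/eqP<-|->//].
  by rewrite eqxx orbT.
have -> : 2 * #|gedge G| = \sum_(e <- enum (gedge G)) 2.
  by rewrite sum_const_seq -cardE.
rewrite [X in _ <= _ + X]big_mkcond -big_split /=.
by apply: leq_sum => e _; case: eqP; rewrite ?mul1n ?mul0n; lia.
Qed.

(** [fnd] remembers the tables of all finished passes, of which the program keeps only the last:
    arrows between deeper levels refer to earlier tables. Before the first pass [l] is [m.+1], and
    nothing links [fnd] to the current table. *)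
Record merge_inv l (fnd : nat -> G -> G) (st : merge_state Q G) : Prop := MergeInv {
  mi_uf : uf_ok h l (st_uf st);
  mi_mem_uniq : uniq (st_mem st);
  mi_mem : st_mem st =i alive h l;
  mi_anc : {in alive h l, forall v, st_anc st v = ancestor (hV h v) l};
  mi_reps_uniq : uniq (st_reps st);
  mi_reps : forall v, (v \in st_reps st) = (v \in alive h l) && (st_uf st v == v);
  mi_vs_uniq : uniq (st_vs st);
  mi_vs : forall v j, ((v, j) \in st_vs st) =
    [&& l <= j, j <= m, v \in alive h j & fnd j v == v];
  mi_arrs_uniq : uniq (st_arrs st);
  mi_arrs : forall p q, ((p, q) \in st_arrs st) =
    [&& p \in st_vs st, l <= q.2, p.2 == q.2.+1 & q.1 == fnd q.2 p.1];
  mi_map : {in st_vs st, forall p, st_map st p = ancestor (hV h p.1) p.2};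
  mi_fnd : forall j, l <= j <= m -> uf_ok h j (fnd j);
  mi_cur : l <= m -> st_uf st = fnd l }.

(** The summand [9 * #|G|] covers three loops with 3 steps per vertex: representatives, new
    vertices, new arrows. *)
Definition pass_cost l : nat := 4 * #|G| + (2 * #|gedge G| +
  \sum_(e <- enum (gedge G) | level (hE h e) == l) (3 + 3 * #|G|)) + 9 * #|G|.

Lemma size_le_card (s : seq G) : uniq s -> size s <= #|G|.
Proof. by move=> us; rewrite cardE; apply: uniq_leq_size => // v _; rewrite mem_enum. Qed.

Lemma merge_pass_spec l fnd st : l <= m -> merge_inv l.+1 fnd st ->
  spec (run_merge_pass h lev succ l st) (pass_cost l)
    (fun st' => exists fnd', merge_inv l fnd' st').
Proof.
move=> lem [i1 i2 i3 i4 i5 i6 i7 i8 i9 i10 i11 i12 i13].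
have i1' : uf_inv (edge_rel h l) (alive h l.+1) (edge_at h l.+1) (st_uf st) (uf_classes h l.+1).
  apply: uf_inv_sub i1 => // x y /edge_relP[e [he xe ye]].
  by apply/edge_relP; exists e; rewrite ltnW.
rewrite /pass_cost -addnA.
apply: (spec_bind (add_pass_spec i1' i2 i3 i4) _ (leqnn _)) => -[[uf1 mem] anc] [/= a1 a2 a3 a4 _].
rewrite alive_upto_all in a1 a3.
apply: (spec_bind (union_pass_spec a1 a3 a2) _ (leqnn _)) => uf b.
have {}b : uf_ok h l uf by rewrite /uf_ok uf_classesS.
have szm := size_le_card a2.
apply: (@spec_bind _ _ _ _ (3 * #|G|) (6 * #|G|) _
  (fun reps => reps = rev [seq v <- mem | uf v == v])); last by rewrite -mulnDl.
  apply: (@spec_loop _ _ 2 (fun dn reps => reps = rev [seq v <- dn | uf v == v]));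
    rewrite ?leq_mul2l //.
  move=> dn v rst reps _ ->; apply: spec_step; apply: spec_step_end => //.
  by rewrite filter_rcons; case: eqP; rewrite ?rev_rcons.
move=> reps ereps.
have ureps : uniq reps by rewrite ereps rev_uniq filter_uniq.
have mreps v : (v \in reps) = (v \in alive h l) && (uf v == v).
  by rewrite ereps mem_rev mem_filter a3 andbC.
have szr := size_le_card ureps.
apply: (@spec_bind _ _ _ _ (3 * #|G|) (3 * #|G|) _ (fun vm : seq (G * nat) * (G * nat -> Q) =>
   vm.1 = rev [seq (v, l) | v <- reps] ++ st_vs st /\
   vm.2 =1 fun p => if (p.1 \in reps) && (p.2 == l) then anc p.1 else st_map st p)); last by rewrite -mulnDl.
  apply: (@spec_loop _ _ 2 (fun dn (vm : seq (G * nat) * (G * nat -> Q)) =>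
     vm.1 = rev [seq (v, l) | v <- dn] ++ st_vs st /\
     vm.2 =1 fun p => if (p.1 \in dn) && (p.2 == l) then anc p.1 else st_map st p));
    rewrite ?leq_mul2l //.
  move=> dn v rst [vs mp] _ [/= -> hmp]; apply: spec_step; apply: spec_step_end => //=.
  split; first by rewrite map_rcons rev_rcons.
  move=> [u j]; rewrite /upd mem_rcons inE xpair_eqE /= hmp /=.
  by case: (u =P v) => [->|_] /=; case: (j == l); rewrite ?andbF ?andbT.
move=> [vs mp] [/= evs hmp].
have szo := size_le_card i5.
apply: (@spec_bind _ _ _ _ (3 * #|G|) 0 _ (fun arrs =>
   arrs = rev [seq ((v, l.+1), (uf v, l)) | v <- st_reps st] ++ st_arrs st)); last by rewrite addn0.
  apply: (@spec_loop _ _ 2 (fun dn arrs =>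
     arrs = rev [seq ((v, l.+1), (uf v, l)) | v <- dn] ++ st_arrs st)); rewrite ?leq_mul2l //.
  move=> dn v rst arrs _ ->; apply: spec_step; apply: spec_step_end => //.
  by rewrite map_rcons rev_rcons.
move=> arrs earrs; apply: spec_ret.
pose fnd' j := if j == l then uf else fnd j.
have fndl : fnd' l = uf by rewrite /fnd' eqxx.
have fndg j : l < j -> fnd' j = fnd j by rewrite /fnd'; case: eqP => // ->; rewrite ltnn.
exists fnd'.
have memvs v j : ((v, j) \in vs) = (v \in reps) && (j == l) || ((v, j) \in st_vs st).
  rewrite evs mem_cat mem_rev; congr (_ || _).
  by apply/mapP/andP=> [[u ur [-> ->]]|[vr /eqP->]]; [split|exists v].
have ivs v j : ((v, j) \in vs) = [&& l <= j, j <= m, v \in alive h j & fnd' j v == v].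
  rewrite memvs i8; case: (ltngtP l j) => [lt|lt|<-] /=; last first.
  - by rewrite ?eqxx andbT lem mreps fndl orbF.
  - by rewrite andbF.
  by rewrite andbF fndg.
split=> //=.
- by move=> v vD; apply: a4; rewrite ?mem_enum //; rewrite inE in vD.
- rewrite evs cat_uniq i7 andbT rev_uniq map_inj_uniq ?ureps /=; last by move=> ? ? [].
  by apply/hasPn=> -[v j]; rewrite i8 => /andP[lt _]; rewrite mem_rev; apply/mapP=> -[u _ [_ e]];
    rewrite e ltnn in lt.
- rewrite earrs cat_uniq i9 andbT rev_uniq map_inj_uniq ?i5 /=; last by move=> ? ? [].
  apply/hasPn=> -[p q]; rewrite i10 => /and4P[_ lt _ _]; rewrite mem_rev.
  by apply/mapP=> -[u _ [_ e]]; rewrite e ltnn in lt.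
- move=> [v j] [w i] /=; rewrite earrs mem_cat mem_rev i10 /= memvs.
  have -> : ((v, j, (w, i)) \in [seq ((v, l.+1), (uf v, l)) | v <- st_reps st]) =
     [&& v \in st_reps st, j == l.+1, i == l & w == uf v].
    apply/mapP/and4P=> [[u ur [-> -> -> ->]]|[vr /eqP-> /eqP-> /eqP->]]; last by exists v.
    by rewrite ur !eqxx.
  rewrite i6; case: (ltngtP l i) => [lt|lt|<-] /=.
  + rewrite fndg // !andbF /=; case: (eqVneq j i.+1) => [->|_]; rewrite ?andbF //=.
    by rewrite gtn_eqF ?andbF // (ltn_trans lt).
  + by rewrite !andbF.
  rewrite !andbF orbF fndl; case: (eqVneq j l.+1) => [->|_]; rewrite ?andbF //=.
  congr (_ && _); rewrite i8 [l.+1 == l]gtn_eqF // andbF leqnn /=.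
  (* The top level receives no arrows, as no vertex is alive beyond [m]. *)
  case: (leqP l.+1 m) => [lt|gt] /=; first by rewrite -(i13 lt).
  by rewrite inE leqNgt (leq_ltn_trans (level_le_max h v)).
- move=> [v j]; rewrite memvs hmp /=; case: ifP => [/andP[vr /eqP->] _|_ /= hv].
    by apply: a4; rewrite ?mem_enum //; move: vr; rewrite mreps inE => /andP[].
  exact: i11 hv.
move=> j /andP[lj jm]; have [->|nj] := eqVneq j l; first by rewrite fndl.
have lt : l < j by rewrite ltn_neqAle eq_sym nj.
by rewrite fndg //; apply: i12; rewrite lt jm.
Qed.

End MergePass.

Section RunLevel.
Variable Q : quiver.
Hypothesis rQ : rooted_tree Q.
Let gQ := rooted_tree_graded rQ.

Lemma run_succ_spec : spec (run_succ Q) (#|Q| + 2 * #|arrow Q|)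
  (fun succ => forall a : arrow Q, succ (source a) = target a).
Proof.
apply: spec_alloc; apply: (@spec_loop _ _ 1 (fun dn succ =>
   {in dn, forall a, succ (source a) = target a})); rewrite -?cardE //.
  move=> dn a rst succ _ hs; apply: spec_step_end => // b; rewrite mem_rcons inE /upd.
  have [/(source_inj gQ)->//|ne] := eqVneq (source b) (source a).
  by case/orP=> [/eqP e|/hs//]; rewrite e eqxx in ne.
by move=> succ hs a; apply: hs; rewrite mem_enum.
Qed.

Let nextQ := next_layer source target (enum (arrow Q)).
Let layersQ := layer_list source target (enum (arrow Q)).

(** The counter starts at the level of the deepest layer and drops by one per layer. It ends one
    below the level of [l], or at 0 if [l] has level 0. *)
Lemma set_levels_spec n j (l : seq Q) lev0 : {in l, forall x, level x = j} ->
  spec (each (rev (layersQ n l)) (lev0, (j + size (layersQ n l)).-1) (fun l st =>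
    let* lev := each l st.1 (fun x lev => step (upd lev x st.2)) in
    step (lev, st.2.-1)))
  (\sum_(l' <- layersQ n l) (2 * size l' + 2))
  (fun r => {in flatten (layersQ n l), forall x, r.1 x = level x} /\
      (forall x, x \notin flatten (layersQ n l) -> r.1 x = lev0 x) /\ r.2 = j.-1).
Proof.
elim: n j l => [|n IH] j l hl; first by apply: spec_ret; rewrite addn0.
case: l hl => [|x0 l0]; first by move=> _; apply: spec_ret; rewrite addn0.
set l := x0 :: l0 => hl; rewrite (_ : layersQ n.+1 l = l :: layersQ n (nextQ l)) //.
rewrite rev_cons big_cons [size _]/= addnS.
apply: spec_each_rcons.
- have := IH j.+1 (nextQ l); rewrite addSn; apply => p /mem_next_layer[x xl [b + <-]].
  by rewrite mem_arrows_into => /andP[_ /eqP eb]; rewrite (levelS gQ) eb hl.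
- move=> [lev n1] [h1 [h2 e]]; rewrite [(_, _).1]/= in h1 h2; rewrite [(_, _).2]/= in e.
  rewrite {n1}e.
  apply: (@spec_bind _ _ _ _ (2 * size l) 1 (2 * size l + 1) (fun lev' => lev' =1 fun x =>
     if x \in l then level x else lev x)); last exact: leqnn.
    apply: (@spec_loop _ _ 1 (fun (dn : seq Q) (lev' : Q -> nat) => lev' =1 fun x =>
      if x \in dn then level x else lev x)) => //.
    move=> dn x rst lev' el hlev; apply: spec_step_end => // y.
    rewrite /upd mem_rcons inE hlev; case: eqVneq => [->|//] /=.
    by rewrite hl // el mem_cat inE eqxx orbT.
  have memf x : (x \in flatten (l :: layersQ n (nextQ l))) =
      (x \in l) || (x \in flatten (layersQ n (nextQ l))) by exact: mem_cat.
  move=> lev' hlev; apply: spec_step_end => //; split=> [x|].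
    by rewrite memf [LHS]hlev; case: (boolP (x \in l)) => //= _; apply: h1.
  split=> // x; rewrite memf negb_or => /andP[xl /h2 <-].
  by rewrite [LHS]hlev (negbTE xl).
by rewrite [leqRHS]addnC leq_add2l addn1 addn2.
Qed.

Lemma size_layers n (l : seq Q) : size (layersQ n l) <= \sum_(l' <- layersQ n l) size l'.
Proof.
elim: n l => [//|n IH] [//|x l]; rewrite (_ : layersQ _ _ = (x :: l) :: layersQ n (nextQ (x :: l))) //.
by rewrite big_cons /= addSn ltnS; apply: leq_trans (IH _) (leq_addl _ _).
Qed.

Lemma run_level_spec : spec (run_level Q) (30 * qsize Q) (fun lev => lev =1 @level Q).
Proof.
pose n := size (enum Q); pose na := size (enum (arrow Q)).
have n0 : 0 < n by rewrite /n -cardE; case: (rQ) => -[].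
apply: (@spec_weaken _ _ (30 * (n + na)) _ (fun lev => lev =1 @level Q)) => //; last first.
  by rewrite /n /na -!cardE.
apply: (spec_bind (n2 := 29 * n + 26 * na) (in_arrows_spec _ _ _)) => [t ht|]; last first.
  by rewrite -/n -/na; lia.
apply: (spec_bind (n2 := 25 * n + 20 * na) (list_sinks_spec _ _ _)) => [rs ers|]; last first.
  by rewrite -/n -/na; lia.
have prs : perm_eq rs [seq x <- enum Q | level x == 0].
  rewrite ers perm_rev (eq_in_filter (a2 := fun x => level x == 0)) // => x _.
  by rewrite out_arrow_enum lt0n negbK.
have pall : perm_eq (flatten (layersQ #|Q|.+1 rs)) (enum Q).
  have := layer_list_all (enum_uniq Q) (enum_uniq (arrow Q)) (fun b _ => mem_enum _ _)
    (fun b _ => mem_enum _ _) (fun b c _ _ => @source_inj _ gQ b c)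
    (fun b _ => levelS gQ b) (fun x _ => out_arrow_enum x) #|Q|.+1 prs.
  rewrite (eq_filter (a2 := predT)) ?filter_predT // => x.
  by rewrite /= add0n ltnS ltnW // level_lt_card.
have szall : \sum_(l' <- layersQ #|Q|.+1 rs) size l' = n.
  by rewrite /n -(perm_size pall) size_flatten sumnE big_map.
have szl := size_layers #|Q|.+1 rs; rewrite szall in szl.
apply: (spec_bind (n1 := 1 + 2 * n + 3 * na) (n2 := 20 * n) (P := fun ls => ls = rev (layersQ #|Q|.+1 rs))); last by lia.
  apply: spec_weaken (layers_spec source #|Q|.+1 rs [::] ht) _ _ => [ls ->|]; first by rewrite cats0.
  rewrite -addnA leq_add2l -[X in _ <= X + _]muln1.
  have -> : \sum_(l' <- layersQ #|Q|.+1 rs) \sum_(x <- l')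
      (2 + 3 * size (arrows_into target (enum (arrow Q)) x)) =
      \sum_(x <- enum Q) (2 + 3 * size (arrows_into target (enum (arrow Q)) x)).
    by rewrite -(perm_big _ pall) big_flatten.
  have -> : \sum_(x <- enum Q) (2 + 3 * size (arrows_into target (enum (arrow Q)) x)) =
     2 * n + 3 * \sum_(x <- enum Q) size (arrows_into target (enum (arrow Q)) x).
    rewrite /n; elim: (enum Q) => [|x s IH]; first by rewrite !big_nil.
    by rewrite !big_cons IH /=; lia.
  rewrite muln1 leq_add2l leq_mul2l sum_indeg ?enum_uniq //.
  exact: count_size.
move=> ls els.
apply: (spec_bind (n1 := 2 * n) (n2 := 18 * n) (P := fun k => k = size ls)); last by lia.
  apply: (@spec_loop _ _ 1 (fun dn k => k = size dn)) => //.
    by move=> dn l rst k _ ->; apply: spec_step_end; rewrite ?size_rcons.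
  by rewrite els size_rev leq_mul2l.
move=> _ ->; apply: (@spec_weaken _ _ (#|Q| + 4 * n) _ (fun lev => lev =1 @level Q)) => //; last first.
  by rewrite cardE -/n; lia.
apply: spec_alloc; rewrite els size_rev.
have hl : {in rs, forall x, level x = 0}.
  by move=> x; rewrite (perm_mem prs) mem_filter => /andP[/eqP].
have := set_levels_spec #|Q|.+1 (fun=> 0) hl; rewrite add0n => sp.
apply: (spec_bind (n2 := 0) sp) => [r [h1 _]|].
  by apply: spec_ret => x; apply: h1; rewrite (perm_mem pall) mem_enum.
rewrite addn0; apply: leq_trans (_ : 2 * n + 2 * n <= _); last by lia.
have -> : \sum_(l' <- layersQ #|Q|.+1 rs) (2 * size l' + 2) =
   2 * \sum_(l' <- layersQ #|Q|.+1 rs) size l' + 2 * size (layersQ #|Q|.+1 rs).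
  elim: (layersQ _ _) => [|x s IH]; first by rewrite !big_nil.
  by rewrite !big_cons IH /=; lia.
by rewrite szall leq_add2l leq_mul2l.
Qed.

End RunLevel.

(** * The merge forest *)

Section MergeForestResult.
Variables (Q : quiver) (G : sgraph) (h : filtration Q G).
Hypothesis rQ : rooted_tree Q.
Let gQ := rooted_tree_graded rQ.
Let m := max_level h.

Definition merge_cost : nat := 32 * qsize Q + 5 * #|G| +
  m.+1 * (13 * #|G| + 2 * #|gedge G| + 1) + #|gedge G| * (3 + 3 * #|G|).

(** An edge has one level, so it contributes to at most one of the inner sums. *)
Lemma sum_level_edges n c :
  \sum_(l <- iota 0 n) \sum_(e <- enum (gedge G) | level (hE h e) == l) c <= #|gedge G| * c.
Proof.
rewrite cardE; elim: (enum _) => [|e s IH].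
  by rewrite big1 // => l _; rewrite big_nil.
under eq_bigr do rewrite big_mkcond big_cons -big_mkcond.
rewrite big_split /= mulSn leq_add //.
have [lt|ge] := ltnP (level (hE h e)) n; last first.
  rewrite big_seq big1 // => l; rewrite mem_iota add0n /= => lt.
  by case: eqP => // el; rewrite el leqNgt lt in ge.
rewrite (bigD1_seq (level (hE h e))) ?iota_uniq ?mem_iota //= eqxx big1 ?addn0 //.
by move=> l; rewrite eq_sym => /negbTE->.
Qed.

Lemma run_merge_forest_spec :
  spec (run_merge_forest h) merge_cost (fun st => exists fnd, merge_inv h 0 fnd st).
Proof.
pose c := m.+1 * (13 * #|G| + 2 * #|gedge G| + 1) + #|gedge G| * (3 + 3 * #|G|).
have -> : merge_cost = 30 * qsize Q + (2 * qsize Q + (3 * #|G| + (#|G| + (#|G| + c)))).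
  rewrite /merge_cost -addnA -/c; move: (qsize Q) c (#|G|) => a b d; lia.
rewrite /run_merge_forest; apply: (spec_bind (run_level_spec rQ) _ (leqnn _)) => lev hlev.
apply: (spec_bind (n2 := 3 * #|G| + (#|G| + (#|G| + c))) (run_succ_spec rQ)) => [succ hsucc|]; last first.
  by rewrite leq_add2r /qsize mulnDr leq_add2r leq_pmull.
apply: (spec_bind (n1 := 3 * #|G|) (n2 := #|G| + (#|G| + c)) (P := fun k => k = m) _ _ (leqnn _)).
  apply: (@spec_loop _ _ 2 (fun dn k => k = \max_(v <- dn) level (hV h v))); rewrite -?cardE //.
  - by rewrite big_nil.
  - move=> dn v rst k _ ->; apply: spec_step; apply: spec_step_end => //.
    by rewrite hlev -cats1 big_cat big_seq1 maxnC.
  by move=> k ->; rewrite /m /max_level big_enum.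
move=> _ ->; apply: spec_alloc; apply: spec_alloc.
apply: (@spec_weaken _ _ c _ (fun st => exists fnd, merge_inv h (m.+1 - size (rev (iota 0 m.+1))) fnd st)) => //; last first.
  by rewrite size_rev size_iota subnn.
apply: (@spec_each _ _ _ _ _ (pass_cost h)
  (fun dn st => exists fnd, merge_inv h (m.+1 - size dn) fnd st)).
(* Any table will do at the start, as no vertex is alive at level [m.+1]. *)
- exists (fun=> id); rewrite subn0.
  have d0 v : v \in alive h m.+1 -> False by rewrite inE ltnNge (level_le_max h v).
  split=> //=.
  + exact: uf_ok_max.
  + by move=> v; rewrite in_nil; apply/esym/negbTE/negP=> /d0.
  + by move=> v /d0.
  + by move=> v; rewrite in_nil; apply/esym/negbTE/negP=> /andP[/d0].
  + by move=> v j; rewrite in_nil; apply/esym/negbTE/negP=> /andP[h1 /andP[h2 _]]; lia.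
  + by move=> j /andP[h1 h2]; lia.
- move=> dn l rst st e [fnd hst].
  have sz : size dn < m.+1.
    by have := congr1 size e; rewrite size_rev size_iota size_cat /=; lia.
  have el : l = m - size dn.
    have := congr1 (fun s => nth 0 s (size dn)) e.
    rewrite nth_cat ltnn subnn [nth _ (_ :: _) _]/= => <-.
    rewrite nth_rev size_iota; last exact: sz.
    by rewrite nth_iota; lia.
  have el' : m.+1 - size dn = l.+1 by lia.
  rewrite el' in hst; rewrite size_rcons.
  apply: spec_weaken (merge_pass_spec gQ hlev hsucc _ hst) _ (leqnn _); first by rewrite el leq_subr.
  by move=> st' hst'; rewrite (_ : m.+1 - (size dn).+1 = l) //; lia.
rewrite (perm_big _ (permEl (perm_rev _))).
apply: leq_trans (leq_add (leqnn _) (sum_level_edges m.+1 (3 + 3 * #|G|))).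
have -> : m.+1 * (13 * #|G| + 2 * #|gedge G| + 1) =
    \sum_(l <- iota 0 m.+1) (13 * #|G| + 2 * #|gedge G| + 1).
  by rewrite sum_const_seq size_iota mulnC.
have le l : (pass_cost h l).+1 <= 13 * #|G| + 2 * #|gedge G| + 1 +
    \sum_(e <- enum (gedge G) | level (hE h e) == l) (3 + 3 * #|G|).
  rewrite /pass_cost; set s := bigop _ _ _; move: s (#|G|) (#|gedge G|) => s a b; lia.
by rewrite -big_split; apply: leq_sum => l _; apply: le.
Qed.

(** The tables are taken from a run of the program. *)
Lemma uf_ok_exists : exists phi, forall l, l <= m -> uf_ok h l (phi l).
Proof.
by have [[fnd hst] _] := run_merge_forest_spec; exists fnd => l le; apply: (mi_fnd hst).
Qed.

Section Forest.
Variable fnd : nat -> G -> G.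
Hypothesis fndV : valid_find h fnd.
Let MF := merge_forest h fnd.
Implicit Types x y : MF.

Definition vname x : G * nat := ((val x).1, val (val x).2).

Lemma vname_inj : injective vname.
Proof. by move=> x y [e1 e2]; apply: val_inj; apply: injective_projections => //; apply: val_inj. Qed.

Lemma vname_rep x : [/\ (vname x).2 <= m, (vname x).1 \in alive h (vname x).2
  & fnd (vname x).2 (vname x).1 = (vname x).1].
Proof.
have [phi hphi] := uf_ok_exists.
have lex : (vname x).2 <= m by rewrite -ltnS; apply: (valP (val x).2) || exact: ltn_ord.
have := valP x; rewrite (mem_representatives fndV hphi) // => /andP[h1 /eqP h2].
by split.
Qed.

Lemma vname_ex v j : j <= m -> v \in alive h j -> fnd j v = v -> exists x, vname x = (v, j).
Proof.
move=> le vD e; have [phi hphi] := uf_ok_exists.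
have lt : j < m.+1 by [].
have hx : v \in uf_representatives h fnd (Ordinal lt).
  by rewrite (mem_representatives fndV hphi) // vD e eqxx.
by exists (exist (fun x : G * 'I_m.+1 => x.1 \in uf_representatives h fnd x.2) (v, Ordinal lt) hx).
Qed.

Lemma merge_mapE x : Defs.merge_map x = ancestor (hV h (vname x).1) (vname x).2.
Proof. by []. Qed.

Lemma level_merge_map x : level (Defs.merge_map x) = (vname x).2.
Proof.
have [_ h2 _] := vname_rep x; rewrite inE in h2.
by rewrite merge_mapE (ancestorP gQ h2).2.
Qed.

Lemma merge_arrow_name (b : arrow MF) : exists v j,
  vname (source b) = (v, j.+1) /\ vname (target b) = (fnd j v, j).
Proof.
case: b => -[[x y] a] /= /and4P[/eqP h1 /eqP h2 _ _].
by exists (val x).1, (val (val y).2); split; congr (_, _).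
Qed.

(** The image of [x] has positive level, so an arrow of $Q$ leaves it. Its target is the ancestor of
    level [j], which is the image of the merged class. *)
Lemma merge_arrow_ex x v j : vname x = (v, j.+1) ->
  exists2 b : arrow MF, source b = x & vname (target b) = (fnd j v, j).
Proof.
move=> ex; have [phi hphi] := uf_ok_exists.
have := vname_rep x; rewrite ex /= => -[h1 h2 h3].
have vD : v \in alive h j by move: h2; rewrite !inE; apply: ltnW.
have jm := ltnW h1.
have [y ey] : exists y, vname y = (fnd j v, j).
  apply: vname_ex => //; first exact: (fnd_alive fndV hphi jm vD).1.
  exact: (fnd_idem fndV hphi jm vD).
have /sinkPn[a ea] : ~~ sink (Defs.merge_map x) by rewrite sink_level level_merge_map ex.
have ta : target a = Defs.merge_map y.
  rewrite merge_mapE ey /= (fnd_ancestor gQ fndV hphi jm vD).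
  by apply: (ancestor_arrow gQ); [rewrite inE in h2|rewrite ea merge_mapE ex].
have hb : is_merge_arrow ((x, y), a).
  case: ex ey => e1 e2 [e3 e4]; apply/and4P; split; apply/eqP => //.
    exact: etrans e2 (congr1 S (esym e4)).
  exact: etrans e3 (congr2 fnd (esym e4) (esym e1)).
by exists (exist (fun t => is_merge_arrow t) ((x, y), a) hb).
Qed.

Lemma merge_source_inj : injective (@source MF).
Proof.
move=> b c e; have [v [j [b1 b2]]] := merge_arrow_name b.
have [w [i [c1 c2]]] := merge_arrow_name c.
have et : target b = target c.
  by apply: vname_inj; rewrite b2 c2; move: b1; rewrite e c1 => -[-> ->].
apply: val_inj; move: e et; case: b {b1 b2} => -[[x y] a] /= hb; case: c {c1 c2} => -[[x' y'] a'] /= hc.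
move=> ex ey; rewrite ex ey in hb *; congr (_, _, _); apply: (source_inj gQ).
by case/and4P: hb => _ _ /eqP-> _; case/and4P: hc => _ _ /eqP->.
Qed.

Lemma merge_forest_graded : graded MF /\ forall x, level x = (vname x).2.
Proof.
have lS (b : arrow MF) : (vname (source b)).2 = (vname (target b)).2.+1.
  by have [v [j [-> ->]]] := merge_arrow_name b.
have l0 x : sink x = ((vname x).2 == 0).
  apply: negb_inj; apply/sinkPn/idP=> [[b <-]|]; first by rewrite lS.
  case e : (vname x) => [v [|j]] //= _.
  by have [b eb _] := merge_arrow_ex e; exists b.
split; first exact: (lev_graded merge_source_inj lS l0).
by move=> x; apply: (level_lev lS l0).
Qed.

Lemma merge_level_f x y : merge_forest_over h fnd x = merge_forest_over h fnd y -> level x = level y.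
Proof. by move=> /= e; rewrite !merge_forest_graded.2 -!level_merge_map e. Qed.

Lemma merge_sink_f x : sink x -> sink (merge_forest_over h fnd x).
Proof. by rewrite !sink_level merge_forest_graded.2 /= level_merge_map. Qed.

Lemma prune_forest_pruned (S : {set arrow MF}) :
  prune_forest S <-> pruned (merge_forest_over h fnd) S.
Proof.
have [gM lM] := merge_forest_graded.
have level_C (C : component MF) (x y : full_on (val C)) :
    full_on_over (merge_forest_over h fnd) (val C) x = full_on_over (merge_forest_over h fnd) (val C) y ->
    level x = level y.
    by move/merge_level_f; rewrite !(level_full_on gM).
split=> [hS|/pruned_components hS].
  by apply/pruned_components => C; apply: (prune_tree_pruned (graded_full_on gM C) (@level_C C)).
by move=> C; apply: (pruned_prune_tree (graded_full_on gM C) (@level_C C)).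
Qed.

End Forest.

End MergeForestResult.

(** * The output of the program for graphs *)

Section DecomposeRun.
Variables (Q : quiver) (G : sgraph) (h : filtration Q G).
Hypothesis rQ : rooted_tree Q.
Let gQ := rooted_tree_graded rQ.
Let m := max_level h.

Section Result.
Variables (fnd : nat -> G -> G) (st : merge_state Q G).
Hypothesis hst : merge_inv h 0 fnd st.
Let ok : forall l, l <= m -> uf_ok h l (fnd l) := fun l le => mi_fnd hst le.
Let fndV : valid_find h fnd := valid_of_uf_ok ok.
Let vs := st_vs st.
Let arrs := st_arrs st.
Implicit Types (p q : G * nat).

Lemma mem_vs v j : ((v, j) \in vs) = [&& j <= m, v \in alive h j & fnd j v == v].
Proof. by rewrite /vs (mi_vs hst). Qed.

Lemma mem_arrs v j q : ((v, j.+1), q) \in arrs = ((v, j.+1) \in vs) && (q == (fnd j v, j)).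
Proof.
rewrite /arrs (mi_arrs hst) /=; case: q => w i /=; rewrite eqSS xpair_eqE (eq_sym i).
by case: (eqVneq j i) => [->|_] /=; rewrite ?andbT ?andbF.
Qed.

Lemma arrsP b : b \in arrs -> exists v j,
  [/\ b = ((v, j.+1), (fnd j v, j)), (v, j.+1) \in vs & (fnd j v, j) \in vs].
Proof.
case: b => [[v j] [w i]]; rewrite /arrs (mi_arrs hst) => /and4P[hv _ /eqP /= ej /eqP /= ew].
rewrite {w}ew; rewrite {j}ej in hv *; exists v, i; split=> //.
have := hv; rewrite mem_vs => /and3P[im vD _].
have vD' : v \in alive h i by move: vD; rewrite !inE; apply: ltnW.
by rewrite mem_vs (ltnW im) (fnd_alive fndV ok (ltnW im) vD').1
  (fnd_idem fndV ok (ltnW im) vD') eqxx.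
Qed.

Lemma arrs_src : {in arrs, forall b, b.1 \in vs}.
Proof. by move=> b /arrsP[v [j [-> ? ?]]]. Qed.

Lemma arrs_tgt : {in arrs, forall b, b.2 \in vs}.
Proof. by move=> b /arrsP[v [j [-> ? ?]]]. Qed.

Lemma arrs_src_inj : {in arrs &, injective fst}.
Proof. by move=> _ _ /arrsP[v [j [-> _ _]]] /arrsP[w [i [-> _ _]]] /= [-> ->]. Qed.

Lemma arrs_lev : {in arrs, forall b, b.1.2 = b.2.2.+1}.
Proof. by move=> _ /arrsP[v [j [-> _ _]]]. Qed.

Lemma vs_out_arrow : {in vs, forall p, out_arrow fst arrs p = (0 < p.2)}.
Proof.
move=> [v [|j]] hv /=; apply/hasP; last first.
  by exists ((v, j.+1), (fnd j v, j)); rewrite //= mem_arrs hv eqxx.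
by case=> _ /arrsP[w [i [-> _ _]]] /eqP.
Qed.

(** The classes of [v] at the levels [0], ..., [j] are already [j.+1] different vertices of the
    forest. *)
Lemma vs_lev : {in vs, forall p, p.2 <= size vs}.
Proof.
move=> [v j] hv /=; apply: ltnW; have := hv; rewrite mem_vs => /and3P[jm vD _].
pose s := [seq (fnd i v, i) | i <- iota 0 j.+1].
have us : uniq s by rewrite map_inj_uniq ?iota_uniq // => a b [].
have := uniq_leq_size (s2 := vs) us; rewrite size_map size_iota; apply=> p.
case/mapP=> i; rewrite mem_iota add0n ltnS => /= ij ->.
have im := leq_trans ij jm; have vDi : v \in alive h i.
  by move: vD; rewrite !inE; apply: leq_trans.
by rewrite mem_vs im /= (fnd_alive fndV ok im vDi).1 (fnd_idem fndV ok im vDi) eqxx.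
Qed.

Lemma vs_map p : p \in vs -> st_map st p = ancestor (hV h p.1) p.2 /\ level (st_map st p) = p.2.
Proof.
move=> hp; rewrite (mi_map hst hp); split=> //; case: p hp => v j.
by rewrite mem_vs inE => /and3P[_ vD _]; apply: (ancestorP gQ vD).2.
Qed.

Lemma arrs_map_tgt : {in arrs &, forall b c,
  st_map st b.1 = st_map st c.1 -> st_map st b.2 = st_map st c.2}.
Proof.
have step b : b \in arrs -> exists2 a : arrow Q, source a = st_map st b.1 & target a = st_map st b.2.
  move=> bA; have b1 := arrs_src bA; have b2 := arrs_tgt bA.
  have [e1 l1] := vs_map b1; have [e2 l2] := vs_map b2; have el := arrs_lev bA.
  have /sinkPn[a ea] : ~~ sink (st_map st b.1) by rewrite sink_level l1 el.
  exists a => //; rewrite e2; have [v [j [eb hv _]]] := arrsP bA; rewrite eb /=.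
  have := hv; rewrite mem_vs => /and3P[jm vD _].
  have vD' : v \in alive h j by move: vD; rewrite !inE; apply: ltnW.
  rewrite (fnd_ancestor gQ fndV ok (ltnW jm) vD'); apply: (ancestor_arrow gQ).
    by rewrite inE in vD.
  by rewrite ea e1 eb.
move=> b c /step[a <- <-] /step[a' <- <-] e.
by rewrite (source_inj gQ e).
Qed.

Lemma level_size j : size [seq p <- vs | p.2 == j] <= #|G|.
Proof.
rewrite -(size_map fst); apply: size_le_card; rewrite map_inj_in_uniq.
  by rewrite filter_uniq // (mi_vs_uniq hst).
by move=> [v i] [w i']; rewrite !mem_filter /= => /andP[/eqP-> _] /andP[/eqP-> _] ->.
Qed.

(** The arrows into level [j] start at distinct vertices of level [j.+1], and a level has at most
    one vertex of the forest for each vertex of [G]. *)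
Lemma level_weight j :
  \sum_(p <- vs | p.2 == j) (1 + size (arrows_into snd arrs p)) <= 2 * #|G|.
Proof.
rewrite -big_filter big_split /= sum1_size mul2n -addnn leq_add ?level_size //.
rewrite sum_indeg ?filter_uniq ?(mi_vs_uniq hst) // -size_filter.
apply: leq_trans (level_size j.+1); rewrite -[leqLHS](size_map fst).
apply: uniq_leq_size.
  rewrite map_inj_in_uniq ?filter_uniq ?(mi_arrs_uniq hst) // => b c.
  by rewrite !mem_filter => /andP[_ bA] /andP[_ cA]; apply: arrs_src_inj.
move=> _ /mapP[b + ->]; rewrite !mem_filter => /andP[/andP[/eqP e _] bA].
by rewrite arrs_src // arrs_lev // e eqxx.
Qed.

(* A leaf is a vertex of the graph that is created at the level of the leaf. *)
Lemma leaves_le : count (fun p => size (arrows_into snd arrs p) == 0) vs <= #|G|.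
Proof.
rewrite -size_filter -(size_map fst); apply: size_le_card.
have leaf v j : (v, j) \in vs -> size (arrows_into snd arrs (v, j)) == 0 ->
    j = level (hV h v).
  rewrite mem_vs => /and3P[jm vD /eqP ev] l0; apply/eqP; rewrite eqn_leq.
  have := vD; rewrite inE => -> /=; rewrite leqNgt; apply/negP=> lt.
  have vD' : v \in alive h j.+1 by rewrite inE.
  have jm' : j < m by apply: leq_trans lt (level_le_max h v).
  have [uD cu] := fnd_alive fndV ok jm' vD'.
  have hu : (fnd j.+1 v, j.+1) \in vs.
    by rewrite mem_vs jm' uD (fnd_idem fndV ok jm' vD') eqxx.
  have : ((fnd j.+1 v, j.+1), (v, j)) \in arrows_into snd arrs (v, j).
    rewrite mem_arrows_into mem_arrs hu /= eqxx andbT.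
    by rewrite (fndS fndV ok jm' vD') ev.
  by rewrite (size0nil (eqP l0)).
rewrite map_inj_in_uniq; first by rewrite filter_uniq // (mi_vs_uniq hst).
move=> [v i] [w j]; rewrite !mem_filter => /andP[l1 h1] /andP[l2 h2] /= evw.
by rewrite (leaf _ _ h1 l1) (leaf _ _ h2 l2) evw.
Qed.

Lemma size_vs : size vs <= m.+1 * #|G|.
Proof.
have -> : size vs = \sum_(j <- iota 0 m.+1) size [seq p <- vs | p.2 == j].
  have : {in vs, forall p, p.2 < m.+1}.
    by move=> [v j]; rewrite mem_vs => /and3P[].
  elim: (vs) => [|p s IH] hs; first by rewrite big1.
  have lt : p.2 < m.+1 by apply: hs; rewrite inE eqxx.
  rewrite /= IH; last by move=> q qs; apply: hs; rewrite inE qs orbT.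
  have pin : p.2 \in iota 0 m.+1 by rewrite mem_iota.
  rewrite (bigD1_seq p.2 pin (iota_uniq _ _)) [in RHS](bigD1_seq p.2 pin (iota_uniq _ _)) /=.
  rewrite eqxx /= addSn; congr (_ + _).+1; apply: eq_bigr => j nj.
  by rewrite eq_sym (negbTE nj).
apply: (@leq_trans (\sum_(j <- iota 0 m.+1) #|G|)).
  by apply: leq_sum => j _; apply: level_size.
by rewrite sum_const_seq size_iota mulnC.
Qed.

Lemma run_forest_merge_spec :
  spec (run_forest fst snd vs arrs (st_map st))
    (50 * (m.+1 * #|G|) + 120 * (#|G| * (2 * #|G|).+1))
    (pruned_list fst snd arrs (st_map st)).
Proof.
apply: spec_weaken (run_forest_cost (mi_vs_uniq hst) (mi_arrs_uniq hst) arrs_src arrs_tgt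
  arrs_src_inj (lev := snd) arrs_lev vs_out_arrow vs_lev arrs_map_tgt level_weight) _ _ => //.
apply: leq_add; first by rewrite leq_mul2l size_vs.
by rewrite leq_mul2l leq_mul2r leaves_le !orbT.
Qed.

Let MF := merge_forest h fnd.
Let F := merge_forest_over h fnd.

Lemma vname_vs (x : MF) : vname x \in vs.
Proof.
have [h1 h2 h3] := vname_rep rQ fndV x.
by rewrite (surjective_pairing (vname x)) mem_vs h1 h2 h3 eqxx.
Qed.

Lemma vs_vname p : p \in vs -> exists x : MF, vname x = p.
Proof.
by case: p => v j; rewrite mem_vs => /and3P[h1 h2 /eqP h3]; apply: (vname_ex rQ fndV).
Qed.

Lemma map_vname (x : MF) : st_map st (vname x) = Defs.merge_map x.
Proof. by rewrite (vs_map (vname_vs x)).1. Qed.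

Definition aname (b : arrow MF) : (G * nat) * (G * nat) := (vname (source b), vname (target b)).

Lemma aname_inj : injective aname.
Proof. by move=> b c /(congr1 fst) /vname_inj e; apply: (merge_source_inj rQ e). Qed.

Lemma aname_arrs b : aname b \in arrs.
Proof.
have [v [j [e1 e2]]] := merge_arrow_name b.
by rewrite /aname e1 e2 mem_arrs -e1 vname_vs eqxx.
Qed.

Lemma arrs_aname c : c \in arrs -> exists b, aname b = c.
Proof.
case/arrsP=> v [j [-> h1 _]]; have [x ex] := vs_vname h1.
have [b eb1 eb2] := merge_arrow_ex rQ fndV ex.
by exists b; rewrite /aname eb1 ex eb2.
Qed.

Lemma sim_vname (x y : MF) :
  sim_over F x y <-> sim_list fst snd arrs (st_map st) (vname x) (vname y).
Proof.
apply: (similar_transfer (i := @vname Q G h fnd)) => [{}x {}y|p {}x|p {}x].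
- by rewrite !map_vname.
- by case/adjP=> b <- <-; exists (aname b); rewrite ?aname_arrs.
case=> c /arrs_aname[b <-] [<- /vname_inj <-]; exists (source b) => //.
by apply/adjP; exists b.
Qed.

Lemma represents_kept kept : pruned_list fst snd arrs (st_map st) kept ->
  exists2 S : {set arrow MF}, prune_forest S & represents S (vs, kept, st_map st).
Proof.
case=> uk sk ck ik; exists [set b | aname b \in kept].
  apply/(prune_forest_pruned rQ fndV); split=> [b _|b c]; last first.
    rewrite !inE => bK cK e s; apply: aname_inj; apply: ik => //; first exact: (f_equal (@vname Q G h fnd) e).
    exact/sim_vname.
  have [c cK [ec s]] := ck _ (aname_arrs b); have [d ed] := arrs_aname (sk _ cK).
  exists d; first by rewrite inE ed.
  rewrite -ed in ec s; split; first exact: vname_inj ec.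
  exact/sim_vname.
split; last exact: map_vname.
- apply: uniq_perm; first exact: (mi_vs_uniq hst).
    by rewrite map_inj_uniq ?enum_uniq //; apply: vname_inj.
  move=> p; apply/idP/mapP=> [/vs_vname[x <-]|[x _ ->]]; last exact: vname_vs.
  by exists x; rewrite ?mem_enum.
apply: uniq_perm => //.
  by rewrite map_inj_uniq ?enum_uniq //; apply: aname_inj.
move=> p; apply/idP/mapP=> [pK|[b + ->]]; last by rewrite mem_enum inE.
have [b eb] := arrs_aname (sk _ pK); exists b => //.
by rewrite mem_enum inE eb.
Qed.

End Result.

Lemma run_decompose_spec :
  spec (run_decompose_H0 h)
    (merge_cost h + (50 * (m.+1 * #|G|) + 120 * (#|G| * (2 * #|G|).+1)))
    (fun out => exists2 fnd : nat -> G -> G, valid_find h fnd &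
         exists2 S : {set arrow (merge_forest h fnd)}, prune_forest S & represents S out).
Proof.
apply: (spec_bind (run_merge_forest_spec h rQ) _ (leqnn _)) => st [fnd hst].
apply: (spec_bind (n2 := 0) (run_forest_merge_spec hst)) => [kept hk|]; last by rewrite addn0.
apply: spec_ret; exists fnd; last exact: represents_kept.
by apply: valid_of_uf_ok => l le; apply: (mi_fnd hst).
Qed.

(** Levels are below [#|Q|], so the size of $Q$ bounds the number of passes and, with it, the number
    of vertices of the forest. Hence it has to be linear in [gsize G]. *)
Lemma run_decompose_time k : qsize Q <= k * gsize G ->
  (run_decompose_H0 h).2 <= (100 * k + 500) * gsize G ^ 2.
Proof.
move=> hk; have [_ le] := run_decompose_spec; apply: leq_trans le _.
have hQ : 0 < #|Q| by case: rQ => -[].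
have hm : m.+1 <= qsize Q.
  apply: leq_trans (leq_addr _ _); rewrite /m /max_level.
  have [x _] : exists x : Q, true by case/card_gt0P: hQ => x _; exists x.
  rewrite -(prednK hQ) ltnS; apply/bigmax_leqP => v _.
  by rewrite -ltnS prednK // level_lt_card.
have hm' := leq_trans hm hk.
(* A rooted tree is nonempty, so the bound on [qsize Q] excludes the empty graph. *)
have hg : 0 < gsize G by case: (gsize G) hm' => //; rewrite muln0.
rewrite /merge_cost -/m.
have hG : #|G| <= gsize G by apply: leq_addr.
have hE : #|gedge G| <= gsize G by apply: leq_addl.
move: (#|G|) (#|gedge G|) (gsize G) (m.+1) (qsize Q) hG hE hg hm hm' hk => v e g M q.
move=> hv he hg hMq hM hq.
have gg : g <= g * g by rewrite leq_pmulr.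
have t1 : 32 * q <= 32 * k * (g * g).
  by apply: leq_trans (_ : 32 * (k * g) <= _); [rewrite leq_mul2l hq|rewrite -mulnA !leq_mul2l gg !orbT].
have t2 : 5 * v <= 5 * (g * g) by rewrite leq_mul2l /= (leq_trans hv).
have t3 : M * (13 * v + 2 * e + 1) <= 16 * k * (g * g).
  apply: leq_trans (_ : (k * g) * (16 * g) <= _); first by apply: leq_mul => //; lia.
  by rewrite -!mulnA [g * (16 * g)]mulnCA [k * _]mulnCA.
have t4 : e * (3 + 3 * v) <= 6 * (g * g).
  apply: leq_trans (_ : g * (6 * g) <= _); first by apply: leq_mul => //; lia.
  by rewrite mulnCA.
have t5 : 50 * (M * v) <= 50 * k * (g * g).
  apply: leq_trans (_ : 50 * ((k * g) * g) <= _); first by rewrite leq_mul2l /= leq_mul.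
  by rewrite -!mulnA.
have t6 : 120 * (v * (2 * v).+1) <= 360 * (g * g).
  apply: leq_trans (_ : 120 * (g * (3 * g)) <= _); last by rewrite [g * (3 * g)]mulnCA; lia.
  by rewrite leq_mul2l /=; apply: leq_mul => //; lia.
rewrite -mulnn mulnDl.
by move: t1 t2 t3 t4 t5 t6; lia.
Qed.

End DecomposeRun.

(** * Zeroth homology *)

Section ZerothHomology.
Local Open Scope classical_set_scope.
Local Open Scope ring_scope.
Variables (R : realType) (k : fieldType) (I : finType) (X : set (I -> R)).
Let point := I -> R.
Implicit Types (c : seq (k * point)) (b : seq (k * (R -> point))).

Definition chain_in c : Prop := forall i, i \in c -> X i.2.
Definition paths_in b : Prop := forall j, j \in b -> path_in X j.2.
Definition eval_chain (H : vectType k) (cl : point -> H) c : H := \sum_(i <- c) i.1 *: cl i.2.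
Definition scale_chain (A : Type) (a : k) (c : seq (k * A)) := [seq (a * i.1, i.2) | i <- c].

Lemma eval_chain_cat (H : vectType k) (cl : point -> H) c1 c2 :
  eval_chain cl (c1 ++ c2) = eval_chain cl c1 + eval_chain cl c2.
Proof. exact: big_cat. Qed.

Lemma eval_chain_scale (H : vectType k) (cl : point -> H) a c :
  eval_chain cl (scale_chain a c) = a *: eval_chain cl c.
Proof.
rewrite /eval_chain big_map scaler_sumr; by apply: eq_bigr => i _; rewrite scalerA.
Qed.

Lemma chain_in_cat c1 c2 : chain_in c1 -> chain_in c2 -> chain_in (c1 ++ c2).
Proof. by move=> h1 h2 i; rewrite mem_cat => /orP[/h1|/h2]. Qed.

Lemma chain_in_scale a c : chain_in c -> chain_in (scale_chain a c).
Proof. by move=> h _ /mapP[i ic ->]; apply: h ic. Qed.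

Lemma coef0_boundary b p : Defs.coef0 (boundary b) p =
  \sum_(j <- b) j.1 * ((j.2 1 == p)%:R - (j.2 0 == p)%:R).
Proof.
rewrite /Defs.coef0 /boundary big_cat /= !big_map [X in X + _]big_mkcond [X in _ + X]big_mkcond -big_split /=.
apply: eq_bigr => j _; rewrite mulrBr.
by case: (j.2 1 == p); case: (j.2 0 == p); rewrite /= ?mulr1 ?mulr0 ?subr0 ?addr0 ?sub0r ?add0r.
Qed.

Lemma sum_coef0 (u : point -> k) c (s : seq point) : uniq s -> (forall i, i \in c -> i.2 \in s) ->
  \sum_(p <- s) Defs.coef0 c p * u p = \sum_(i <- c) i.1 * u i.2.
Proof.
move=> us hs; under eq_bigr do rewrite /Defs.coef0 mulr_suml big_mkcond.
rewrite exchange_big /= big_seq [RHS]big_seq; apply: eq_bigr => i ic.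
rewrite (bigD1_seq i.2) ?hs //= eqxx big1 ?addr0 // => p np.
by rewrite eq_sym (negbTE np).
Qed.

(** Chains are lists with possible repetitions, equal as chains if their coefficients agree; a
    functional on points then takes the same value on both. *)
Lemma coef0_pairing (u : point -> k) c c' : Defs.coef0 c = Defs.coef0 c' ->
  \sum_(i <- c) i.1 * u i.2 = \sum_(i <- c') i.1 * u i.2.
Proof.
move=> e; pose s := undup (map snd (c ++ c')).
have us : uniq s by apply: undup_uniq.
rewrite -(sum_coef0 u us) ?e ?(sum_coef0 u us) // => i ic;
  by rewrite mem_undup map_f // mem_cat ic ?orbT.
Qed.

Lemma boundary_pairing (u : point -> k) b :
  \sum_(i <- boundary b) i.1 * u i.2 = \sum_(j <- b) j.1 * (u (j.2 1) - u (j.2 0)).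
Proof.
rewrite /boundary big_cat /= !big_map -big_split /=; apply: eq_bigr => j _.
by rewrite mulrBr mulNr.
Qed.

Section Uniqueness.
Variables (H H' : vectType k) (cl : point -> H) (cl' : point -> H').
Hypothesis h0 : is_H0 X cl.
Hypothesis h0' : is_H0 X cl'.

Lemma eval_chain_kernel c : chain_in c -> eval_chain cl c = 0 -> eval_chain cl' c = 0.
Proof. by move=> hc /(h0.2 c hc).1 hb; apply/(h0'.2 c hc). Qed.

Lemma eval_chain_eq c1 c2 : chain_in c1 -> chain_in c2 ->
  eval_chain cl c1 = eval_chain cl c2 -> eval_chain cl' c1 = eval_chain cl' c2.
Proof.
move=> h1 h2 e; have : eval_chain cl' (c1 ++ scale_chain (-1) c2) = 0.
  apply: eval_chain_kernel; first by apply: chain_in_cat => //; apply: chain_in_scale.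
  by rewrite eval_chain_cat eval_chain_scale e scaleN1r subrr.
by rewrite eval_chain_cat eval_chain_scale scaleN1r => /eqP; rewrite subr_eq0 => /eqP.
Qed.

(** For both quotients the kernel consists of the boundaries. The map is defined by choosing a chain
    for each vector; it is linear because the choice is immaterial. *)
Lemma H0_hom : exists phi : 'Hom(H, H'), forall c, chain_in c ->
  phi (eval_chain cl c) = eval_chain cl' c.
Proof.
have /choice[ch hch] : forall w, exists c, chain_in c /\ w = eval_chain cl c.
  by move=> w; have [c hc e] := h0.1 w; exists c.
pose phi w := eval_chain cl' (ch w).
have phiE c : chain_in c -> phi (eval_chain cl c) = eval_chain cl' c.
  by move=> hc; have [h1 h2] := hch (eval_chain cl c); apply: eval_chain_eq.
exists (linfun phi) => c hc; rewrite linfunE ?phiE // => a u v.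
have [u1 u2] := hch u; have [v1 v2] := hch v.
rewrite {1}u2 {1}v2 -eval_chain_scale -eval_chain_cat phiE ?eval_chain_cat ?eval_chain_scale //.
by apply: chain_in_cat => //; apply: chain_in_scale.
Qed.

End Uniqueness.

Lemma H0_iso (H H' : vectType k) (cl : point -> H) (cl' : point -> H') :
  is_H0 X cl -> is_H0 X cl' -> exists2 phi : 'Hom(H, H'), bijective phi &
    forall t, X t -> phi (cl t) = cl' t.
Proof.
move=> h h'; have [phi hphi] := H0_hom h h'; have [psi hpsi] := H0_hom h' h.
exists phi; last first.
  move=> t Xt; have := hphi [:: (1, t)]; rewrite /eval_chain !big_seq1 !scale1r; apply.
  by move=> i; rewrite inE => /eqP->.
exists psi => w.
  by have [c hc ->] := h.1 w; rewrite -/(eval_chain cl c) hphi // hpsi.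
by have [c hc ->] := h'.1 w; rewrite -/(eval_chain cl' c) hpsi // hphi.
Qed.

Definition homologous (t t' : point) : Prop := exists2 b, paths_in b &
  forall p, Defs.coef0 (boundary b) p = (t == p)%:R - (t' == p)%:R.

Lemma homologous_refl t : homologous t t.
Proof. by exists [::] => // p; rewrite coef0_boundary big_nil subrr. Qed.

Lemma homologous_sym t t' : homologous t t' -> homologous t' t.
Proof.
case=> b hb e; exists (scale_chain (-1) b) => [_ /mapP[j jb ->]|p]; first exact: hb jb.
rewrite coef0_boundary big_map -[RHS]opprB -e coef0_boundary -sumrN.
by apply: eq_bigr => j _; rewrite mulN1r mulNr.
Qed.

Lemma homologous_trans t' t t'' : homologous t t' -> homologous t' t'' -> homologous t t''.
Proof.
case=> b hb e [b' hb' e']; exists (b ++ b') => [j|p].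
  by rewrite mem_cat => /orP[/hb|/hb'].
by rewrite coef0_boundary big_cat /= -!coef0_boundary e e' addrA subrK.
Qed.

Lemma homologous_path g : path_in X g -> homologous (g 1) (g 0).
Proof.
move=> hg; exists [:: (1, g)] => [j|p]; first by rewrite inE => /eqP->.
by rewrite coef0_boundary big_seq1 mul1r.
Qed.

Section Classification.
Variables (T Q : quiver) (g : qmorph T Q) (q : Q) (cls : point -> option T).
Hypothesis cls_fiber : forall t, X t -> exists2 y, cls t = Some y & g y = q.
Hypothesis cls_onto : forall y, g y = q -> exists2 t, X t & cls t = Some y.
Hypothesis cls_path : forall gamma, path_in X gamma -> cls (gamma 1) = cls (gamma 0).
Hypothesis cls_homologous : forall t t', X t -> X t' -> cls t = cls t' -> homologous t t'.

Definition class_vector (t : point) : linearization k g q :=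
  if cls t is Some y then bas k g q y else 0.

Lemma co_class_vector t y : g y = q -> co y (class_vector t) = (cls t == Some y)%:R.
Proof.
move=> ey; rewrite /class_vector; case: (cls t) => [z|]; last by rewrite linear0.
by rewrite co_bas ey eqxx andbT eq_sym.
Qed.

Lemma co_eval_chain c y : g y = q ->
  co y (eval_chain class_vector c) = \sum_(i <- c) i.1 * (cls i.2 == Some y)%:R.
Proof.
move=> ey; rewrite linear_sum; apply: eq_bigr => i _.
by rewrite linearZ /= co_class_vector.
Qed.

(** A boundary pairs to zero with the indicator function of each class. Conversely, every point
    differs by a boundary from a base point [tau y] of its class; what remains of a chain is a
    combination of base points, whose coefficients are the coordinates of its value, hence 0. *)
Lemma linearization_H0 : is_H0 X class_vector.
Proof.
split=> [w|c hc].
  have /choice[tau htau] : forall y, exists t, g y = q -> X t /\ cls t = Some y.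
    move=> y; have [ey|ney] := pselect (g y = q); last by exists (fun=> 0).
    by have [t h1 h2] := cls_onto ey; exists t.
  exists [seq (co y w : k, tau y) | y <- enum T & g y == q].
    by move=> _ /mapP[y + ->]; rewrite mem_filter => /andP[/eqP/htau[]].
  rewrite {1}(bas_expand w) big_map big_filter big_enum_cond [RHS]big_mkcond /=.
  apply: eq_bigr => y _; case: eqP => [ey|/eqP ney]; last by rewrite co_out // scale0r.
  by rewrite /class_vector (htau y ey).2.
rewrite -/(eval_chain class_vector c); split=> [e0|[b hb e]]; last first.
  apply: co_inj => y ey; rewrite co_eval_chain // linear0.
  rewrite (coef0_pairing (fun t => (cls t == Some y)%:R) e).
  rewrite (boundary_pairing (fun t => (cls t == Some y)%:R)) big_seq big1 // => j jb.
  by rewrite (cls_path (hb j jb)) subrr mulr0.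
have /choice[tau htau] : forall y, exists t, g y = q -> X t /\ cls t = Some y.
  move=> y; have [ey|ney] := pselect (g y = q); last by exists (fun=> 0).
  by have [t h1 h2] := cls_onto ey; exists t.
have /choice[bt hbt] : forall t, exists b, X t -> paths_in b /\ forall y, cls t = Some y ->
    forall p, Defs.coef0 (boundary b) p = (t == p)%:R - (tau y == p)%:R.
  move=> t; have [Xt|nXt] := pselect (X t); last by exists [::].
  have [y ety ey] := cls_fiber Xt; have [Xty ety'] := htau y ey.
  have [|b hb eb] := cls_homologous Xt Xty; first by rewrite ety ety'.
  by exists b => _; split=> // z; rewrite ety => -[<-].
exists (flatten [seq scale_chain i.1 (bt i.2) | i <- c]).
  move=> j /flattenP[_ /mapP[i ic ->] /mapP[j' jb ->]].
  exact: (hbt i.2 (hc i ic)).1 jb.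
apply: funext => p; rewrite coef0_boundary big_flatten big_map.
pose F (o : option T) : k := if o is Some y then (tau y == p)%:R else 0.
transitivity (\sum_(i <- c) i.1 * ((i.2 == p)%:R - F (cls i.2))); last first.
  rewrite big_seq [RHS]big_seq; apply: eq_bigr => i ic; rewrite /scale_chain big_map /=.
  have [y ety ey] := cls_fiber (hc i ic).
  rewrite ety /= -((hbt i.2 (hc i ic)).2 y ety) coef0_boundary mulr_sumr.
  by apply: eq_bigr => j _; rewrite mulrA.
under eq_bigr do rewrite mulrBr.
rewrite sumrB [X in _ - X](_ : _ = 0) ?subr0.
  rewrite /Defs.coef0 big_mkcond; apply: eq_bigr => i _.
  by case: eqP; rewrite ?mulr1 ?mulr0.
transitivity (\sum_y \sum_(i <- c) i.1 * (cls i.2 == Some y)%:R * F (Some y)).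
  rewrite exchange_big /= big_seq [RHS]big_seq; apply: eq_bigr => i ic.
  have [y ety ey] := cls_fiber (hc i ic); rewrite (bigD1 y) //= ety eqxx mulr1.
  by rewrite big1 ?addr0 // => z /negbTE nz; rewrite (inj_eq Some_inj) eq_sym nz mulr0 mul0r.
rewrite big1 // => y _; rewrite -mulr_suml.
have [ey|ney] := pselect (g y = q); first by rewrite -co_eval_chain // e0 linear0 mul0r.
rewrite big_seq big1 ?mul0r // => i ic; have [z etz ez] := cls_fiber (hc i ic).
by rewrite etz; case: eqP => [[ezy]|_]; rewrite ?mulr0 //; case: ney; rewrite -ezy.
Qed.

End Classification.
End ZerothHomology.

Section WithinContinuity.
Local Open Scope classical_set_scope.
Local Open Scope ring_scope.

Lemma within_continuous_sum (R : realType) (I : finType) (A : set R) (P : pred I)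
    (F : I -> R -> R) : (forall i, {within A, continuous (F i)}) ->
  {within A, continuous (fun s => \sum_(i | P i) F i s)}.
Proof.
move=> hF; elim: (index_enum I) => [|i r IH] x.
  rewrite (_ : (fun s => _) = (fun=> 0)); first exact: cvg_cst.
  by apply: funext => s; rewrite big_nil.
have [Pi|nPi] := boolP (P i).
  rewrite (_ : (fun s => _) = (F i + (fun s => \sum_(j <- r | P j) F j s))).
    by apply: cvgD; [apply: hF|apply: IH].
  by apply: funext => s; rewrite big_cons Pi.
rewrite (_ : (fun s => _) = (fun s => \sum_(j <- r | P j) F j s)); first exact: IH.
by apply: funext => s; rewrite big_cons (negbTE nPi).
Qed.

End WithinContinuity.

(** * Path components of the realization *)

Section Realization.
Local Open Scope classical_set_scope.
Local Open Scope ring_scope.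
Variables (R : realType) (k : fieldType) (Q : quiver) (G : sgraph) (h : filtration Q G).
Hypothesis rQ : rooted_tree Q.
Let gQ := rooted_tree_graded rQ.
Let m := max_level h.
Variable fnd : nat -> G -> G.
Hypothesis fndV : valid_find h fnd.
Let MF := merge_forest h fnd.
Implicit Types (t : G -> R) (q : Q).

Lemma edge_leQ (e : gedge G) v q : v \in val e -> leQ (hE h e) q -> leQ (hV h v) q.
Proof. by move=> ve; apply: leQ_trans (hVE h ve). Qed.

Lemma leQ_alive v q : leQ (hV h v) q -> v \in alive h (level q) /\ (level q <= m)%N.
Proof.
move=> vq; have le := leQ_level gQ vq; split; first by rewrite inE.
exact: leq_trans le (level_le_max h v).
Qed.

Lemma fnd_edge (e : gedge G) u v q : leQ (hE h e) q -> u \in val e -> v \in val e ->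
  fnd (level q) u = fnd (level q) v.
Proof.
move=> eq ue ve; have [phi hphi] := uf_ok_exists h rQ.
have [uD lm] := leQ_alive (edge_leQ ue eq); have [vD _] := leQ_alive (edge_leQ ve eq).
apply/(fnd_connect fndV hphi lm uD vD); apply/connect1/edge_relP; exists e.
by rewrite leQ_level.
Qed.

Lemma support_nonempty q t : realization h q t -> exists v, t v != 0.
Proof.
case=> _ s1 _; apply/existsP; apply: contraT; rewrite negb_exists => /forallP z.
have /eqP := s1; rewrite big1 1?eq_sym ?oner_eq0 // => v _.
by apply/eqP; have := z v; rewrite negbK.
Qed.

Lemma support_class q t v : realization h q t -> t v != 0 ->
  leQ (hV h v) q /\ forall u, t u != 0 -> fnd (level q) u = fnd (level q) v.
Proof.
case=> _ _ [[w wq hw]|[e eq he]] nv.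
  by rewrite (hw v nv); split=> // u /hw ->.
by split=> [|u nu]; [apply: edge_leQ (he v nv) eq|apply: fnd_edge eq (he u nu) (he v nv)].
Qed.

(** The support of a point lies in a vertex or an edge, so the class does not depend on the vertex
    that is picked. On the realization the value is never [None]. *)
Definition point_class q t : option MF :=
  if [pick v | t v != 0] is Some v
  then [pick y : MF | vname y == (fnd (level q) v, level q)] else None.

Lemma point_classP q t v : realization h q t -> t v != 0 ->
  exists2 y, point_class q t = Some y & vname y = (fnd (level q) v, level q) /\ Defs.merge_map y = q.
Proof.
move=> ht nv; have [vq hu] := support_class ht nv.
have [vD lm] := leQ_alive vq; have [phi hphi] := uf_ok_exists h rQ.
rewrite /point_class; case: pickP => [w /hu->|/(_ v)]; last by rewrite nv.
have [y ey] : exists y : MF, vname y = (fnd (level q) v, level q).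
  apply: (vname_ex rQ fndV) => //; first exact: (fnd_alive fndV hphi lm vD).1.
  exact: (fnd_idem fndV hphi lm vD).
case: pickP => [y' /eqP ey'|/(_ y)]; last by rewrite ey eqxx.
exists y' => //; split=> //; rewrite merge_mapE ey' /= (fnd_ancestor gQ fndV hphi lm vD).
exact: ancestor_eq.
Qed.

Definition dirac_point (v : G) : G -> R := fun u => (u == v)%:R.

Lemma dirac_point_neq0 v u : dirac_point v u != 0 -> u = v.
Proof. by rewrite /dirac_point; case: (u =P v) => [//|_]; rewrite eqxx. Qed.

Lemma dirac_point_self v : dirac_point v v != 0.
Proof. by rewrite /dirac_point eqxx oner_eq0. Qed.

Lemma sum_dirac_point v : \sum_u dirac_point v u = 1.
Proof.
rewrite (bigD1 v) //= /dirac_point eqxx big1 ?addr0 // => u /negbTE->//.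
Qed.

Lemma dirac_point_in v q : leQ (hV h v) q -> realization h q (dirac_point v).
Proof.
move=> vq; split=> [u||]; [exact: ler0n|exact: sum_dirac_point|].
by left; exists v => // u; apply: dirac_point_neq0.
Qed.

(** The straight segment stays in the realization because both points are supported in the same
    edge. *)
Lemma homologous_segment q t t' (e : gedge G) : leQ (hE h e) q ->
  realization h q t -> realization h q t' ->
  (forall u, t u != 0 -> u \in val e) -> (forall u, t' u != 0 -> u \in val e) ->
  homologous k (realization h q) t t'.
Proof.
move=> eq [t0 t1 _] [t0' t1' _] te te'.
pose g (s : R) : G -> R := fun u => s * t u + (1 - s) * t' u.
have g1 : g 1 = t by apply: funext => u; rewrite /g mul1r subrr mul0r addr0.
have g0 : g 0 = t' by apply: funext => u; rewrite /g mul0r subr0 mul1r add0r.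
rewrite -g1 -g0; apply: homologous_path; split=> [s /andP[s0 s1]|u].
  split=> [u||].
  - by rewrite addr_ge0 // mulr_ge0 // subr_ge0.
  - by rewrite big_split /= -!mulr_sumr t1 t1' !mulr1 addrC subrK.
  right; exists e => // u; apply: contraR => ue.
  have z (w : G -> R) : (forall u, w u != 0 -> u \in val e) -> w u = 0.
    by move=> hw; apply/eqP; apply: contraR ue => /hw.
  by rewrite /g (z t te) (z t' te') !mulr0 addr0.
apply: continuous_subspaceT => s; apply: cvgD.
  by apply: cvgMr_tmp; apply: cvg_id.
by apply: cvgMr_tmp; apply: cvgB; [apply: cvg_cst|apply: cvg_id].
Qed.

Lemma homologous_dirac q t v : realization h q t -> t v != 0 ->
  homologous k (realization h q) t (dirac_point v).
Proof.
move=> ht nv; have [vq _] := support_class ht nv; have [_ s1 [[w wq hw]|[e eq he]]] := ht.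
  have ev := hw v nv; suff -> : t = dirac_point v by apply: homologous_refl.
  apply: funext => u; rewrite /dirac_point; case: eqP => [->|/eqP nuv].
    rewrite -s1 (bigD1 v) //= big1 ?addr0 // => x nx.
    by apply/eqP; apply: contraR nx => /hw ->; rewrite ev.
  by apply/eqP; apply: contraR nuv => /hw ->; rewrite ev.
apply: (homologous_segment eq ht (dirac_point_in vq) he) => u /dirac_point_neq0->.
exact: he.
Qed.

Lemma homologous_connect q v w : leQ (hV h v) q -> connect (edge_rel h (level q)) v w ->
  homologous k (realization h q) (dirac_point v) (dirac_point w).
Proof.
move=> vq /connectP[p]; elim: p v vq => [|u p IH] v vq /=.
  by move=> _ ->; apply: homologous_refl.
case/andP=> /edge_relP[e [le ve ue]] hp ew.
(* The vertices above [hV h v] form a chain, so the level of the edge decides whether it lies below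
   [q]. *)
have eq : leQ (hE h e) q by apply: (leQ_chain gQ (hVE h ve) vq le).
have uq := edge_leQ ue eq.
apply: homologous_trans (IH u uq hp ew).
by apply: (homologous_segment eq) => [||x /dirac_point_neq0->|x /dirac_point_neq0->] //;
  apply: dirac_point_in.
Qed.

Lemma point_class_homologous q t t' : realization h q t -> realization h q t' ->
  point_class q t = point_class q t' -> homologous k (realization h q) t t'.
Proof.
move=> ht ht'; have [v nv] := support_nonempty ht; have [w nw] := support_nonempty ht'.
have [y -> [ey _]] := point_classP ht nv; have [y' -> [ey' _]] := point_classP ht' nw.
case=> eyy; have [vq _] := support_class ht nv; have [wq _] := support_class ht' nw.
have [vD lm] := leQ_alive vq; have [wD _] := leQ_alive wq.
have [phi hphi] := uf_ok_exists h rQ.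
apply: homologous_trans (homologous_dirac ht nv) _.
apply: homologous_trans (homologous_sym (homologous_dirac ht' nw)).
apply: homologous_connect => //; apply/(fnd_connect fndV hphi lm vD wD).
by have := congr1 (@vname Q G h fnd) eyy; rewrite ey ey' => -[].
Qed.

Lemma point_class_onto q (y : MF) : Defs.merge_map y = q ->
  exists2 t, realization h q t & point_class q t = Some y.
Proof.
move=> ey; have [h1 h2 h3] := vname_rep rQ fndV y; have ly := level_merge_map rQ fndV y.
set v := (vname y).1 in h1 h2 h3.
have vq : leQ (hV h v) q.
  by apply/(leQ_ancestor gQ); rewrite -ey ly; split; [rewrite inE in h2|].
exists (dirac_point v); first exact: dirac_point_in.
have [z -> [ez _]] := point_classP (dirac_point_in vq) (dirac_point_self v).
congr Some; apply: (@vname_inj Q G h fnd).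
by rewrite ez (surjective_pairing (vname y)) -/v -ey ly h3.
Qed.

(* The mass that a point puts on a component is 0 or 1 and depends continuously
   on the point. *)
Lemma point_class_path q (g : R -> G -> R) : path_in (realization h q) g ->
  point_class q (g 1) = point_class q (g 0).
Proof.
case=> hX hc.
have in01 (s : R) : s \in `[0, 1] -> realization h q (g s).
  by rewrite in_itv /= => hs; apply: hX.
have X0 : realization h q (g 0) by apply: hX; rewrite lexx ler01.
have X1 : realization h q (g 1) by apply: hX; rewrite lexx ler01.
have [v nv] := support_nonempty X0; have [w nw] := support_nonempty X1.
pose l := level q; pose mass (t : G -> R) := \sum_(u | fnd l u == fnd l v) t u.
have massE t x : realization h q t -> t x != 0 -> mass t = (fnd l x == fnd l v)%:R.
  move=> ht nx; have [_ hu] := support_class ht nx; have [_ s1 _] := ht.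
  rewrite /mass; case: eqP => [e|/eqP ne].
    rewrite -s1 [RHS](bigID (fun u => fnd l u == fnd l v)) /= [X in _ + X]big1 ?addr0 // => u nu.
    by apply/eqP; apply: contraR nu => /hu eu; rewrite /l eu -/l e.
  by rewrite big1 // => u /eqP eu; apply/eqP; apply: contraR ne => /hu eux; rewrite /l -eux -/l eu.
have [y -> [ey _]] := point_classP X1 nw; have [y' -> [ey' _]] := point_classP X0 nv.
congr Some; apply: (@vname_inj Q G h fnd); rewrite ey ey'; congr (_, _).
apply/eqP/negPn/negP=> ne.
have mc : {within `[0, 1], continuous (fun s => mass (g s))} by apply: within_continuous_sum.
have [|c c01 e] := @IVT R (fun s => mass (g s)) 0 1 (1 / 2) ler01 mc.
  rewrite (massE _ _ X0 nv) (massE _ _ X1 nw) eqxx (negbTE ne) /=.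
  by rewrite ge_min le_max; apply/andP; split; apply/orP; [right|left]; lra.
have [x nx] := support_nonempty (in01 c c01).
move: e; rewrite (massE _ _ (in01 c c01) nx) => /(congr1 (fun z => z * 2)).
rewrite divfK ?pnatr_eq0 // -natrM => /eqP; rewrite (eqr_nat R _ 1).
by case: (fnd l x == fnd l v).
Qed.

Definition merge_class q (t : G -> R) : linearization k (merge_forest_over h fnd) q :=
  class_vector k (merge_forest_over h fnd) q (point_class q) t.

(** Naturality is the compatibility [fndS] of consecutive find operations: the arrow of the merge
    forest out of the class of a point at [source a] leads to its class at [target a]. *)
Lemma merge_forest_H0 : is_H0_rep R h (linearization k (merge_forest_over h fnd)).
Proof.
exists merge_class; split=> [q|a t ht].
  apply: linearization_H0.
  - move=> t ht; have [v nv] := support_nonempty ht.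
    by have [y e1 [_ e2]] := point_classP ht nv; exists y.
  - exact: point_class_onto.
  - exact: point_class_path.
  - exact: point_class_homologous.
have ht' : realization h (target a) t.
  have st := leQ_arrow a; have [t0 s1 ht2] := ht; split=> //.
  case: ht2 => [[v vq hv]|[e eq he]]; [left; exists v|right; exists e] => //;
    exact: leQ_trans st.
have [v nv] := support_nonempty ht; have [vq _] := support_class ht nv.
have [vD lm] := leQ_alive vq; have [phi hphi] := uf_ok_exists h rQ.
rewrite /merge_class /class_vector.
have [y -> [ey my]] := point_classP ht nv; have [y' -> [ey' my']] := point_classP ht' nv.
rewrite (levelS gQ) in ey vD lm.
have [b eb1 eb2] := merge_arrow_ex rQ fndV ey.
have eby : target b = y'.
  by apply: (@vname_inj Q G h fnd); rewrite eb2 ey' (fndS fndV hphi lm vD).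
rewrite -eb1 -eby; apply: map_at_bas; first exact: (merge_source_inj rQ).
by apply: (source_inj gQ); rewrite on_source eb1.
Qed.

(** The classes of points span, so naturality of the isomorphisms is checked on them. *)
Lemma H0_rep_iso (H : rep k Q) : is_H0_rep R h H ->
  rep_iso H (linearization k (merge_forest_over h fnd)).
Proof.
case=> cl [hcl ncl]; have [cl' [hcl' ncl']] := merge_forest_H0.
have ex q := cid2 (H0_iso (hcl q) (hcl' q)).
pose phi q := s2val (ex q).
have bij q : bijective (phi q) := s2valP (ex q).
have phiE q t : realization h q t -> phi q (cl q t) = cl' q t := s2valP' (ex q) t.
have nat (a : arrow Q) v : phi (target a) (map_at H a v) =
    map_at (linearization k (merge_forest_over h fnd)) a (phi (source a) v).
  have [c hc ->] := (hcl (source a)).1 v; rewrite !linear_sum big_seq [RHS]big_seq.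
  apply: eq_bigr => i /hc hi; rewrite !linearZ /= ncl // !phiE ?ncl' //.
  have [t0 s1 ht2] := hi; split=> //.
  by case: ht2 => [[u uq hu]|[e eq he]]; [left; exists u|right; exists e] => //;
    apply: leQ_trans (leQ_arrow a).
exact: (bijective_rep_iso (phi := RepHom nat)).
Qed.

End Realization.

(** * Restricting the filtration to its image *)

Section Restriction.
Variables (Q : quiver) (G : sgraph) (h : filtration Q G).
Hypothesis rQ : rooted_tree Q.
Let gQ := rooted_tree_graded rQ.
Let RQ := restricted_quiver h.
Implicit Types x y z : RQ.

Lemma restricted_root : exists r : RQ, sink (val r) /\ forall q : Q, leQ q (val r).
Proof.
case: rQ => tQ /eqP/cards1P[r er].
have sr : sink r by have := set11 r; rewrite -er inE.
have hr : r \in image_and_root h by rewrite inE sr.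
exists (exist (fun q => q \in image_and_root h) r hr); split=> //= q.
by have [y sy qy] := leQ_sink tQ q; have /set1P <- : y \in [set r] by rewrite -er inE.
Qed.

(** A vertex of largest level among those strictly above [x] covers [x], and it lies below [y] since
    the vertices above [x] form a chain. *)
Lemma next_restricted x y : leQ (val x) (val y) -> x != y ->
  exists2 b : arrow RQ, source b = x & leQ (val (target b)) (val y).
Proof.
move=> xy nxy.
pose P := fun z : RQ => (z != x) && leQ (val x) (val z).
have Py : P y by rewrite /P eq_sym nxy.
case: (arg_maxnP (fun z : RQ => level (val z)) Py) => z /andP[nzx xz] zmax.
have cov : covers (x, z).
  rewrite /covers /= eq_sym nzx xz /=; apply/forallP=> w; apply/implyP=> /andP[xw wz].
  have [//|nwx /=] := eqVneq w x; apply/eqP/val_inj.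
  have Pw : P w by rewrite /P nwx.
  case: (leQ_measure (level_target gQ) wz) => [//|lt].
  have le : level (val w) <= level (val z) := zmax w Pw.
  by rewrite leqNgt lt in le.
exists (exist (fun p => covers p) (x, z) cov) => //=.
have le : level (val y) <= level (val z) := zmax y Py.
exact: (leQ_chain gQ xz xy le).
Qed.

Lemma covers_leQ (b : arrow RQ) : leQ (val (source b)) (val (target b)) /\ source b != target b.
Proof. by case: b => -[x y] /= /and3P[]. Qed.

Lemma level_covers (b : arrow RQ) : level (val (target b)) < level (val (source b)).
Proof.
have [le ne] := covers_leQ b; case: (leQ_measure (level_target gQ) le) => [/val_inj e|//].
by rewrite e eqxx in ne.
Qed.

(** Two covers of the same vertex lie in a chain, so they are comparable and hence equal. *)
Lemma restricted_source_inj : injective (@source RQ).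
Proof.
have half (b c : arrow RQ) : source b = source c ->
    level (val (target c)) <= level (val (target b)) -> target b = target c.
  move=> e le; have [b1 nb] := covers_leQ b; have [c1 nc] := covers_leQ c.
  have bc : leQ (val (target b)) (val (target c)).
    by apply: (leQ_chain gQ b1 _ le); rewrite e.
  case: c e le c1 nc bc => -[x y] /= hc e _ _ _ bc; have /and3P[_ _ /forallP/(_ (target b))] := hc.
  rewrite /= -e b1 bc /= eq_sym (negbTE nb) /=; exact: eqP.
move=> b c e; have et : target b = target c.
  by case/orP: (leq_total (level (val (target c))) (level (val (target b)))) => /half ->.
apply: val_inj; move: e et; case: b c => -[x y] /= _ [[x' y'] /= _] -> ->; done.
Qed.

Lemma restricted_rooted_tree : rooted_tree RQ.
Proof.
have [r [sr hr]] := restricted_root.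
apply: (rooted_tree_criterion (lev := fun x => level (val x)) (r := r)).
- exact: restricted_source_inj.
- exact: level_covers.
move=> x sx; apply/eqP/negPn/negP=> nxr.
have [b eb _] := next_restricted (hr (val x)) nxr.
by move/negP: (introT (sinkPn x) (ex_intro _ b eb)).
Qed.

(** Following covers towards [y] lowers the level in each step, so the Hasse quiver generates the
    induced order. This makes the restriction of [h] a filtration. *)
Lemma leQ_restricted x y : leQ (val x) (val y) -> leQ x y.
Proof.
have [n] := ubnP (level (val x)); elim: n x => // n IH x ltn xy.
have [->|nxy] := eqVneq x y; first exact: leQ_refl.
have [b eb le] := next_restricted xy nxy.
apply: leQ_trans (IH (target b) _ le); first by rewrite -eb leQ_arrow.
by apply: leq_trans (level_covers b) _; rewrite eb -ltnS.
Qed.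

Lemma restriction_exists : exists h' : filtration RQ G, is_restriction h'.
Proof.
have inV v : hV h v \in image_and_root h by rewrite inE codom_f orbT.
have inE' e : hE h e \in image_and_root h by rewrite inE codom_f !orbT.
pose hV' v : RQ := exist (fun q => q \in image_and_root h) _ (inV v).
pose hE' e : RQ := exist (fun q => q \in image_and_root h) _ (inE' e).
have hVE' (e : gedge G) v : v \in val e -> leQ (hV' v) (hE' e).
  by move=> ve; apply: leQ_restricted; apply: hVE.
by exists (Filtration hVE').
Qed.

(** There are at most [1 + gsize G] vertices, the 1 being for the root, and no more arrows than
    vertices; a nonempty graph absorbs the 1. *)
Lemma restricted_size : 0 < gsize G -> qsize RQ <= 4 * gsize G.
Proof.
move=> g0; have ca : #|arrow RQ| <= #|RQ|.
  by rewrite -(card_codom restricted_source_inj) max_card.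
have cv : #|RQ| <= (1 + #|G|) + #|gedge G|.
  have [r [sr hr]] := restricted_root.
  rewrite card_sig; apply: leq_trans (_ : #|[set val r] :|: [set hV h v | v : G] :|: [set hE h e | e : gedge G]| <= _).
    apply: subset_leq_card; apply/fintype.subsetP=> q; rewrite !inE => /or3P[sq|/codomP[v ->]|/codomP[e ->]].
    - by rewrite (sink_leQ sq (hr q)) eqxx.
    - by rewrite imset_f ?orbT.
    - by rewrite [X in _ || X]imset_f ?orbT.
  apply: leq_trans (leq_card_setU _ _) _; apply: leq_add; last exact: leq_imset_card.
  apply: leq_trans (leq_card_setU _ _) _; rewrite cards1 leq_add2l; exact: leq_imset_card.
move: g0 cv ca; rewrite /qsize /gsize; move: (#|RQ|) (#|arrow RQ|) (#|G|) (#|gedge G|) => a b c d.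
by lia.
Qed.

End Restriction.

(** Correctness concerns every outcome that the choices in the algorithms allow, the time bounds a
    program that realizes one of them. The existence of [H] shows that the claim about homology is
    not vacuous. The last two parts bound the time for $Q$ of linear size, and after the restriction
    of the codomain that achieves this size. *)
Theorem theoremD (R : realType) (k : fieldType) :
  (exists c : nat, forall (Q T : quiver) (f : qmorph T Q),
     rooted_tree Q -> rooted_tree T -> root_to_root f ->
     [/\ forall S : {set arrow T}, prune_tree f S ->
           summands_of f S (linearization k f),
         prune_tree f [set b | b \in (run_prune_tree f).1]
       & (run_prune_tree f).2 <= c * qsize T ^ 2])
  /\
  (forall (Q : quiver) (G : sgraph) (h : filtration Q G), rooted_tree Q ->
     [/\ exists H : rep k Q, is_H0_rep R h H,
         forall H : rep k Q, is_H0_rep R h H ->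
           forall fnd : nat -> G -> G, valid_find h fnd ->
           forall S : {set arrow (merge_forest h fnd)}, prune_forest S ->
             summands_of (merge_forest_over h fnd) S H
       & exists2 fnd : nat -> G -> G, valid_find h fnd &
         exists2 S : {set arrow (merge_forest h fnd)}, prune_forest S &
           represents S (run_decompose_H0 h).1])
  /\
  (forall m : nat, exists c : nat,
     forall (Q : quiver) (G : sgraph) (h : filtration Q G),
       rooted_tree Q -> qsize Q <= m * gsize G ->
       (run_decompose_H0 h).2 <= c * gsize G ^ 2)
  /\
  (exists c : nat,
     forall (Q : quiver) (G : sgraph) (h : filtration Q G),
       rooted_tree Q -> 0 < gsize G ->
       rooted_tree (restricted_quiver h) /\
       exists2 h' : filtration (restricted_quiver h) G, is_restriction h' &
         (run_decompose_H0 h').2 <= c * gsize G ^ 2).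
Proof.
split; [|split; [|split]].
- exists 300 => Q T f rQ rT ff.
  have gT := rooted_tree_graded rT; have gQ := rooted_tree_graded rQ.
  (* [f] sends arrows to arrows and the root to the root, so the level of [f x] is a level function
     on [T]. *)
  have lev_f x : level (f x) = level x.
    apply: esym; apply: (level_lev (lev := fun x => level (f x))) => [b|{}x].
      by rewrite -on_source -on_target levelS.
    rewrite -sink_level; apply/idP/idP=> [/ff//|].
    apply: contraTT => /sinkPn[b <-]; apply/sinkPn; exists (on_arrow f b).
    exact: on_source.
  have level_f x y : f x = f y -> level x = level y by rewrite -!lev_f => ->.
  have [h1 h2] := run_prune_tree_spec f gT (source_inj gQ).
  split=> [S /(prune_tree_pruned gT level_f)||//].
    exact: (pruned_summands_of k gT (source_inj gQ) level_f ff).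
  exact: pruned_prune_tree.
- move=> Q G h rQ; have [phi hphi] := uf_ok_exists h rQ.
  split; last exact: (run_decompose_spec h rQ).1.
    by exists (linearization k (merge_forest_over h phi)); apply: merge_forest_H0 => //;
      apply: valid_of_uf_ok.
  move=> H hH fnd fndV S /(prune_forest_pruned rQ fndV) pS.
  have [gM _] := merge_forest_graded rQ fndV.
  have [ds ind] := pruned_summands_of k gM (source_inj (rooted_tree_graded rQ))
    (@merge_level_f _ _ _ rQ _ fndV) (merge_sink_f rQ fndV) pS.
  by split=> //; apply: direct_sum_iso ds; apply: (H0_rep_iso rQ fndV hH).
- by move=> m; exists (100 * m + 500) => Q G h rQ; apply: run_decompose_time.
(* 900 is [100 * 4 + 500], with the 4 of [restricted_size]. *)
exists 900 => Q G h rQ g0; split; first exact: restricted_rooted_tree.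
have [h' rh'] := restriction_exists h rQ; exists h' => //.
apply: (@run_decompose_time _ _ h' (restricted_rooted_tree h rQ) 4).
exact: (restricted_size h rQ g0).
Qed.
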